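(* Let $a>0$, $x>0$, $0<\theta<1$, let $k\geq 1$ be an odd integer, and let $\nu\in\mathbb{C}$ with $\Re(\nu)>0$. Then \begin{align*} &\left(\frac{a^2x}{4}\right)^{\frac{\nu}{2}+k+1}\sum_{n=1}^{\infty} n^{\nu/2}K_{\nu}(a\sqrt{nx})\sum_{d\mid n}d^k\cos\left(\frac{2\pi n\theta}{d}\right) =\frac{(-1)^{\frac{k+1}{2}}(2\pi)^{k+1}}{8}\Gamma(\nu+k+1)\bigl\{\zeta(-k,\theta)+\zeta(-k,1-\theta)\bigr\}\\ &\quad+\frac{(-1)^{\frac{k+1}{2}}(2\pi)^{k+1}}{4}\Gamma(\nu+k+1)\sum_{r=1}^{\infty}\sum_{m=0}^{\infty}\left\{\frac{(m+\theta)^k}{\left(\frac{16\pi^2}{a^2}\frac{r(m+\theta)}{x}+1\right)^{\nu+k+1}}+\frac{(m+1-\theta)^k}{\left(\frac{16\pi^2}{a^2}\frac{r(m+1-\theta)}{x}+1\right)^{\nu+k+1}}\right\}\\ &\quad-\frac{a^{2k+2}}{2^{2k+4}}\zeta(-k)\Gamma(\nu)x^{k+1}. \end{align*}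
   Context: $K_\nu$ denotes the modified Bessel function of the second kind of order $\nu$. $\zeta(s,\alpha)$ is the Hurwitz zeta function ($\sum_{n\ge0}(n+\alpha)^{-s}$ for $\Re s>1$, meromorphically continued to $\mathbb{C}$) and $\zeta(s)$ the Riemann zeta function. *)

(* Defs.v *)
From Stdlib Require Import Reals List ClassicalEpsilon.
From Coquelicot Require Import Coquelicot.
Import ListNotations.
Open Scope R_scope.

Definition Cexp (z : C) : C :=
  (exp (Re z) * cos (Im z), exp (Re z) * sin (Im z)).

Definition Rpow_C (b : R) (s : C) : C := Cexp (s * RtoC (ln b))%C.

Definition Ccosh (z : C) : C := ((Cexp z + Cexp (- z)) / 2)%C.

Definition Gamma (s : C) : C :=
  RInt_gen (V := C_R_CompleteNormedModule)
    (fun t => (Rpow_C t (s - 1) * RtoC (exp (- t)))%C)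
    (at_right 0) (Rbar_locally p_infty).

Definition BesselK (nu : C) (y : R) : C :=
  RInt_gen (V := C_R_CompleteNormedModule)
    (fun t => (RtoC (exp (- y * cosh t)) * Ccosh (nu * RtoC t))%C)
    (at_right 0) (Rbar_locally p_infty).

Definition is_hurwitz_continuation (alpha : R) (F : C -> C) : Prop :=
  (forall z : C, z <> RtoC 1 ->
     ex_derive (K := C_AbsRing) (V := C_NormedModule) F z) /\
  (forall s : C, 1 < Re s ->
     is_series (K := C_AbsRing) (V := C_NormedModule)
       (fun n => Rpow_C (INR n + alpha) (- s)%C) (F s)).

Definition hurwitz_zeta (s : C) (alpha : R) : C :=
  epsilon (inhabits (RtoC 0))
    (fun v => exists F, is_hurwitz_continuation alpha F /\ F s = v).

Definition riemann_zeta (s : C) : C := hurwitz_zeta s 1.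

Definition divisor_sum (n : nat) (f : nat -> R) : R :=
  fold_right Rplus 0
    (map f (filter (fun d => Nat.eqb (Nat.modulo n d) 0) (seq 1 n))).

(* Main.v *)
(** Put [c = a^2 x / 4]. Then [n^(nu/2) K_nu (a sqrt (n x))] is [c^(nu/2) / 2] times the integral of
    [t^(nu-1) exp (- c t - n / t)] over the half-line, and the powers on the right-hand side are Mellin
    integrals as well, so the theorem is the Mellin transform of a pointwise identity of modular type for
    [sum_n exp (- n y) sum_(d | n) d^k cos (2 pi n theta / d)]. Both sides of that identity are continuous
    in [theta], and they have the same Fourier coefficients, computed from the Lipschitz formula and from
    those of the Bernoulli polynomials; hence they agree. Finally [zeta (- k, alpha)] is
    [- B_(k+1)(alpha) / (k+1)] by Euler-Maclaurin summation; that any analytic continuation takes this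
    value follows by pulling back along [z |-> 1 + exp (exp z)] and using uniqueness of Fourier series once
    more, on vertical lines. *)

Require Import Defs.
From Stdlib Require Import Reals Lra Lia Psatz Factorial List ClassicalEpsilon.
From Coquelicot Require Import Coquelicot.
Open Scope R_scope.

(** With [n = d q] a term of the divisor sum has frequency [q] in [theta], so mode [m] of the
    Lambert series is half of the sum of [d^k exp (- d m y)]. The Lipschitz formula turns it into a
    sum over all integers [j] of [(m y + 2 pi i j)^(-k-1)]. Multiplication by a purely imaginary
    number exchanges [m] and [j]; after it the terms [j <> 0] are the modes of the double sum on the
    right-hand side. The term [j = 0] is left for the Bernoulli polynomial, that is for
    [zeta (- k, theta)], and the mode [m = 0] for [zeta (- k)]. As [k + 1] is even, the power of the
    imaginary factor is real, whence the sign [(-1)^((k+1)/2)]. The delicate point is the endpoint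
    [theta = 0]: Fourier uniqueness is applied to functions continuous on the closed interval, but
    for [k = 1] the terms [m = 0] of the double sum do not sum uniformly in [r] there. Their sum
    over [r] is therefore taken in closed form and continued to [0]. [hurwitz_zeta] is the value of
    an unspecified continuation, so its existence and its uniqueness both have to be proved. *)

Local Notation is_Cseries := (is_series (K := C_AbsRing) (V := C_NormedModule)) (only parsing).

(** * Series in normed modules and their termwise integration *)

Lemma plus_minus_cancel {G : AbelianGroup} (x y : G) : plus y (minus x y) = x.
Proof. unfold minus. rewrite (plus_comm x), plus_assoc, plus_opp_r. apply plus_zero_l. Qed.

Section NormedSeries.
Context {V : NormedModule R_AbsRing}.

Lemma norm_minus_sym (x y : V) : norm (minus x y) = norm (minus y x).
Proof. rewrite <- (opp_minus y x). apply norm_opp. Qed.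

Lemma is_series_eps (u : nat -> V) (l : V) :
  is_series u l <->
  forall eps, 0 < eps ->
    exists N, forall n, (N <= n)%nat -> norm (minus (sum_n u n) l) < eps.
Proof.
  pose proof (filterlim_locally_ball_norm (F := eventually) (sum_n u) l) as E.
  split.
  - intros H eps He. destruct (proj1 E H (mkposreal eps He)) as [N HN]. exists N.
    intros n Hn. exact (HN n Hn).
  - intros H. apply E. intros [eps He]. destruct (H eps He) as [N HN]. exists N.
    intros n Hn. exact (HN n Hn).
Qed.

Lemma norm_series_le (u : nat -> V) (b : nat -> R) (l : V) (B : R) :
  (forall n, norm (u n) <= b n) -> is_series b B -> is_series u l -> norm l <= B.
Proof.
  intros Hb HB Hl.
  assert (Hb0 : forall n, 0 <= b n)
    by (intros n; apply Rle_trans with (2 := Hb n); apply norm_ge_0).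
  apply le_epsilon; intros eps He.
  apply is_series_eps with (eps := eps) in Hl; auto. destruct Hl as [N HN].
  specialize (HN N (Nat.le_refl N)).
  rewrite <- (plus_minus_cancel l (sum_n u N)).
  apply Rle_trans with (1 := norm_triangle _ _). rewrite norm_minus_sym.
  apply Rplus_le_compat; [|lra].
  apply Rle_trans with (sum_n b N).
  - unfold sum_n. apply Rle_trans with (1 := norm_sum_n_m _ _ _).
    apply sum_n_m_le. intros; apply Hb.
  - rewrite <- (is_series_unique _ _ HB), sum_n_Reals.
    apply sum_incr; auto. apply is_series_Reals in HB.
    rewrite (is_series_unique b B); auto. apply is_series_Reals; auto.
Qed.

End NormedSeries.

Lemma is_series_tail (b : nat -> R) (B : R) :
  (forall n, 0 <= b n) -> is_series b B ->
  forall eps, 0 < eps -> exists N, forall n, (N <= n)%nat -> B - sum_n b n < eps.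
Proof.
  intros Hb HB eps He. apply is_series_eps with (eps := eps) in HB; auto. destruct HB as [N HN]. exists N.
  intros n Hn. specialize (HN n Hn).
  change (Rabs (sum_n b n + - B) < eps) in HN. apply Rabs_def2 in HN.
  change (B - sum_n b n < eps). lra.
Qed.

Section NormedSeries2.
Context {V : NormedModule R_AbsRing}.

Lemma norm_series_remainder (u : nat -> V) (b : nat -> R) (l : V) (B : R) (n : nat) :
  (forall n, norm (u n) <= b n) -> is_series b B -> is_series u l ->
  norm (minus (sum_n u n) l) <= B - sum_n b n.
Proof.
  intros Hb HB Hl. rewrite norm_minus_sym.
  apply norm_series_le with (fun k => u (S n + k)%nat) (fun k => b (S n + k)%nat).
  - intros; apply Hb.
  - apply (is_series_incr_n b (S n)); [apply Nat.lt_0_succ|]. simpl Nat.pred.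
    change (is_series b (B - sum_n b n + sum_n b n)).
    replace (B - sum_n b n + sum_n b n) with B by ring. exact HB.
  - apply (is_series_incr_n u (S n)); [apply Nat.lt_0_succ|]. simpl Nat.pred.
    rewrite plus_comm. replace (plus (sum_n u n) (minus l (sum_n u n))) with l.
    + exact Hl.
    + symmetry; apply (plus_minus_cancel (G := NormedModule.AbelianGroup R_AbsRing V)).
Qed.

Lemma is_RInt_sum_n (f : nat -> R -> V) (I : nat -> V) (a b : R) (n : nat) :
  (forall k, is_RInt (f k) a b (I k)) ->
  is_RInt (fun t => sum_n (fun k => f k t) n) a b (sum_n I n).
Proof.
  intros H. induction n as [|n IH].
  - rewrite sum_O. apply is_RInt_ext with (f := f 0%nat).
    + intros; rewrite sum_O; auto.
    + apply H.
  - rewrite sum_Sn.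
    apply is_RInt_ext with (f := fun t => plus (sum_n (fun k => f k t) n) (f (S n) t)).
    + intros; rewrite sum_Sn; auto.
    + apply is_RInt_plus; auto.
Qed.

End NormedSeries2.

Lemma is_RInt_series {V : CompleteNormedModule R_AbsRing} (f : nat -> R -> V) (b : nat -> R) (F : R -> V)
  (I : nat -> V) (x y : R) :
  x <= y -> ex_series b ->
  (forall n t, x <= t <= y -> norm (f n t) <= b n) ->
  (forall t, x <= t <= y -> is_series (fun n => f n t) (F t)) ->
  (forall n, is_RInt (f n) x y (I n)) ->
  exists L : V, is_series I L /\ is_RInt F x y L.
Proof.
  intros Hxy [B HB] Hf HF HI.
  (* [filterlim_RInt] asks for convergence uniform over the whole line, while the bounds hold on
     [[x, y]] only. Every function is replaced by zero outside, where convergence is trivial. *)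
  pose (cut := fun (h : R -> V) t =>
    if Rle_dec x t then if Rle_dec t y then h t else zero else zero).
  assert (Hcut : forall h t, x <= t <= y -> cut h t = h t).
  { intros h t [H1 H2]; unfold cut. destruct (Rle_dec x t); [|easy].
    destruct (Rle_dec t y); easy. }
  assert (Hb : forall n, 0 <= b n).
  { intros n. apply Rle_trans with (2 := Hf n x (conj (Rle_refl x) Hxy)).
    apply norm_ge_0. }
  destruct (filterlim_RInt
    (fun n => cut (fun t => sum_n (fun k => f k t) n)) x y eventually _
    (cut F) (fun n => sum_n I n)) as [L [HL1 HL2]].
  - intros n. apply is_RInt_ext with (f := fun t => sum_n (fun k => f k t) n).
    + intros t Ht. rewrite Rmin_left, Rmax_right in Ht by auto.
      rewrite Hcut; auto; lra.
    + exact (is_RInt_sum_n (V := CompleteNormedModule.NormedModule R_AbsRing V) f I x y n HI).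
  - apply filterlim_locally. intros eps.
    destruct (is_series_tail b B Hb HB eps (cond_pos eps)) as [N HN].
    exists N. intros n Hn t. apply (norm_compat1 (V := CompleteNormedModule.NormedModule R_AbsRing V)).
    assert (Hc : x <= t <= y \/ ~ (x <= t <= y)) by lra.
    destruct Hc as [Hc|Hc].
    + rewrite !Hcut by auto.
      apply Rle_lt_trans with (2 := HN n Hn).
      exact (norm_series_remainder (V := CompleteNormedModule.NormedModule R_AbsRing V) _ b _ B n (fun k => Hf k t Hc) HB (HF t Hc)).
    + assert (Hz : forall h, cut h t = zero).
      { intros h; unfold cut. destruct (Rle_dec x t); auto.
        destruct (Rle_dec t y); auto. exfalso; apply Hc; auto. }
      rewrite !Hz.
      rewrite (minus_eq_zero (G := NormedModule.AbelianGroup R_AbsRing (CompleteNormedModule.NormedModule R_AbsRing V))).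
      apply Rle_lt_trans with 0; [|apply cond_pos].
      right; exact (norm_zero (V := CompleteNormedModule.NormedModule R_AbsRing V)).
  - exists L; split; auto. apply is_RInt_ext with (2 := HL2).
    intros t Ht. rewrite Rmin_left, Rmax_right in Ht by auto.
    apply Hcut; lra.
Qed.

(** * Complex series and improper integrals over the half-line *)

Lemma norm_C_R (z : C) : norm (V := C_R_NormedModule) z = Cmod z.
Proof.
  unfold norm; simpl; unfold prod_norm, Cmod, norm; simpl; unfold abs; simpl.
  f_equal. rewrite !Rmult_1_r, <- !Rabs_mult, !Rabs_pos_eq; auto; apply Rle_0_sqr.
Qed.

(** Partial sums and neighbourhoods do not depend on the ring of scalars, so the two notions are
    convertible. Estimates for real normed modules thereby serve complex series. *)
Lemma is_series_C_R (u : nat -> C) (l : C) :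
  is_Cseries u l <->
  is_series (K := R_AbsRing) (V := C_R_NormedModule) u l.
Proof. split; intros H; exact H. Qed.

Lemma is_series_C_eps (u : nat -> C) (l : C) :
  is_Cseries u l <->
  forall eps, 0 < eps -> exists N, forall n, (N <= n)%nat ->
    Cmod (sum_n (G := C_AbelianMonoid) u n - l) < eps.
Proof.
  rewrite is_series_C_R, (is_series_eps (V := C_R_NormedModule)).
  split; intros H eps He; destruct (H eps He) as [N HN]; exists N; intros n Hn;
    specialize (HN n Hn); rewrite norm_C_R in *; exact HN.
Qed.

Lemma Cmod_series_le (u : nat -> C) (b : nat -> R) (l : C) (B : R) :
  (forall n, Cmod (u n) <= b n) -> is_series b B ->
  is_Cseries u l -> Cmod l <= B.
Proof.
  intros Hb HB Hl. rewrite <- norm_C_R.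
  apply (norm_series_le (V := C_R_NormedModule) u b l B); auto.
  intros n; rewrite norm_C_R; auto.
Qed.

Lemma ex_series_C_le (u : nat -> C) (b : nat -> R) :
  (forall n, Cmod (u n) <= b n) -> ex_series b ->
  exists l, is_Cseries u l.
Proof.
  intros Hb HB.
  destruct (ex_series_le (V := C_R_CompleteNormedModule) u b) as [l Hl]; auto.
  - intros n. change (norm (V := C_R_NormedModule) (u n) <= b n). rewrite norm_C_R; auto.
  - exists l. exact Hl.
Qed.

Definition is_CInt (f : R -> C) (a b : R) (I : C) : Prop :=
  is_RInt (V := C_R_NormedModule) f a b I.

Definition is_CInt_pos (f : R -> C) (I : C) : Prop :=
  is_RInt_gen (V := C_R_CompleteNormedModule) f (at_right 0) (Rbar_locally p_infty) I.

Lemma is_CInt_unique f a b I J : is_CInt f a b I -> is_CInt f a b J -> I = J.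
Proof.
  intros H H'. apply (is_RInt_unique (V := C_R_CompleteNormedModule)) in H.
  apply (is_RInt_unique (V := C_R_CompleteNormedModule)) in H'. congruence.
Qed.

Lemma Cmod_CInt_le f g a b I J :
  a <= b -> (forall t, a <= t <= b -> Cmod (f t) <= g t) ->
  is_CInt f a b I -> is_RInt g a b J -> Cmod I <= J.
Proof.
  intros Hab Hfg HI HJ. rewrite <- norm_C_R.
  apply (norm_RInt_le (V := C_R_NormedModule) f g a b); auto.
  intros; rewrite norm_C_R; auto.
Qed.

Lemma is_CInt_pos_eps (f : R -> C) (l : C) :
  is_CInt_pos f l <->
  forall eps, 0 < eps -> exists A, 0 < A /\ exists B, forall a b,
    0 < a < A -> B < b -> exists I, is_CInt f a b I /\ Cmod (I - l) < eps.
Proof.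
  unfold is_CInt_pos, is_RInt_gen. rewrite filterlimi_locally. split.
  - intros H eps He.
    (* The balls of the product structure on [C] are squares; [norm_factor] bounds the modulus in
       terms of their radius. *)
    pose (c := @norm_factor R_AbsRing C_R_NormedModule).
    assert (Hc : 0 < c) by apply norm_factor_gt_0.
    assert (He' : 0 < eps / c) by (apply Rdiv_lt_0_compat; auto).
    destruct (H (mkposreal _ He')) as [P Q [d Hd] [M HM] HPQ].
    exists d; split; [apply cond_pos|]. exists M. intros a b [Ha Ha'] Hb.
    destruct (HPQ a b) as [I [HI1 HI2]].
    + apply Hd; auto. unfold ball; simpl; unfold AbsRing_ball, abs, minus, plus, opp; simpl.
      apply Rabs_def1; lra.
    + apply HM; auto.
    + exists I; split; [exact HI1|].
      apply (norm_compat2 (V := C_R_NormedModule)) in HI2. fold c in HI2. simpl pos in HI2.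
      replace (c * (eps / c)) with eps in HI2 by (field; lra).
      rewrite norm_C_R in HI2. exact HI2.
  - intros H [eps He]. destruct (H eps He) as [A [HA [B HB]]].
    apply Filter_prod with (fun a => 0 < a < A) (fun b => B < b).
    + exists (mkposreal A HA). intros y Hy Hy'. split; auto.
      unfold ball in Hy; simpl in Hy; unfold AbsRing_ball, abs, minus, plus, opp in Hy;
        simpl in Hy. apply Rabs_def2 in Hy; lra.
    + exists B; auto.
    + intros a b Ha Hb. destruct (HB a b Ha Hb) as [I [H1 H2]]. exists I; split; [exact H1|].
      apply (norm_compat1 (V := C_R_NormedModule)). rewrite norm_C_R. exact H2.
Qed.

Lemma is_CInt_pos_unique (f : R -> C) (l l' : C) :
  is_CInt_pos f l -> is_CInt_pos f l' -> l = l'.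
Proof.
  unfold is_CInt_pos.
  intros H H'. apply is_RInt_gen_unique in H; [|typeclasses eauto..].
  apply is_RInt_gen_unique in H'; [|typeclasses eauto..]. congruence.
Qed.

(** A dominating function is given together with an explicit primitive and the limits of this
    primitive at both ends. Its improper integrability and the size of its two tails are then data,
    read off from [Phi]. *)
Definition primitive_pos (g Phi : R -> R) (P0 P1 : R) : Prop :=
  (forall t, 0 < t -> is_derive Phi t (g t) /\ continuous g t) /\
  (forall eps, 0 < eps -> exists A, 0 < A /\ forall t, 0 < t < A -> Rabs (Phi t - P0) < eps) /\
  (forall eps, 0 < eps -> exists B, forall t, B < t -> Rabs (Phi t - P1) < eps).

Lemma primitive_pos_RInt g Phi P0 P1 a b :
  primitive_pos g Phi P0 P1 -> 0 < a -> a <= b ->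
  is_RInt g a b (Phi b - Phi a).
Proof.
  intros [H _] Ha Hab. apply (is_RInt_derive Phi g);
    intros x Hx; rewrite Rmin_left, Rmax_right in Hx by auto; apply H; lra.
Qed.

Lemma is_CInt_Chasles f a b c I J :
  is_CInt f a b I -> is_CInt f b c J -> is_CInt f a c (I + J)%C.
Proof. intros H H'. exact (is_RInt_Chasles (V := C_R_NormedModule) f a b c I J H H'). Qed.

Lemma Cmod_minus_triangle (x y z : C) : Cmod (x - z) <= Cmod (x - y) + Cmod (y - z).
Proof. replace (x - z)%C with ((x - y) + (y - z))%C by ring. apply Cmod_triangle. Qed.

Lemma Cmod_minus_sym (x y : C) : Cmod (x - y) = Cmod (y - x).
Proof. replace (x - y)%C with (- (y - x))%C by ring. apply Cmod_opp. Qed.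

(** Integrals of [f] over compact pieces are bounded by increments of [Phi], so enlarging an
    interval changes the integral by at most the increments at its two ends, and the Cauchy
    criterion applies. The last clause bounds the tails without reference to [f], which makes them
    uniform over the terms of a series. *)
Lemma dominated_CInt_pos (f : R -> C) (g Phi : R -> R) (P0 P1 : R) :
  primitive_pos g Phi P0 P1 ->
  (forall a b, 0 < a -> a <= b -> exists I, is_CInt f a b I) ->
  (forall t, 0 < t -> Cmod (f t) <= g t) ->
  exists l : C, is_CInt_pos f l /\ Cmod l <= P1 - P0 /\
    forall a b I, 0 < a -> a <= b -> is_CInt f a b I ->
      Cmod (I - l) <= (P1 - Phi b) + (Phi a - P0).
Proof.
  intros HP Hex Hfg.
  assert (Hb : forall a b I, 0 < a -> a <= b -> is_CInt f a b I ->
             Cmod I <= Phi b - Phi a).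
  { intros a b I Ha Hab HI. eapply Cmod_CInt_le with (f := f) (g := g) (3 := HI); eauto.
    - intros; apply Hfg; lra.
    - eapply primitive_pos_RInt; eauto. }
  assert (Hmono : forall a b, 0 < a -> a <= b -> Phi a <= Phi b).
  { intros a b Ha Hab. destruct (Hex a b Ha Hab) as [I HI].
    specialize (Hb a b I Ha Hab HI). generalize (Cmod_ge_0 I); lra. }
  assert (Hcmp : forall a' a b b' I J, 0 < a' -> a' <= a -> a <= b -> b <= b' ->
     is_CInt f a b I -> is_CInt f a' b' J ->
     Cmod (I - J) <= (Phi b' - Phi b) + (Phi a - Phi a')).
  { intros a' a b b' I J H1 H2 H3 H4 HI HJ.
    destruct (Hex a' a) as [I1 HI1]; try lra. destruct (Hex b b') as [I2 HI2]; try lra.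
    assert (E : J = (I1 + I + I2)%C).
    { eapply is_CInt_unique; [exact HJ|].
      eapply is_CInt_Chasles; eauto. eapply is_CInt_Chasles; eauto. }
    rewrite Cmod_minus_sym.
    replace (J - I)%C with (I2 + I1)%C by (rewrite E; ring).
    apply Rle_trans with (1 := Cmod_triangle _ _).
    apply Rplus_le_compat; apply Hb; auto; lra. }
  destruct HP as [HP1 [HP2 HP3]].
  assert (HPlow : forall t, 0 < t -> P0 <= Phi t).
  { intros t Ht. apply le_epsilon; intros e He. destruct (HP2 e He) as [A [HA H]].
    assert (H1 : 0 < Rmin t (A/2)) by (apply Rmin_glb_lt; lra).
    specialize (H (Rmin t (A/2))).
    assert (H2 := Hmono (Rmin t (A/2)) t H1 (Rmin_l _ _)). generalize (Rmin_r t (A/2)); intros H3.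
    assert (H4 : Rabs (Phi (Rmin t (A / 2)) - P0) < e) by (apply H; lra).
    apply Rabs_def2 in H4. lra. }
  assert (HPup : forall t, 0 < t -> Phi t <= P1).
  { intros t Ht. apply le_epsilon; intros e He. destruct (HP3 e He) as [B H].
    specialize (H (Rmax t (B+1))).
    assert (H2 := Hmono t (Rmax t (B+1)) Ht (Rmax_l _ _)). generalize (Rmax_r t (B+1)); intros H3.
    assert (H4 : Rabs (Phi (Rmax t (B + 1)) - P1) < e) by (apply H; lra).
    apply Rabs_def2 in H4. lra. }
  pose (J := fun ab : R * R => RInt (V := C_R_CompleteNormedModule) f (fst ab) (snd ab)).
  assert (HJ : forall a b, 0 < a -> a <= b -> is_CInt f a b (J (a, b))).
  { intros a b Ha Hab. apply (RInt_correct (V := C_R_CompleteNormedModule)).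
    destruct (Hex a b Ha Hab) as [I HI]. exists I; exact HI. }
  assert (HC : exists l : C, filterlim J
            (filter_prod (at_right 0) (Rbar_locally p_infty))
            (locally (T := C_R_CompleteNormedModule) l)).
  { apply (filterlim_locally_cauchy (U := C_R_CompleteNormedModule)). intros [eps He]. simpl pos.
    destruct (HP2 (eps/8)) as [A [HA HPA]]; [lra|].
    destruct (HP3 (eps/8)) as [B HPB]; [lra|].
    exists (fun ab => 0 < fst ab < Rmin 1 A /\ Rmax 1 B < snd ab). split.
    - apply Filter_prod with (fun a => 0 < a < Rmin 1 A) (fun b => Rmax 1 B < b).
      + assert (HA' : 0 < Rmin 1 A) by (apply Rmin_glb_lt; lra).
        exists (mkposreal _ HA'). intros y Hy Hy'. split; auto.
        unfold ball in Hy; simpl in Hy; unfold AbsRing_ball, abs, minus, plus, opp in Hy;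
        simpl in Hy. apply Rabs_def2 in Hy; lra.
      + exists (Rmax 1 B); auto.
      + simpl; auto.
    - intros [a b] [a' b']; simpl fst; simpl snd; intros [[Ha1 Ha2] Hb2] [[Ha1' Ha2'] Hb2'].
      assert (Q1 := Rmin_l 1 A). assert (Q2 := Rmin_r 1 A).
      assert (Q3 := Rmax_l 1 B). assert (Q4 := Rmax_r 1 B).
      apply (norm_compat1 (V := C_R_NormedModule)). rewrite norm_C_R.
      change (Cmod (J (a', b') - J (a, b)) < eps).
      (* Neither interval need contain the other; both are compared with their hull [[a0, b0]]. *)
      pose (a0 := Rmin a a'). pose (b0 := Rmax b b').
      assert (R1 := Rmin_l a a'). assert (R2 := Rmin_r a a').
      assert (R3 := Rmax_l b b'). assert (R4 := Rmax_r b b').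
      assert (R5 : 0 < a0) by (apply Rmin_glb_lt; auto).
      fold a0 in R1, R2. fold b0 in R3, R4.
      apply Rle_lt_trans with (1 := Cmod_minus_triangle _ (J (a0, b0)) _).
      rewrite (Cmod_minus_sym (J (a0, b0))).
      assert (E1 : Rabs (Phi a - P0) < eps / 8) by (apply HPA; lra).
      assert (E2 : Rabs (Phi a' - P0) < eps / 8) by (apply HPA; lra).
      assert (E3 : Rabs (Phi b - P1) < eps / 8) by (apply HPB; lra).
      assert (E4 : Rabs (Phi b' - P1) < eps / 8) by (apply HPB; lra).
      assert (E5 : P0 <= Phi a0) by (apply HPlow; auto).
      assert (E6 : Phi b0 <= P1) by (apply HPup; lra).
      apply Rabs_def2 in E1. apply Rabs_def2 in E2. apply Rabs_def2 in E3. apply Rabs_def2 in E4.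
      assert (T1 : Cmod (J (a', b') - J (a0, b0)) <= (Phi b0 - Phi b') + (Phi a' - Phi a0)).
      { apply Hcmp; try lra; apply HJ; lra. }
      assert (T2 : Cmod (J (a, b) - J (a0, b0)) <= (Phi b0 - Phi b) + (Phi a - Phi a0)).
      { apply Hcmp; try lra; apply HJ; lra. }
      lra. }
  destruct HC as [l Hl]. exists l.
  assert (HG : is_CInt_pos f l).
  { apply is_CInt_pos_eps. intros eps He.
    apply (filterlim_locally_ball_norm (U := C_R_NormedModule)) with (eps := mkposreal eps He) in Hl.
    destruct Hl as [P Q [d Hd] [M HM] HPQ].
    exists (Rmin d 1). split. { apply Rmin_glb_lt; [apply cond_pos|lra]. }
    exists (Rmax M 1). intros a b [Ha Ha'] Hb'.
    assert (Q1 := Rmin_l d 1). assert (Q2 := Rmin_r d 1).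
    assert (Q3 := Rmax_l M 1). assert (Q4 := Rmax_r M 1).
    exists (J (a, b)). split. { apply HJ; lra. }
    rewrite <- norm_C_R. apply (HPQ a b).
    + apply Hd; auto. unfold ball; simpl; unfold AbsRing_ball, abs, minus, plus, opp; simpl.
      apply Rabs_def1; lra.
    + apply HM; lra. }
  assert (HE : forall a b I, 0 < a -> a <= b -> is_CInt f a b I ->
      Cmod (I - l) <= (P1 - Phi b) + (Phi a - P0)).
  { intros a b I Ha Hab HI. apply le_epsilon. intros eps He.
    destruct (proj1 (is_CInt_pos_eps f l) HG eps He) as [A [HA [B HB]]].
    pose (a' := Rmin a (A/2)). pose (b' := Rmax b (B+1)).
    assert (R1 := Rmin_l a (A/2)). assert (R2 := Rmin_r a (A/2)).
    assert (R3 := Rmax_l b (B+1)). assert (R4 := Rmax_r b (B+1)).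
    assert (R5 : 0 < a') by (apply Rmin_glb_lt; lra).
    fold a' in R1, R2. fold b' in R3, R4.
    destruct (HB a' b') as [J' [HJ1 HJ2]]; try lra.
    apply Rle_trans with (1 := Cmod_minus_triangle _ J' _).
    assert (T := Hcmp a' a b b' I J' R5 R1 Hab R3 HI HJ1).
    assert (E5 : P0 <= Phi a') by (apply HPlow; auto).
    assert (E6 : Phi b' <= P1) by (apply HPup; lra). lra. }
  split; [auto|split; auto].
  (* On the degenerate interval [[1, 1]] the two values of [Phi] cancel in the tail bound, which
     leaves [P1 - P0]. *)
  assert (HI0 : is_CInt f 1 1 0).
  { exact (is_RInt_point (V := C_R_NormedModule) f 1). }
  specialize (HE 1 1 _ ltac:(lra) ltac:(lra) HI0).
  rewrite Cmod_minus_sym in HE. replace (l - 0)%C with l in HE by ring. lra.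
Qed.

Lemma primitive_pos_scal g Phi P0 P1 c :
  0 <= c -> primitive_pos g Phi P0 P1 ->
  primitive_pos (fun t => c * g t) (fun t => c * Phi t) (c * P0) (c * P1).
Proof.
  intros Hc [H1 [H2 H3]]. split; [|split].
  - intros t Ht. destruct (H1 t Ht) as [Ha Hb]. split.
    + apply (is_derive_scal Phi t c); auto.
    + apply (continuous_scal_r c g); auto.
  - intros eps He. destruct (H2 (eps / (c + 1))) as [A [HA HB]].
    { apply Rdiv_lt_0_compat; lra. }
    exists A; split; auto. intros t Ht. specialize (HB t Ht).
    rewrite <- Rmult_minus_distr_l, Rabs_mult, (Rabs_pos_eq c) by auto.
    apply Rle_lt_trans with (c * (eps / (c + 1))).
    + apply Rmult_le_compat_l; lra.
    + apply Rmult_lt_reg_r with (c + 1); [lra|]. field_simplify; [|lra]. nra.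
  - intros eps He. destruct (H3 (eps / (c + 1))) as [A HB].
    { apply Rdiv_lt_0_compat; lra. }
    exists A. intros t Ht. specialize (HB t Ht).
    rewrite <- Rmult_minus_distr_l, Rabs_mult, (Rabs_pos_eq c) by auto.
    apply Rle_lt_trans with (c * (eps / (c + 1))).
    + apply Rmult_le_compat_l; lra.
    + apply Rmult_lt_reg_r with (c + 1); [lra|]. field_simplify; [|lra]. nra.
Qed.

Lemma is_CInt_series (f : nat -> R -> C) (b : nat -> R) (F : R -> C)
  (I : nat -> C) (x y : R) :
  x <= y -> ex_series b ->
  (forall n t, x <= t <= y -> Cmod (f n t) <= b n) ->
  (forall t, x <= t <= y -> is_Cseries (fun n => f n t) (F t)) ->
  (forall n, is_CInt (f n) x y (I n)) ->
  exists L : C, is_Cseries I L /\ is_CInt F x y L.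
Proof.
  intros Hxy Hb Hf HF HI.
  apply (is_RInt_series (V := C_R_CompleteNormedModule) f b F I x y Hxy Hb).
  - intros n t Ht. change (norm (V := C_R_NormedModule) (f n t) <= b n).
    rewrite norm_C_R; auto.
  - intros t Ht. exact (HF t Ht).
  - intros n. exact (HI n).
Qed.

Lemma is_series_nonneg (b : nat -> R) (B : R) :
  (forall n, 0 <= b n) -> is_series b B -> 0 <= B.
Proof.
  intros Hb HB. apply Rle_trans with (norm (V := R_NormedModule) B); [apply norm_ge_0|].
  apply (norm_series_le (V := R_NormedModule) b b B B); auto.
  intros n. change (Rabs (b n) <= b n). rewrite Rabs_pos_eq; auto; lra.
Qed.

(** On a compact interval [g] is bounded and the M-test applies; near [0] and infinity the error of
    the [n]-th term is at most [b n] times tails of [Phi] that do not depend on [n]. Integrability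
    of the sum on compact intervals is returned as well, because a sum produced here becomes a term
    of the next series when double sums are treated. *)
Lemma CInt_pos_series (f : nat -> R -> C) (b : nat -> R) (F : R -> C) (I : nat -> C)
  (g Phi : R -> R) (P0 P1 : R) :
  primitive_pos g Phi P0 P1 ->
  ex_series b ->
  (forall n x y, 0 < x -> x <= y -> exists J, is_CInt (f n) x y J) ->
  (forall n t, 0 < t -> Cmod (f n t) <= b n * g t) ->
  (forall n, 0 <= b n) ->
  (forall t, 0 < t -> is_Cseries (fun n => f n t) (F t)) ->
  (forall n, is_CInt_pos (f n) (I n)) ->
  (forall x y, 0 < x -> x <= y -> exists J, is_CInt F x y J) /\
  exists L : C, is_Cseries I L /\ is_CInt_pos F L.
Proof.
  intros HP Hb Hex Hf Hb0 HF HI.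
  assert (Hn : forall n, Cmod (I n) <= b n * (P1 - P0) /\
     forall x y J, 0 < x -> x <= y -> is_CInt (f n) x y J ->
       Cmod (J - I n) <= b n * ((P1 - Phi y) + (Phi x - P0))).
  { intros n. destruct (dominated_CInt_pos (f n) (fun t => b n * g t) _ _ _
      (primitive_pos_scal _ _ _ _ (b n) (Hb0 n) HP) (Hex n) (Hf n)) as [l [H1 [H2 H3]]].
    rewrite (is_CInt_pos_unique _ _ _ (HI n) H1). split.
    - lra.
    - intros x y J Hx Hxy HJ. specialize (H3 x y J Hx Hxy HJ). lra. }
  assert (Hfin : forall x y, 0 < x -> x <= y -> exists J : nat -> C, exists L,
     (forall n, is_CInt (f n) x y (J n)) /\
     is_Cseries J L /\ is_CInt F x y L).
  { intros x y Hx Hxy.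
    destruct (bounded_continuity (K := R_AbsRing) (V := R_NormedModule) g x y) as [M HM].
    { intros t Ht. apply (proj1 HP); lra. }
    pose (J := fun n => RInt (V := C_R_CompleteNormedModule) (f n) x y).
    assert (HJ : forall n, is_CInt (f n) x y (J n)).
    { intros n. apply (RInt_correct (V := C_R_CompleteNormedModule)).
      destruct (Hex n x y Hx Hxy) as [K HK]; exists K; exact HK. }
    exists J.
    destruct (is_CInt_series f (fun n => b n * M) F J x y Hxy) as [L [HL1 HL2]]; auto.
    - destruct Hb as [B HB]. exists (scal M B).
      apply is_series_ext with (fun n => scal M (b n)).
      + intros n; apply Rmult_comm.
      + apply (is_series_scal M b B HB).
    - intros n t Ht. apply Rle_trans with (b n * g t); [apply Hf; lra|].
      apply Rmult_le_compat_l; auto. specialize (HM t Ht).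
      apply Rle_trans with (1 := Rle_abs _). left; exact HM.
    - intros t Ht; apply HF; lra.
    - exists L; auto. }
  split.
  { intros x y Hx Hxy. destruct (Hfin x y Hx Hxy) as [J [L [_ [_ H]]]]. exists L; auto. }
  destruct Hb as [B HB].
  assert (HexI : exists L, is_Cseries I L).
  { apply ex_series_C_le with (fun n => b n * (P1 - P0)).
    - intros n; apply Hn.
    - exists (scal (P1 - P0) B). apply is_series_ext with (fun n => scal (P1 - P0) (b n)).
      + intros n; apply Rmult_comm.
      + apply (is_series_scal _ b B HB). }
  destruct HexI as [L HL]. exists L; split; auto.
  assert (HB0 : 0 <= B).
  { apply is_series_nonneg with (2 := HB); auto. }
  apply is_CInt_pos_eps. intros eps He.
  assert (He' : 0 < eps / (3 * (B + 1))) by (apply Rdiv_lt_0_compat; lra).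
  destruct HP as [_ [HP2 HP3]].
  destruct (HP2 _ He') as [A [HA HA']]. destruct (HP3 _ He') as [M HM].
  exists (Rmin A 1). split. { apply Rmin_glb_lt; lra. }
  exists (Rmax M 1). intros x y [Hx Hx'] Hy.
  assert (Q1 := Rmin_l A 1). assert (Q2 := Rmin_r A 1).
  assert (Q3 := Rmax_l M 1). assert (Q4 := Rmax_r M 1).
  destruct (Hfin x y Hx) as [J [K [HJ [HK1 HK2]]]]; [lra|].
  exists K; split; auto.
  (* Termwise the error is [b n] times the same two tails, so it adds up to these tails times [B].
     The denominator [3 * (B + 1)] makes room for both. *)
  assert (T : Cmod (K - L) <= ((P1 - Phi y) + (Phi x - P0)) * B).
  { apply Cmod_series_le with (fun n => (J n - I n)%C)
      (fun n => ((P1 - Phi y) + (Phi x - P0)) * b n).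
    - intros n. rewrite Rmult_comm. apply Hn; auto. lra.
    - apply (is_series_scal _ b B HB).
    - exact (is_series_minus J I K L HK1 HL). }
  apply Rle_lt_trans with (1 := T).
  specialize (HA' x ltac:(lra)). specialize (HM y ltac:(lra)).
  apply Rabs_def2 in HA'. apply Rabs_def2 in HM.
  apply Rle_lt_trans with ((2 * (eps / (3 * (B + 1)))) * B).
  - apply Rmult_le_compat_r; auto. lra.
  - apply Rmult_lt_reg_r with (3 * (B + 1)); [lra|]. field_simplify; [|lra]. nra.
Qed.

(** * The complex exponential and complex powers of positive reals *)

Lemma Cexp_plus (z w : C) : Cexp (z + w)%C = (Cexp z * Cexp w)%C.
Proof.
  unfold Cexp, Cmult, Re, Im; simpl. rewrite exp_plus, cos_plus, sin_plus. f_equal; ring.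
Qed.

Lemma Cexp_0 : Cexp 0 = 1.
Proof. unfold Cexp; simpl. rewrite exp_0, cos_0, sin_0. unfold RtoC. f_equal; ring. Qed.

Lemma Cmod_Cexp (z : C) : Cmod (Cexp z) = exp (Re z).
Proof.
  unfold Cmod, Cexp; simpl.
  replace (_ + _) with (exp (Re z) ^ 2 * ((sin (Im z))^2 + (cos (Im z))^2)) by ring.
  rewrite <- !Rsqr_pow2, sin2_cos2, Rmult_1_r. apply sqrt_Rsqr. left; apply exp_pos.
Qed.

Lemma Cexp_neq_0 (z : C) : Cexp z <> 0.
Proof. apply Cmod_gt_0. rewrite Cmod_Cexp. apply exp_pos. Qed.

Lemma Cexp_opp (z : C) : Cexp (- z)%C = (/ Cexp z)%C.
Proof.
  assert (H := Cexp_neq_0 z).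
  assert (E : (Cexp z * Cexp (- z) = 1)%C).
  { rewrite <- Cexp_plus, Cplus_opp_r. apply Cexp_0. }
  replace (Cexp (- z)) with (/ Cexp z * (Cexp z * Cexp (- z)))%C by (field; auto).
  rewrite E. ring.
Qed.

Lemma Cexp_RtoC (x : R) : Cexp (RtoC x) = RtoC (exp x).
Proof. unfold Cexp, RtoC; simpl. rewrite cos_0, sin_0. f_equal; ring. Qed.

Lemma Rpow_C_plus (b : R) (s t : C) : Rpow_C b (s + t)%C = (Rpow_C b s * Rpow_C b t)%C.
Proof. unfold Rpow_C. rewrite Cmult_plus_distr_r. apply Cexp_plus. Qed.

Lemma Rpow_C_neq_0 (b : R) (s : C) : Rpow_C b s <> 0.
Proof. apply Cexp_neq_0. Qed.

Lemma Rpow_C_mult (a b : R) (s : C) :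
  0 < a -> 0 < b -> Rpow_C (a * b) s = (Rpow_C a s * Rpow_C b s)%C.
Proof.
  intros Ha Hb. unfold Rpow_C. rewrite ln_mult, RtoC_plus, Cmult_plus_distr_l by auto.
  apply Cexp_plus.
Qed.

Lemma Cmod_Rpow_C (b : R) (s : C) : Cmod (Rpow_C b s) = Rpower b (Re s).
Proof.
  unfold Rpow_C, Rpower. rewrite Cmod_Cexp. f_equal. unfold Re; simpl. ring.
Qed.

Lemma Rpow_C_real (b x : R) : Rpow_C b (RtoC x) = RtoC (Rpower b x).
Proof. unfold Rpow_C, Rpower. rewrite <- RtoC_mult. apply Cexp_RtoC. Qed.

Lemma Rpow_C_INR (b : R) (n : nat) : 0 < b -> Rpow_C b (RtoC (INR n)) = RtoC (b ^ n).
Proof. intros. rewrite Rpow_C_real, Rpower_pow; auto. Qed.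

Lemma Rpow_C_1_r (b : R) : 0 < b -> Rpow_C b 1 = RtoC b.
Proof. intros. rewrite Rpow_C_real, Rpower_1; auto. Qed.

Lemma ex_CInt_continuous (f : R -> C) (a b : R) :
  (forall t, Rmin a b <= t <= Rmax a b -> continuous (fun t => Re (f t)) t) ->
  (forall t, Rmin a b <= t <= Rmax a b -> continuous (fun t => Im (f t)) t) ->
  exists I, is_CInt f a b I.
Proof.
  intros H1 H2.
  destruct (ex_RInt_continuous (V := R_CompleteNormedModule) (fun t => Re (f t)) a b H1) as [I1 HI1].
  destruct (ex_RInt_continuous (V := R_CompleteNormedModule) (fun t => Im (f t)) a b H2) as [I2 HI2].
  exists (I1, I2). apply is_RInt_fct_extend_pair; auto.
Qed.

Lemma is_CInt_scal f a b I (c : C) :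
  is_CInt f a b I -> is_CInt (fun t => c * f t)%C a b (c * I)%C.
Proof.
  intros H.
  assert (H1 := is_RInt_fct_extend_fst (U := R_NormedModule) (V := R_NormedModule) f a b I H).
  assert (H2 := is_RInt_fct_extend_snd (U := R_NormedModule) (V := R_NormedModule) f a b I H).
  apply is_RInt_fct_extend_pair; simpl.
  - apply (is_RInt_minus (V := R_NormedModule)); apply (is_RInt_scal (V := R_NormedModule)); auto.
  - apply (is_RInt_plus (V := R_NormedModule)); apply (is_RInt_scal (V := R_NormedModule)); auto.
Qed.

Lemma is_CInt_plus f g a b I J :
  is_CInt f a b I -> is_CInt g a b J -> is_CInt (fun t => f t + g t)%C a b (I + J)%C.
Proof. intros. exact (is_RInt_plus (V := C_R_NormedModule) f g a b I J H H0). Qed.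

Lemma is_CInt_ext f g a b I :
  (forall t, Rmin a b < t < Rmax a b -> f t = g t) -> is_CInt f a b I -> is_CInt g a b I.
Proof. intros. exact (is_RInt_ext (V := C_R_NormedModule) f g a b I H H0). Qed.

Lemma is_CInt_pos_scal f I (c : C) :
  is_CInt_pos f I -> is_CInt_pos (fun t => c * f t)%C (c * I)%C.
Proof.
  rewrite !is_CInt_pos_eps. intros H eps He.
  assert (Hc := Cmod_ge_0 c).
  destruct (H (eps / (Cmod c + 1))) as [A [HA [B HB]]].
  { apply Rdiv_lt_0_compat; lra. }
  exists A; split; auto. exists B; intros a b Ha Hb.
  destruct (HB a b Ha Hb) as [J [HJ1 HJ2]]. exists (c * J)%C; split.
  - apply is_CInt_scal; auto.
  - replace (c * J - c * I)%C with (c * (J - I))%C by ring. rewrite Cmod_mult.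
    apply Rle_lt_trans with (Cmod c * (eps / (Cmod c + 1))).
    + apply Rmult_le_compat_l; lra.
    + apply Rmult_lt_reg_r with (Cmod c + 1); [lra|]. field_simplify; [|lra]. nra.
Qed.

Lemma is_CInt_pos_plus f g I J :
  is_CInt_pos f I -> is_CInt_pos g J -> is_CInt_pos (fun t => f t + g t)%C (I + J)%C.
Proof.
  rewrite !is_CInt_pos_eps. intros H1 H2 eps He.
  destruct (H1 (eps / 2)) as [A [HA [B HB]]]; [lra|].
  destruct (H2 (eps / 2)) as [A' [HA' [B' HB']]]; [lra|].
  exists (Rmin A A'); split; [apply Rmin_glb_lt; auto|].
  exists (Rmax B B'); intros a b Ha Hb.
  assert (Q1 := Rmin_l A A'). assert (Q2 := Rmin_r A A').
  assert (Q3 := Rmax_l B B'). assert (Q4 := Rmax_r B B').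
  destruct (HB a b) as [K [HK1 HK2]]; try lra.
  destruct (HB' a b) as [L [HL1 HL2]]; try lra.
  exists (K + L)%C; split. { apply is_CInt_plus; auto. }
  replace (K + L - (I + J))%C with ((K - I) + (L - J))%C by ring.
  apply Rle_lt_trans with (1 := Cmod_triangle _ _). lra.
Qed.

Lemma is_CInt_pos_ext f g I :
  (forall t, 0 < t -> f t = g t) -> is_CInt_pos f I -> is_CInt_pos g I.
Proof.
  intros E. rewrite !is_CInt_pos_eps. intros H eps He.
  destruct (H eps He) as [A [HA [B HB]]].
  exists A; split; auto. exists (Rmax B A). intros a b Ha Hb.
  assert (Q3 := Rmax_l B A). assert (Q4 := Rmax_r B A).
  destruct (HB a b) as [J [HJ1 HJ2]]; try lra.
  exists J; split; auto. apply is_CInt_ext with (2 := HJ1).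
  intros t Ht. rewrite Rmin_left in Ht by lra. apply E; lra.
Qed.

(** * Majorants on the half-line *)

Lemma is_derive_Rpower_l (p t : R) :
  0 < t -> is_derive (fun t => Rpower t p) t (p * Rpower t (p - 1)).
Proof.
  intros Ht. unfold Rpower. auto_derive; auto.
  replace ((p - 1) * ln t) with (p * ln t + - ln t) by ring.
  rewrite exp_plus, exp_Ropp, exp_ln by auto. field; lra.
Qed.

Lemma Rpower_pos (x p : R) : 0 < Rpower x p.
Proof. apply exp_pos. Qed.

Lemma Rpower_mult_exp_le (p : R) :
  0 < p -> exists M, 0 < M /\ forall x, 0 < x -> Rpower x p * exp (- x) <= M.
Proof.
  (* The maximum of [x^p exp (- x)] is attained at [x = p]; the bound is [1 + u <= exp u] at
     [u = ln (x / p)]. *)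
  intros Hp. exists (exp (p * ln p - p)). split; [apply exp_pos|].
  intros x Hx. unfold Rpower. rewrite <- exp_plus.
  assert (H : p * ln x + - x <= p * ln p - p).
  { assert (Hxp : 0 < x / p) by (apply Rdiv_lt_0_compat; auto).
    assert (E := exp_ineq1_le (ln (x / p))). rewrite exp_ln in E by auto.
    unfold Rdiv in E at 1. rewrite ln_mult, ln_Rinv in E; auto using Rinv_0_lt_compat.
    apply Rmult_le_compat_l with (r := p) in E; [|lra].
    replace (p * (x / p)) with x in E by (field; lra). lra. }
  destruct H as [H|H]; [left; apply exp_increasing; auto|rewrite H; right; auto].
Qed.

Lemma exp_opp_le_Rpower (p : R) :
  0 < p -> exists M, 0 < M /\ forall x, 0 < x -> exp (- x) <= M * Rpower x (- p).
Proof.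
  intros Hp. destruct (Rpower_mult_exp_le p Hp) as [M [HM H]]. exists M; split; auto.
  intros x Hx. rewrite Rpower_Ropp.
  apply Rmult_le_reg_l with (Rpower x p); [apply Rpower_pos|].
  replace (Rpower x p * (M * / Rpower x p)) with M.
  - apply H; auto.
  - field. apply Rgt_not_eq, Rpower_pos.
Qed.

Lemma Rpower_le_compat (a b p : R) : 0 < a -> a <= b -> 0 <= p -> Rpower a p <= Rpower b p.
Proof. intros. apply Rle_Rpower_l; auto. Qed.

Lemma Rpower_small (s eps : R) :
  0 < s -> 0 < eps -> exists A, 0 < A /\ forall t, 0 < t < A -> Rpower t s < eps.
Proof.
  intros Hs He. exists (Rpower eps (/ s)). split; [apply Rpower_pos|].
  intros t [Ht1 Ht2].
  replace eps with (Rpower (Rpower eps (/ s)) s) at 1.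
  - unfold Rpower. apply exp_increasing. apply Rmult_lt_compat_l; auto.
    apply ln_increasing; auto.
  - rewrite Rpower_mult, Rinv_l, Rpower_1; lra.
Qed.

Lemma Rpower_large (s M : R) :
  0 < s -> 0 < M -> exists B, 0 < B /\ forall t, B < t -> M < Rpower t s.
Proof.
  intros Hs HM. exists (Rpower M (/ s)). split; [apply Rpower_pos|].
  intros t Ht. assert (H0 := Rpower_pos M (/ s)).
  replace M with (Rpower (Rpower M (/ s)) s) at 1.
  - unfold Rpower. apply exp_increasing. apply Rmult_lt_compat_l; auto.
    apply ln_increasing; auto.
  - rewrite Rpower_mult, Rinv_l, Rpower_1; lra.
Qed.

(** This is the derivative of [- 1 / (s (1 + t^s))]. It behaves like [t^(s-1)] at [0] and like
    [t^(-s-1)] at infinity, so up to a constant it dominates [t^(s-1) exp (- c t)], while its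
    primitive is elementary. *)
Definition majorant (s t : R) : R := Rpower t (s - 1) / (1 + Rpower t s) ^ 2.

Lemma primitive_majorant (s : R) :
  0 < s ->
  primitive_pos (majorant s) (fun t => - / s * / (1 + Rpower t s)) (- / s) 0.
Proof.
  intros Hs. assert (Hp : forall t, 0 < 1 + Rpower t s) by (intros t; generalize (Rpower_pos t s); lra).
  split; [|split].
  - intros t Ht. split.
    + evar_last.
      * apply is_derive_scal.
        apply (is_derive_inv (fun t => 1 + Rpower t s)).
        { apply (is_derive_plus (fun _ => 1) (fun t => Rpower t s)).
          - apply is_derive_const.
          - apply is_derive_Rpower_l; auto. }
        apply Rgt_not_eq, Hp.
      * unfold majorant, plus, zero; simpl. field. split; [apply Rgt_not_eq, Hp|lra].
    + apply (ex_derive_continuous (V := R_NormedModule)). unfold majorant, Rpower. auto_derive.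
      split; auto. split; auto. split; auto. apply Rgt_not_eq. specialize (Hp t).
      unfold Rpower in Hp. nra.
  - intros eps He. destruct (Rpower_small s (s * eps) Hs) as [A [HA H]]; [nra|].
    exists A; split; auto. intros t Ht. specialize (H t Ht). specialize (Hp t).
    assert (H0 := Rpower_pos t s).
    replace (- / s * / (1 + Rpower t s) - - / s) with (Rpower t s / (s * (1 + Rpower t s)))
      by (field; split; lra).
    assert (Hd : 0 < s * (1 + Rpower t s)) by nra.
    rewrite Rabs_pos_eq.
    + apply Rmult_lt_reg_r with (1 := Hd). unfold Rdiv. rewrite Rmult_assoc, Rinv_l by lra.
      assert (s * eps <= eps * (s * (1 + Rpower t s))); [|lra].
      assert (0 < s * eps * Rpower t s) by (apply Rmult_lt_0_compat; nra). nra.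
    + left; apply Rdiv_lt_0_compat; auto.
  - intros eps He. destruct (Rpower_large s (/ (s * eps)) Hs) as [B [HB H]].
    { apply Rinv_0_lt_compat; nra. }
    exists B. intros t Ht. specialize (H t Ht). specialize (Hp t).
    replace (- / s * / (1 + Rpower t s) - 0) with (- / (s * (1 + Rpower t s))) by (field; lra).
    rewrite Rabs_Ropp, Rabs_pos_eq by (left; apply Rinv_0_lt_compat; nra).
    assert (Hse : 0 < s * eps) by nra.
    apply Rmult_lt_reg_r with (s * (1 + Rpower t s)); [nra|].
    rewrite Rinv_l by nra.
    apply Rmult_lt_compat_l with (r := s * eps) in H; auto. rewrite Rinv_r in H by lra. nra.
Qed.

Lemma majorant_bound (s c : R) :
  0 < s -> 0 < c -> exists M, 0 < M /\
    forall t, 0 < t -> Rpower t (s - 1) * exp (- (c * t)) <= M * majorant s t.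
Proof.
  intros Hs Hc.
  destruct (Rpower_mult_exp_le (2 * s)) as [M [HM H]]; [lra|].
  pose (K := Rpower c (2 * s)). assert (HK : 0 < K) by apply Rpower_pos.
  (* From [(1 + x)^2 <= 2 + 2 x^2] with [x = t^s], together with [exp (- c t) <= 1] and
     [x^2 exp (- c t) <= M / K]. *)
  exists (2 + 2 * (M / K)).
  assert (HMK : 0 < M / K) by (apply Rdiv_lt_0_compat; auto).
  split; [lra|]. intros t Ht. unfold majorant.
  assert (H0 := Rpower_pos t (s - 1)). assert (H1 := Rpower_pos t s).
  set (x := Rpower t s) in *. set (e := exp (- (c * t))).
  assert (He : 0 < e) by apply exp_pos.
  assert (He1 : e <= 1).
  { unfold e. rewrite <- exp_0. left; apply exp_increasing. nra. }
  assert (Hx : x ^ 2 * e <= M / K).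
  { specialize (H (c * t) ltac:(nra)). rewrite <- (Rpower_mult_distr c t) in H by auto. fold K e in H.
    replace (x ^ 2) with (Rpower t (2 * s)).
    - apply Rmult_le_reg_l with K; auto. replace (K * (M / K)) with M by (field; lra). lra.
    - unfold x. replace (2 * s) with (s + s) by ring. rewrite Rpower_plus. ring. }
  assert (Hb : (1 + x) ^ 2 * e <= 2 + 2 * (M / K)).
  { apply Rle_trans with ((2 + 2 * x ^ 2) * e); [|lra].
    apply Rmult_le_compat_r; [lra|]. assert (0 <= (1 - x) ^ 2) by apply pow2_ge_0. lra. }
  apply Rmult_le_reg_r with ((1 + x) ^ 2); [apply pow_lt; lra|].
  unfold Rdiv. rewrite !Rmult_assoc, Rinv_l, Rmult_1_r by (apply Rgt_not_eq, pow_lt; lra).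
  rewrite (Rmult_comm e), (Rmult_comm _ (Rpower t (s - 1))). apply Rmult_le_compat_l; lra.
Qed.

Lemma RInt_gen_CInt_pos (f : R -> C) (I : C) :
  is_CInt_pos f I ->
  RInt_gen (V := C_R_CompleteNormedModule) f (at_right 0) (Rbar_locally p_infty) = I.
Proof.
  unfold is_CInt_pos. intros H. apply is_RInt_gen_unique in H; [exact H|typeclasses eauto..].
Qed.

Lemma continuous_C (f : R -> C) (t : R) :
  continuous (fun t => Re (f t)) t -> continuous (fun t => Im (f t)) t ->
  continuous (U := C_R_NormedModule) f t.
Proof.
  intros H1 H2. apply filterlim_locally. intros eps.
  generalize (proj1 (filterlim_locally _ _) H1 eps) (proj1 (filterlim_locally _ _) H2 eps).
  intros K1 K2. generalize (filter_and _ _ K1 K2). apply filter_imp.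
  intros x [Hx Hx']. split; auto.
Qed.

Lemma continuous_Rpow_C_Re (s : C) (h : R -> R) (t : R) :
  0 < t -> continuous h t ->
  continuous (fun t => Re (Rpow_C t s * RtoC (h t))%C) t /\
  continuous (fun t => Im (Rpow_C t s * RtoC (h t))%C) t.
Proof.
  intros Ht Hh.
  assert (H1 : continuous (fun t => Re (Rpow_C t s)) t).
  { apply (ex_derive_continuous (V := R_NormedModule)).
    unfold Rpow_C, Cexp, Re, Im; simpl. auto_derive. repeat split; auto. }
  assert (H2 : continuous (fun t => Im (Rpow_C t s)) t).
  { apply (ex_derive_continuous (V := R_NormedModule)).
    unfold Rpow_C, Cexp, Re, Im; simpl. auto_derive. repeat split; auto. }
  split.
  - apply continuous_ext with (fun t => Re (Rpow_C t s) * h t).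
    + intros x; unfold Re; simpl; ring.
    + apply (continuous_mult (fun t => Re (Rpow_C t s)) h); auto.
  - apply continuous_ext with (fun t => Im (Rpow_C t s) * h t).
    + intros x; unfold Im; simpl; ring.
    + apply (continuous_mult (fun t => Im (Rpow_C t s)) h); auto.
Qed.

Lemma ex_CInt_Rpow_C (s : C) (h : R -> R) (a b : R) :
  (forall t, 0 < t -> continuous h t) -> 0 < a -> a <= b ->
  exists I, is_CInt (fun t => Rpow_C t s * RtoC (h t))%C a b I.
Proof.
  intros Hh Ha Hab. apply ex_CInt_continuous; intros t Ht;
    rewrite Rmin_left in Ht by auto; assert (Ht0 : 0 < t) by lra.
  - exact (proj1 (continuous_Rpow_C_Re s h t Ht0 (Hh t Ht0))).
  - exact (proj2 (continuous_Rpow_C_Re s h t Ht0 (Hh t Ht0))).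
Qed.

Lemma Cmod_mellin_le (s : C) (c h M t : R) :
  0 < t -> 0 <= h <= exp (- (c * t)) ->
  Rpower t (Re s - 1) * exp (- (c * t)) <= M * majorant (Re s) t ->
  Cmod (Rpow_C t (s - 1) * RtoC h)%C <= M * majorant (Re s) t.
Proof.
  intros Ht Hh HM. rewrite Cmod_mult, Cmod_Rpow_C, Cmod_R, Rabs_pos_eq by lra.
  apply Rle_trans with (2 := HM).
  replace (Re (s - 1)%C) with (Re s - 1) by (unfold Re; simpl; ring).
  apply Rmult_le_compat_l; [left; apply Rpower_pos|lra].
Qed.

Lemma ex_mellin (s : C) (c : R) (h : R -> R) :
  0 < Re s -> 0 < c -> (forall t, 0 < t -> continuous h t) ->
  (forall t, 0 < t -> 0 <= h t <= exp (- (c * t))) ->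
  exists I, is_CInt_pos (fun t => Rpow_C t (s - 1) * RtoC (h t))%C I.
Proof.
  intros Hs Hc Hh Hb. destruct (majorant_bound (Re s) c Hs Hc) as [M [HM HM']].
  destruct (dominated_CInt_pos (fun t => Rpow_C t (s - 1) * RtoC (h t))%C _ _ _ _
     (primitive_pos_scal _ _ _ _ M (Rlt_le _ _ HM) (primitive_majorant (Re s) Hs)))
    as [l [Hl _]].
  - intros a b Ha Hab. apply ex_CInt_Rpow_C; auto.
  - intros t Ht. apply Cmod_mellin_le with c; auto.
  - exists l; auto.
Qed.

Lemma continuous_exp_lin (c t : R) : continuous (fun t => exp (- (c * t))) t.
Proof. apply (ex_derive_continuous (V := R_NormedModule)). auto_derive; auto. Qed.

Lemma is_CInt_comp_lin (f : R -> C) (p a b : R) (I : C) :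
  is_CInt f (p * a) (p * b) I -> is_CInt (fun t => RtoC p * f (p * t)%R)%C a b I.
Proof.
  intros H.
  assert (H' := is_RInt_comp_lin (V := C_R_NormedModule) f p 0 a b I).
  rewrite !Rplus_0_r in H'. specialize (H' H).
  apply (is_RInt_ext (V := C_R_NormedModule)) with (2 := H').
  intros t _. rewrite Rplus_0_r. unfold scal; simpl. unfold prod_scal, scal, Cmult; simpl.
  unfold mult; simpl. f_equal; ring.
Qed.

Lemma is_CInt_pos_dilate (f : R -> C) (p : R) (I : C) :
  0 < p -> is_CInt_pos f I -> is_CInt_pos (fun t => RtoC p * f (p * t)%R)%C I.
Proof.
  intros Hp. rewrite !is_CInt_pos_eps. intros H eps He.
  destruct (H eps He) as [A [HA [B HB]]]. exists (A / p).
  split; [apply Rdiv_lt_0_compat; auto|]. exists (B / p). intros a b [Ha Ha'] Hb.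
  destruct (HB (p * a) (p * b)) as [J [HJ1 HJ2]].
  - split; [nra|]. apply Rmult_lt_reg_l with (/ p); [apply Rinv_0_lt_compat; auto|].
    rewrite <- Rmult_assoc, Rinv_l by lra. unfold Rdiv in Ha'. lra.
  - apply Rmult_lt_reg_l with (/ p); [apply Rinv_0_lt_compat; auto|].
    rewrite <- Rmult_assoc, Rinv_l by lra. unfold Rdiv in Hb. lra.
  - exists J; split; auto. apply is_CInt_comp_lin; auto.
Qed.

(** * Mellin integrals giving the Gamma and Bessel functions *)

Lemma Gamma_mellin (s : C) (p : R) :
  0 < Re s -> 0 < p ->
  is_CInt_pos (fun t => Rpow_C t (s - 1) * RtoC (exp (- (p * t))))%C (Gamma s / Rpow_C p s)%C.
Proof.
  intros Hs Hp.
  destruct (ex_mellin s 1 (fun t => exp (- (1 * t))) Hs Rlt_0_1) as [I HI].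
  { intros; apply continuous_exp_lin. }
  { intros t Ht; split; [left; apply exp_pos|right; auto]. }
  assert (HI' : is_CInt_pos (fun t => Rpow_C t (s - 1) * RtoC (exp (- t)))%C I).
  { apply is_CInt_pos_ext with (2 := HI). intros t Ht. rewrite Rmult_1_l; auto. }
  assert (E : Gamma s = I).
  { exact (RInt_gen_CInt_pos _ _ HI'). }
  rewrite E. apply (is_CInt_pos_dilate _ p) in HI'; auto.
  apply (is_CInt_pos_scal _ _ (/ Rpow_C p s)) in HI'.
  unfold Cdiv. rewrite Cmult_comm.
  apply is_CInt_pos_ext with (2 := HI'). intros t Ht.
  rewrite Rpow_C_mult by auto.
  replace s with ((s - 1) + 1)%C at 1 by ring.
  rewrite Rpow_C_plus, Rpow_C_1_r by auto.
  assert (RtoC p <> 0) by (intros K; apply RtoC_inj in K; lra).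
  field. split; auto. apply Rpow_C_neq_0.
Qed.

Lemma is_CInt_sub_interval (f : R -> C) (a b c : R) (I : C) :
  a <= b <= c -> is_CInt f a c I ->
  exists J K, is_CInt f a b J /\ is_CInt f b c K /\ I = (J + K)%C.
Proof.
  intros H HI.
  assert (HE : ex_RInt (V := C_R_CompleteNormedModule) f a c) by (exists I; exact HI).
  destruct (ex_RInt_Chasles_1 (V := C_R_CompleteNormedModule) f a b c H HE) as [J HJ].
  destruct (ex_RInt_Chasles_2 (V := C_R_CompleteNormedModule) f a b c H HE) as [K HK].
  exists J, K; split; [exact HJ|split; [exact HK|]].
  apply (is_CInt_unique f a c); auto. apply is_CInt_Chasles with b; [exact HJ|exact HK].
Qed.

Lemma is_CInt_symmetrize (f : R -> C) (U : R) (I : C) :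
  0 <= U -> is_CInt f (- U) U I -> is_CInt (fun u => f u + f (- u)%R)%C 0 U I.
Proof.
  intros HU HI. destruct (is_CInt_sub_interval f (- U) 0 U I) as [J [K [HJ [HK E]]]]; auto; [lra|].
  rewrite E, Cplus_comm. apply is_CInt_plus; auto.
  apply is_CInt_ext with (fun y => - (- f (- y)%R))%C; [intros; ring|].
  replace J with (- (- J))%C by ring.
  apply (is_RInt_opp (V := C_R_NormedModule)).
  replace (- J)%C with (opp (G := C_R_NormedModule) J) by reflexivity.
  apply (is_RInt_swap (V := C_R_NormedModule)) in HJ.
  apply (is_RInt_comp_opp (V := C_R_NormedModule) f 0 U).
  rewrite Ropp_0. exact HJ.
Qed.

Lemma is_CInt_subst_exp (f : R -> C) (rho a b : R) (I : C) :
  0 < rho -> a <= b -> (forall t, 0 < t -> continuous (U := C_R_NormedModule) f t) ->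
  is_CInt f (rho * exp a) (rho * exp b) I ->
  is_CInt (fun u => RtoC (rho * exp u) * f (rho * exp u)%R)%C a b I.
Proof.
  intros Hr Hab Hf HI.
  assert (H := is_RInt_comp (V := C_R_CompleteNormedModule) f (fun u => rho * exp u)
     (fun u => rho * exp u) a b).
  apply (is_RInt_unique (V := C_R_CompleteNormedModule)) in HI. rewrite <- HI.
  apply (is_RInt_ext (V := C_R_NormedModule)) with
    (f := fun y => scal (rho * exp y) (f (rho * exp y))).
  - intros t _. unfold scal; simpl. unfold prod_scal, scal, Cmult; simpl.
    unfold mult; simpl. f_equal; ring.
  - apply H.
    + intros x _. apply Hf. apply Rmult_lt_0_compat; auto. apply exp_pos.
    + intros x _. split.
      * auto_derive; auto. ring.
      * apply (ex_derive_continuous (V := R_NormedModule)). auto_derive; auto.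
Qed.

Lemma Ccosh_bound (z : C) : Cmod (Ccosh z) <= exp (Rabs (Re z)).
Proof.
  unfold Ccosh. assert (H2 : RtoC 2 <> 0) by (intros K; apply RtoC_inj in K; lra).
  rewrite Cmod_div, Cmod_R, Rabs_pos_eq by (auto; lra).
  apply Rmult_le_reg_r with 2; [lra|]. unfold Rdiv. rewrite Rmult_assoc, Rinv_l by lra.
  rewrite Rmult_1_r. apply Rle_trans with (1 := Cmod_triangle _ _).
  rewrite !Cmod_Cexp.
  assert (Hm : forall x, x <= Rabs (Re z) -> exp x <= exp (Rabs (Re z))).
  { intros x [Hx|Hx]; [left; apply exp_increasing; auto|rewrite Hx; right; auto]. }
  assert (H3 := Hm (Re z) (Rle_abs _)).
  assert (H4 : exp (Re (- z)%C) <= exp (Rabs (Re z))).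
  { apply Hm. replace (Re (- z)%C) with (- Re z) by (unfold Re; simpl; ring).
    rewrite <- Rabs_Ropp. apply Rle_abs. }
  lra.
Qed.

(** The substitution [t = rho exp u] with [rho = sqrt (B / A)] balances the two exponents:
    [A t + B / t] becomes [2 sqrt (A B) cosh u]. Folding [u] with [- u] turns [exp (nu u)] into
    [2 cosh (nu u)], the integrand of [BesselK]. Convergence of the Bessel integral is deduced from
    that of the Mellin integral. *)
Lemma BesselK_mellin (nu : C) (A B : R) :
  0 < Re nu -> 0 < A -> 0 < B ->
  is_CInt_pos (fun t => Rpow_C t (nu - 1) * RtoC (exp (- (A * t)) * exp (- (B / t))))%C
    (2 * Rpow_C (sqrt (B / A)) nu * BesselK nu (2 * sqrt (A * B)))%C.
Proof.
  intros Hnu HA HB.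
  assert (HBA : 0 < B / A) by (apply Rdiv_lt_0_compat; auto).
  set (rho := sqrt (B / A)). set (y := 2 * sqrt (A * B)).
  assert (Hrho : 0 < rho) by (apply sqrt_lt_R0; auto).
  pose (h := fun t => exp (- (A * t)) * exp (- (B / t))).
  assert (Hh : forall t, 0 < t -> continuous h t).
  { intros t Ht. apply (ex_derive_continuous (V := R_NormedModule)).
    unfold h. auto_derive. repeat split; lra. }
  assert (Hh2 : forall t, 0 < t -> 0 <= h t <= exp (- (A * t))).
  { intros t Ht. unfold h. assert (0 < B / t) by (apply Rdiv_lt_0_compat; auto).
    assert (E1 := exp_pos (- (A * t))). assert (E2 := exp_pos (- (B / t))).
    assert (E3 : exp (- (B / t)) <= 1).
    { rewrite <- exp_0. left; apply exp_increasing; lra. }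
    split; nra. }
  destruct (ex_mellin nu A h Hnu HA Hh Hh2) as [I HI].
  fold h. pose (f := fun t => (Rpow_C t (nu - 1) * RtoC (h t))%C).
  pose (k := fun t => (RtoC (exp (- y * cosh t)) * Ccosh (nu * RtoC t))%C).
  assert (Hrho2 : A * rho = sqrt (A * B) /\ B / rho = sqrt (A * B)).
  { assert (Q1 : rho * rho = B / A) by (apply sqrt_sqrt; lra).
    assert (Q2 : sqrt (A * B) = A * rho).
    { apply sqrt_lem_1; try nra. replace (A * rho * (A * rho)) with (A * A * (rho * rho)) by ring.
      rewrite Q1. field; lra. }
    split; auto. rewrite Q2. apply Rmult_eq_reg_r with rho; [|lra].
    rewrite Rmult_assoc, Q1. field; split; lra. }
  destruct Hrho2 as [Hr1 Hr2].
  assert (Hfk : forall u, (RtoC (rho * exp u) * f (rho * exp u)%R +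
       RtoC (rho * exp (- u)) * f (rho * exp (- u))%R = (2 * Rpow_C rho nu) * k u)%C).
  { assert (Hone : forall u, (RtoC (rho * exp u) * f (rho * exp u)%R
        = Rpow_C rho nu * (Cexp (nu * RtoC u) * RtoC (exp (- y * cosh u))))%C).
    { intros u. assert (He := exp_pos u).
      assert (Hre : 0 < rho * exp u) by nra. unfold f.
      rewrite Cmult_assoc. rewrite <- (Rpow_C_1_r (rho * exp u)) at 1 by auto.
      rewrite <- Rpow_C_plus. replace (1 + (nu - 1))%C with nu by ring.
      rewrite Rpow_C_mult by auto.
      replace (Rpow_C (exp u) nu) with (Cexp (nu * RtoC u)) by (unfold Rpow_C; rewrite ln_exp; auto).
      rewrite <- Cmult_assoc. do 3 f_equal. unfold h. rewrite <- exp_plus. f_equal.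
      replace (B / (rho * exp u)) with ((B / rho) * / exp u) by (field; split; lra).
      rewrite <- Rmult_assoc, Hr1, Hr2, <- exp_Ropp. unfold y, cosh. field. }
    intros u. rewrite !Hone. unfold k, Ccosh.
    replace (cosh (- u)) with (cosh u) by (unfold cosh; rewrite Ropp_involutive; field).
    replace (nu * RtoC (- u))%C with (- (nu * RtoC u))%C by (rewrite RtoC_opp; ring).
    assert (H2 : RtoC 2 <> 0) by (intros K; apply RtoC_inj in K; lra).
    field; auto. }
  assert (Hkint : forall U J, 0 <= U -> is_CInt f (rho * exp (- U)) (rho * exp U) J ->
     is_CInt (fun u => 2 * Rpow_C rho nu * k u)%C 0 U J).
  { intros U J HU HJ. apply is_CInt_subst_exp in HJ; auto; try lra.
    - apply is_CInt_symmetrize in HJ; auto. apply is_CInt_ext with (2 := HJ).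
      intros; apply Hfk.
    - intros t Ht. apply continuous_C; [exact (proj1 (continuous_Rpow_C_Re (nu - 1) h t Ht (Hh t Ht)))|exact (proj2 (continuous_Rpow_C_Re (nu - 1) h t Ht (Hh t Ht)))]. }
  assert (H2r : (2 * Rpow_C rho nu <> 0)%C).
  { apply Cmult_neq_0; [intros K; apply RtoC_inj in K; lra|apply Rpow_C_neq_0]. }
  assert (HkI : is_CInt_pos k (I / (2 * Rpow_C rho nu))%C).
  { assert (HkI : is_CInt_pos (fun u => 2 * Rpow_C rho nu * k u)%C I).
    { set (w := (2 * Rpow_C rho nu)%C) in *.
      assert (Hy : 0 <= y) by (unfold y; generalize (sqrt_pos (A * B)); lra).
      apply is_CInt_pos_eps. intros eps He.
      assert (He2 : 0 < eps / 2) by lra.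
      destruct (proj1 (is_CInt_pos_eps _ _) HI _ He2) as [a0 [Ha0 [b0 Hb0]]].
      (* [M] bounds [w * k] on [[0, 1]]. Folding gives integrals from [0], whereas the improper
         integral starts at [a > 0]; the piece [[0, a]] costs at most [M * a]. *)
      pose (M := Cmod w * exp (Rabs (Re nu))).
      assert (HM : 0 <= M) by (apply Rmult_le_pos; [apply Cmod_ge_0|left; apply exp_pos]).
      exists (Rmin 1 (eps / 2 / (M + 1))).
      assert (HM1 : 0 < eps / 2 / (M + 1)) by (apply Rdiv_lt_0_compat; lra).
      split; [apply Rmin_glb_lt; lra|].
      (* [rho * exp (-U) < a0] and [b0 < rho * exp U] *)
      exists (Rmax 1 (Rmax (ln (rho / a0)) (ln (Rmax 1 b0 / rho)))). intros a U [Ha Ha'] HU.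
      assert (Q1 := Rmin_l 1 (eps / 2 / (M + 1))). assert (Q2 := Rmin_r 1 (eps / 2 / (M + 1))).
      assert (Q3 := Rmax_l 1 (Rmax (ln (rho / a0)) (ln (Rmax 1 b0 / rho)))).
      assert (Q4 := Rmax_r 1 (Rmax (ln (rho / a0)) (ln (Rmax 1 b0 / rho)))).
      assert (Q5 := Rmax_l (ln (rho / a0)) (ln (Rmax 1 b0 / rho))).
      assert (Q6 := Rmax_r (ln (rho / a0)) (ln (Rmax 1 b0 / rho))).
      assert (Q7 := Rmax_l 1 b0). assert (Q8 := Rmax_r 1 b0).
      destruct (Hb0 (rho * exp (- U)) (rho * exp U)) as [J [HJ1 HJ2]].
      - split. { apply Rmult_lt_0_compat; auto; apply exp_pos. }
        assert (E : exp (ln (rho / a0)) < exp U) by (apply exp_increasing; lra).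
        rewrite exp_ln in E by (apply Rdiv_lt_0_compat; auto).
        rewrite exp_Ropp. apply Rmult_lt_reg_r with (exp U); [apply exp_pos|].
        rewrite Rmult_assoc, Rinv_l by (apply Rgt_not_eq, exp_pos).
        apply Rmult_lt_compat_l with (r := a0) in E; auto.
        replace (a0 * (rho / a0)) with rho in E by (field; lra). lra.
      - assert (E : exp (ln (Rmax 1 b0 / rho)) < exp U) by (apply exp_increasing; lra).
        rewrite exp_ln in E by (apply Rdiv_lt_0_compat; lra).
        apply Rmult_lt_compat_l with (r := rho) in E; auto.
        replace (rho * (Rmax 1 b0 / rho)) with (Rmax 1 b0) in E by (field; lra). lra.
      - apply Hkint in HJ1; [|lra].
        destruct (is_CInt_sub_interval _ 0 a U _ ltac:(lra) HJ1) as [K [L [HK [HL E]]]].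
        exists L; split; auto.
        assert (HKb : Cmod K <= M * (a - 0)).
        { apply Cmod_CInt_le with (f := fun u => (w * k u)%C) (g := fun _ => M) (a := 0) (b := a); auto; [lra| |].
          - intros t Ht. unfold k. rewrite !Cmod_mult. unfold M.
            apply Rmult_le_compat_l; [apply Cmod_ge_0|].
            rewrite Cmod_R, Rabs_pos_eq by (left; apply exp_pos).
            rewrite <- (Rmult_1_l (exp (Rabs (Re nu)))).
            apply Rmult_le_compat; [left; apply exp_pos|apply Cmod_ge_0| |].
            + rewrite <- exp_0. assert (0 < cosh t) by (unfold cosh; generalize (exp_pos t) (exp_pos (-t)); lra).
              destruct (Req_dec y 0) as [Ey|Ey]; [rewrite Ey, Ropp_0, Rmult_0_l; right; auto|].
              left; apply exp_increasing. nra.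
            + apply Rle_trans with (1 := Ccosh_bound _).
              replace (Re (nu * RtoC t)%C) with (Re nu * t) by (unfold Re; simpl; ring).
              rewrite Rabs_mult, (Rabs_pos_eq t) by lra.
              assert (Hr := Rabs_pos (Re nu)).
              assert (Ht1 : Rabs (Re nu) * t <= Rabs (Re nu)) by nra.
              destruct Ht1 as [Ht1|Ht1]; [left; apply exp_increasing; auto|rewrite Ht1; right; auto].
          - replace (M * (a - 0)) with (scal (V := R_NormedModule) (a - 0) M) by (unfold scal; simpl; unfold mult; simpl; ring).
            apply (is_RInt_const (V := R_NormedModule)). }
        replace (L - I)%C with ((J - I) - K)%C by (rewrite E; ring).
        apply Rle_lt_trans with (1 := Cmod_triangle _ _). rewrite Cmod_opp.
        assert (M * (a - 0) <= eps / 2); [|lra].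
        apply Rle_trans with (M * (eps / 2 / (M + 1))).
        + apply Rmult_le_compat_l; lra.
        + apply Rmult_le_reg_r with (M + 1); [lra|]. field_simplify; [|lra]. nra. }
    apply (is_CInt_pos_scal _ _ (/ (2 * Rpow_C rho nu))) in HkI.
    unfold Cdiv. rewrite Cmult_comm. apply is_CInt_pos_ext with (2 := HkI).
    intros t _. field. apply Rpow_C_neq_0. }
  assert (E : BesselK nu y = (I / (2 * Rpow_C rho nu))%C).
  { exact (RInt_gen_CInt_pos _ _ HkI). }
  rewrite E.
  replace (2 * Rpow_C rho nu * (I / (2 * Rpow_C rho nu)))%C with I; auto.
  field. apply Rpow_C_neq_0.
Qed.

(** * Uniqueness of Fourier series on the unit interval *)

Definition cos_mode (m : nat) (t : R) : R := cos (2 * PI * INR m * t).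
Definition sin_mode (m : nat) (t : R) : R := sin (2 * PI * INR m * t).

Lemma cos_mode_S m t :
  cos_mode (S m) t = cos_mode m t * cos (2 * PI * t) - sin_mode m t * sin (2 * PI * t).
Proof.
  unfold cos_mode, sin_mode. rewrite S_INR.
  replace (2 * PI * (INR m + 1) * t) with (2 * PI * INR m * t + 2 * PI * t) by ring.
  apply cos_plus.
Qed.

Lemma sin_mode_S m t :
  sin_mode (S m) t = sin_mode m t * cos (2 * PI * t) + cos_mode m t * sin (2 * PI * t).
Proof.
  unfold cos_mode, sin_mode. rewrite S_INR.
  replace (2 * PI * (INR m + 1) * t) with (2 * PI * INR m * t + 2 * PI * t) by ring.
  apply sin_plus.
Qed.

Lemma cos_mode_0 t : cos_mode 0 t = 1.
Proof. unfold cos_mode; simpl. rewrite Rmult_0_r, Rmult_0_l. apply cos_0. Qed.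

Lemma sin_mode_0 t : sin_mode 0 t = 0.
Proof. unfold sin_mode; simpl. rewrite Rmult_0_r, Rmult_0_l. apply sin_0. Qed.

Lemma is_RInt_ext_R (f g : R -> R) (a b I : R) :
  (forall t, Rmin a b < t < Rmax a b -> f t = g t) -> is_RInt f a b I -> is_RInt g a b I.
Proof. exact (is_RInt_ext (V := R_NormedModule) f g a b I). Qed.

Definition orthogonal_modes (f : R -> R) : Prop :=
  forall m, is_RInt (fun t => f t * cos_mode m t) 0 1 0 /\
            is_RInt (fun t => f t * sin_mode m t) 0 1 0.

Lemma is_RInt_0_lincomb (f g : R -> R) (a b : R) :
  is_RInt f 0 1 0 -> is_RInt g 0 1 0 -> is_RInt (fun t => a * f t + b * g t) 0 1 0.
Proof.
  intros Hf Hg.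
  assert (H : is_RInt (fun t => a * f t + b * g t) 0 1 (a * 0 + b * 0)).
  { exact (is_RInt_plus (V := R_NormedModule) _ _ _ _ _ _
      (is_RInt_scal (V := R_NormedModule) f 0 1 a 0 Hf) (is_RInt_scal (V := R_NormedModule) g 0 1 b 0 Hg)). }
  replace (a * 0 + b * 0) with 0 in H by ring. exact H.
Qed.

(** Multiplication by [cos (2 pi t)] replaces mode [m + 1] by the average of the modes [m] and
    [m + 2]. Mode [0] is treated apart, having no lower neighbour. *)
Lemma orthogonal_modes_mult_cos (f : R -> R) :
  orthogonal_modes f -> orthogonal_modes (fun t => cos (2 * PI * t) * f t).
Proof.
  intros H m. destruct m as [|m].
  - split.
    + apply is_RInt_ext_R with (2 := proj1 (H 1%nat)). intros t _.
      rewrite cos_mode_S, cos_mode_0, sin_mode_0. ring.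
    + apply is_RInt_ext_R with (2 := proj2 (H 0%nat)). intros t _.
      rewrite sin_mode_0. ring.
  - split.
    + apply is_RInt_ext_R with (2 := is_RInt_0_lincomb _ _ (1/2) (1/2)
        (proj1 (H m)) (proj1 (H (S (S m))))).
      intros t _. rewrite ?cos_mode_S, ?sin_mode_S, ?cos_mode_S, ?sin_mode_S.
      assert (E := sin2_cos2 (2 * PI * t)). unfold Rsqr in E.
      (* Everything is expanded in mode [m]; the factor [sin^2 + cos^2], inserted in the one term
         left unexpanded, makes both sides equal as polynomials. *)
      replace (1 / 2 * (f t * cos_mode m t)) with
        (1 / 2 * (f t * cos_mode m t) * (sin (2 * PI * t) * sin (2 * PI * t) + cos (2 * PI * t) * cos (2 * PI * t)))
        by (rewrite E; ring).
      field.
    + apply is_RInt_ext_R with (2 := is_RInt_0_lincomb _ _ (1/2) (1/2)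
        (proj2 (H m)) (proj2 (H (S (S m))))).
      intros t _. rewrite ?sin_mode_S, ?cos_mode_S, ?sin_mode_S, ?cos_mode_S.
      assert (E := sin2_cos2 (2 * PI * t)). unfold Rsqr in E.
      replace (1 / 2 * (f t * sin_mode m t)) with
        (1 / 2 * (f t * sin_mode m t) * (sin (2 * PI * t) * sin (2 * PI * t) + cos (2 * PI * t) * cos (2 * PI * t)))
        by (rewrite E; ring).
      field.
Qed.

Lemma orthogonal_modes_mult_sin (f : R -> R) :
  orthogonal_modes f -> orthogonal_modes (fun t => sin (2 * PI * t) * f t).
Proof.
  intros H m. destruct m as [|m].
  - split.
    + apply is_RInt_ext_R with (2 := proj2 (H 1%nat)). intros t _.
      rewrite sin_mode_S, cos_mode_0, sin_mode_0. ring.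
    + apply is_RInt_ext_R with (2 := proj2 (H 0%nat)). intros t _.
      rewrite !sin_mode_0. ring.
  - split.
    + apply is_RInt_ext_R with (2 := is_RInt_0_lincomb _ _ (-1/2) (1/2)
        (proj2 (H m)) (proj2 (H (S (S m))))).
      intros t _. rewrite ?sin_mode_S, ?cos_mode_S, ?sin_mode_S, ?cos_mode_S.
      assert (E := sin2_cos2 (2 * PI * t)). unfold Rsqr in E.
      replace (-1 / 2 * (f t * sin_mode m t)) with
        (-1 / 2 * (f t * sin_mode m t) * (sin (2 * PI * t) * sin (2 * PI * t) + cos (2 * PI * t) * cos (2 * PI * t)))
        by (rewrite E; ring).
      field.
    + apply is_RInt_ext_R with (2 := is_RInt_0_lincomb _ _ (1/2) (-1/2)
        (proj1 (H m)) (proj1 (H (S (S m))))).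
      intros t _. rewrite ?sin_mode_S, ?cos_mode_S, ?sin_mode_S, ?cos_mode_S.
      assert (E := sin2_cos2 (2 * PI * t)). unfold Rsqr in E.
      replace (1 / 2 * (f t * cos_mode m t)) with
        (1 / 2 * (f t * cos_mode m t) * (sin (2 * PI * t) * sin (2 * PI * t) + cos (2 * PI * t) * cos (2 * PI * t)))
        by (rewrite E; ring).
      field.
Qed.

(* The trigonometric polynomials [bump t0 ^ N] concentrate at [t0]. *)
Definition bump (t0 t : R) : R := (1 + cos (2 * PI * (t - t0))) / 2.

Lemma orthogonal_modes_bump (f : R -> R) (t0 : R) (N : nat) :
  orthogonal_modes f -> orthogonal_modes (fun t => bump t0 t ^ N * f t).
Proof.
  intros H. induction N as [|N IH].
  - intros m; split; [apply is_RInt_ext_R with (2 := proj1 (H m))|apply is_RInt_ext_R with (2 := proj2 (H m))];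
      intros t _; simpl; ring.
  - assert (Hc := orthogonal_modes_mult_cos _ IH). assert (Hs := orthogonal_modes_mult_sin _ IH).
    assert (Hb : forall t, bump t0 t = 1 / 2 + 1 / 2 *
      (cos (2 * PI * t0) * cos (2 * PI * t) + sin (2 * PI * t0) * sin (2 * PI * t))).
    { intros t. unfold bump. replace (2 * PI * (t - t0)) with (2 * PI * t - 2 * PI * t0) by ring.
      rewrite cos_minus. field. }
    intros m; split.
    + apply is_RInt_ext_R with (2 := is_RInt_0_lincomb _ _ (1/2) 1 (proj1 (IH m))
       (is_RInt_0_lincomb _ _ (1/2 * cos (2 * PI * t0)) (1/2 * sin (2 * PI * t0)) (proj1 (Hc m)) (proj1 (Hs m)))).
      intros t _. simpl pow.  replace (bump t0 t * bump t0 t ^ N) with ((1 / 2 + 1 / 2 *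
      (cos (2 * PI * t0) * cos (2 * PI * t) + sin (2 * PI * t0) * sin (2 * PI * t))) * bump t0 t ^ N)
      by (rewrite <- Hb; ring). ring.
    + apply is_RInt_ext_R with (2 := is_RInt_0_lincomb _ _ (1/2) 1 (proj2 (IH m))
       (is_RInt_0_lincomb _ _ (1/2 * cos (2 * PI * t0)) (1/2 * sin (2 * PI * t0)) (proj2 (Hc m)) (proj2 (Hs m)))).
      intros t _. simpl pow.
      replace (bump t0 t * bump t0 t ^ N) with ((1 / 2 + 1 / 2 *
      (cos (2 * PI * t0) * cos (2 * PI * t) + sin (2 * PI * t0) * sin (2 * PI * t))) * bump t0 t ^ N)
      by (rewrite <- Hb; ring). ring.
Qed.

Lemma cos_2PI_Rabs s : cos (2 * PI * s) = cos (2 * PI * Rabs s).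
Proof.
  destruct (Rle_dec 0 s).
  - rewrite Rabs_pos_eq; auto.
  - rewrite Rabs_left by lra. rewrite <- cos_neg. f_equal; ring.
Qed.

Lemma bump_ge t0 t d :
  0 <= d <= 1 / 2 -> Rabs (t - t0) <= d -> (1 + cos (2 * PI * d)) / 2 <= bump t0 t.
Proof.
  intros Hd Ht. unfold bump. rewrite (cos_2PI_Rabs (t - t0)). assert (HPI := PI_RGT_0).
  assert (H0 := Rabs_pos (t - t0)).
  assert (cos (2 * PI * d) <= cos (2 * PI * Rabs (t - t0))); [|lra].
  destruct Ht as [Ht|Ht]; [|rewrite Ht; lra].
  left; apply cos_decreasing_1; nra.
Qed.

Lemma bump_le t0 t d :
  0 <= d <= 1 / 2 -> d <= Rabs (t - t0) <= 1 - d -> bump t0 t <= (1 + cos (2 * PI * d)) / 2.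
Proof.
  intros Hd Ht. unfold bump. rewrite (cos_2PI_Rabs (t - t0)). assert (HPI := PI_RGT_0).
  assert (Hdec : forall s, d <= s <= 1 / 2 -> cos (2 * PI * s) <= cos (2 * PI * d)).
  { intros s [[Hs|Hs] Hs']; [|rewrite Hs; lra]. left; apply cos_decreasing_1; nra. }
  assert (cos (2 * PI * Rabs (t - t0)) <= cos (2 * PI * d)); [|lra].
  destruct (Rle_dec (Rabs (t - t0)) (1/2)).
  - apply Hdec; lra.
  - replace (cos (2 * PI * Rabs (t - t0))) with (cos (2 * PI * (1 - Rabs (t - t0)))).
    + apply Hdec; lra.
    + replace (2 * PI * (1 - Rabs (t - t0))) with (- (2 * PI * Rabs (t - t0)) + 2 * PI) by ring.
      rewrite cos_2PI_shift || rewrite cos_plus, cos_2PI, sin_2PI, cos_neg; ring.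
Qed.

Lemma bump_bounds t0 t : 0 <= bump t0 t <= 1.
Proof. unfold bump. generalize (COS_bound (2 * PI * (t - t0))). lra. Qed.

Lemma is_RInt_const_le (f : R -> R) (a b c : R) :
  a <= b -> ex_RInt f a b -> (forall t, a <= t <= b -> c <= f t) -> c * (b - a) <= RInt f a b.
Proof.
  intros Hab Hf H. replace (c * (b - a)) with (RInt (fun _ => c) a b).
  - apply RInt_le; auto. + apply ex_RInt_const. + intros; apply H; lra.
  - rewrite RInt_const. unfold scal; simpl; unfold mult; simpl. ring.
Qed.

(** If [f t0 > 0], the integral of [bump t0 ^ N * f], which is zero by orthogonality, receives at
    least [f t0 / 2 * d * q1 ^ N] from the interval of radius [d / 2] about [t0] and at least
    [- M * q2 ^ N] from the rest. As [q2 < q1], this is impossible for large [N]. *)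
Lemma fourier_nonpos (f : R -> R) :
  (forall t, 0 <= t <= 1 -> continuous f t) -> orthogonal_modes f ->
  forall t0, 0 < t0 < 1 -> f t0 <= 0.
Proof.
  intros Hf HO t0 Ht0. apply Rnot_lt_le; intros Hpos.
  destruct (bounded_continuity (K := R_AbsRing) (V := R_NormedModule) f 0 1 Hf) as [M HM].
  assert (HM0 : 0 < M).
  { apply Rle_lt_trans with (2 := HM t0 ltac:(lra)). apply norm_ge_0. }
  assert (Hc := Hf t0 ltac:(lra)).
  assert (He : 0 < f t0 / 2) by lra.
  apply filterlim_locally with (eps := mkposreal _ He) in Hc. destruct Hc as [d0 Hd0].
  (* Within [d] of [t0] the value of [f] stays above [f t0 / 2]; [d < t0] and [d < 1 - t0] keep
     [|t - t0|] below [1 - d], away from the next period of [bump], and [d <= 1 / 4] stays inside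
     the decreasing branch of the cosine. *)
  pose (d := Rmin (d0 / 2) (Rmin (1 / 4) (Rmin (t0 / 2) ((1 - t0) / 2)))).
  assert (Hd : 0 < d /\ d < d0 /\ d <= 1 / 4 /\ d < t0 /\ d < 1 - t0).
  { unfold d. assert (Q0 := cond_pos d0).
    assert (Q1 := Rmin_l (d0 / 2) (Rmin (1 / 4) (Rmin (t0 / 2) ((1 - t0) / 2)))).
    assert (Q2 := Rmin_r (d0 / 2) (Rmin (1 / 4) (Rmin (t0 / 2) ((1 - t0) / 2)))).
    assert (Q3 := Rmin_l (1 / 4) (Rmin (t0 / 2) ((1 - t0) / 2))).
    assert (Q4 := Rmin_r (1 / 4) (Rmin (t0 / 2) ((1 - t0) / 2))).
    assert (Q5 := Rmin_l (t0 / 2) ((1 - t0) / 2)). assert (Q6 := Rmin_r (t0 / 2) ((1 - t0) / 2)).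
    split; [repeat apply Rmin_glb_lt; lra|]. lra. }
  destruct Hd as [Hd1 [Hd2 [Hd3 [Hd4 Hd5]]]].
  assert (Hfd : forall t, Rabs (t - t0) <= d -> f t0 / 2 <= f t).
  { intros t Ht. assert (K : ball t0 d0 t).
    { unfold ball; simpl; unfold AbsRing_ball, abs, minus, plus, opp; simpl.
      replace (t + - t0) with (t - t0) by ring. lra. }
    specialize (Hd0 t K). unfold ball in Hd0; simpl in Hd0.
    unfold AbsRing_ball, abs, minus, plus, opp in Hd0; simpl in Hd0.
    apply Rabs_def2 in Hd0. lra. }
  pose (q1 := (1 + cos (2 * PI * (d / 2))) / 2). pose (q2 := (1 + cos (2 * PI * d)) / 2).
  assert (HPI := PI_RGT_0).
  assert (Hq12 : q2 < q1).
  { unfold q1, q2. assert (cos (2 * PI * d) < cos (2 * PI * (d / 2))); [|lra].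
    apply cos_decreasing_1; nra. }
  assert (Hq2 : 0 <= q2) by (unfold q2; generalize (COS_bound (2 * PI * d)); lra).
  assert (Hmain : forall N, f t0 / 2 * d * q1 ^ N <= M * q2 ^ N).
  { intros N.
    destruct (orthogonal_modes_bump f t0 N HO 0%nat) as [HI _].
    pose (g := fun t => bump t0 t ^ N * f t).
    assert (HI' : is_RInt g 0 1 0).
    { apply is_RInt_ext_R with (2 := HI). intros t _. rewrite cos_mode_0. unfold g; ring. }
    assert (Hex : ex_RInt g 0 1) by (exists 0; auto).
    pose (a := t0 - d / 2). pose (b := t0 + d / 2).
    assert (Hab : 0 <= a /\ a <= b /\ b <= 1) by (unfold a, b; lra).
    assert (E1 : ex_RInt g 0 b) by (apply (ex_RInt_Chasles_1 (V := R_CompleteNormedModule)) with 1; auto; lra).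
    assert (E2 : ex_RInt g b 1) by (apply (ex_RInt_Chasles_2 (V := R_CompleteNormedModule)) with 0; auto; lra).
    assert (E3 : ex_RInt g 0 a) by (apply (ex_RInt_Chasles_1 (V := R_CompleteNormedModule)) with b; auto; lra).
    assert (E4 : ex_RInt g a b) by (apply (ex_RInt_Chasles_2 (V := R_CompleteNormedModule)) with 0; auto; lra).
    assert (S1 := RInt_Chasles (V := R_CompleteNormedModule) g 0 a b E3 E4).
    assert (S2 := RInt_Chasles (V := R_CompleteNormedModule) g 0 b 1 E1 E2).
    rewrite (is_RInt_unique (V := R_CompleteNormedModule) _ _ _ _ HI') in S2.
    unfold plus in S1, S2; simpl in S1, S2.
    (* Between [d / 2] and [d] the integrand is nonnegative because [f] is; farther out [bump] is at
       most [q2]. *)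
    assert (Hout : forall t, 0 <= t <= 1 -> d / 2 <= Rabs (t - t0) -> - (M * q2 ^ N) <= g t).
    { intros t Ht Ht2. unfold g.
      assert (Hb := bump_bounds t0 t).
      assert (HbN : 0 <= bump t0 t ^ N) by (apply pow_le; lra).
      assert (HqN : 0 <= q2 ^ N) by (apply pow_le; auto).
      destruct (Rle_dec (Rabs (t - t0)) d) as [Hl|Hl].
      - specialize (Hfd t Hl). apply Rle_trans with 0; nra.
      - assert (Hbq : bump t0 t <= q2).
        { apply bump_le; [lra|]. split; [lra|]. apply Rabs_le; lra. }
        assert (HbqN : bump t0 t ^ N <= q2 ^ N) by (apply pow_incr; lra).
        specialize (HM t Ht). unfold norm in HM; simpl in HM. apply Rabs_def2 in HM.
        apply Rle_trans with (- (M * bump t0 t ^ N)); nra. }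
    assert (L1 : - (M * q2 ^ N) * (a - 0) <= RInt g 0 a).
    { apply is_RInt_const_le; auto; [lra|]. intros t Ht. apply Hout; [lra|].
      unfold a in Ht. rewrite Rabs_left1; lra. }
    assert (L2 : - (M * q2 ^ N) * (1 - b) <= RInt g b 1).
    { apply is_RInt_const_le; auto; [lra|]. intros t Ht. apply Hout; [lra|].
      unfold b in Ht. rewrite Rabs_pos_eq; lra. }
    assert (L3 : (f t0 / 2 * q1 ^ N) * (b - a) <= RInt g a b).
    { apply is_RInt_const_le; auto; [lra|]. intros t Ht. unfold g.
      assert (Ht' : Rabs (t - t0) <= d / 2) by (apply Rabs_le; unfold a, b in Ht; lra).
      assert (Hb : q1 <= bump t0 t) by (apply bump_ge; lra).
      assert (HbN : q1 ^ N <= bump t0 t ^ N) by (apply pow_incr; lra).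
      assert (H0 : 0 <= q1 ^ N) by (apply pow_le; lra).
      specialize (Hfd t ltac:(lra)). nra. }
    assert (HqN : 0 <= M * q2 ^ N) by (apply Rmult_le_pos; [lra|apply pow_le; auto]).
    replace (b - a) with d in L3 by (unfold a, b; field).
    assert (- (M * q2 ^ N) * (a - 0) + - (M * q2 ^ N) * (1 - b) >= - (M * q2 ^ N)).
    { replace (- (M * q2 ^ N) * (a - 0) + - (M * q2 ^ N) * (1 - b)) with
       (- (M * q2 ^ N) + (M * q2 ^ N) * (b - a)) by ring.
      assert (0 <= M * q2 ^ N * (b - a)) by (apply Rmult_le_pos; lra). lra. }
    lra. }
  assert (Hr : Rabs (q2 / q1) < 1).
  { rewrite Rabs_pos_eq.
    - apply Rmult_lt_reg_r with q1; [lra|]. unfold Rdiv. rewrite Rmult_assoc, Rinv_l; lra.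
    - apply Rdiv_le_0_compat; lra. }
  destruct (pow_lt_1_zero (q2 / q1) Hr (f t0 / 2 * d / (M + 1))) as [N HN].
  { apply Rdiv_lt_0_compat; [nra|lra]. }
  specialize (HN N (Nat.le_refl N)). specialize (Hmain N).
  assert (Hq1N : 0 < q1 ^ N) by (apply pow_lt; lra).
  assert (Hpow : (q2 / q1) ^ N = q2 ^ N / q1 ^ N).
  { unfold Rdiv. rewrite Rpow_mult_distr, pow_inv by lra. auto. }
  rewrite Hpow, Rabs_pos_eq in HN by (apply Rdiv_le_0_compat; auto; apply pow_le; auto).
  apply Rmult_lt_compat_l with (r := (M + 1) * q1 ^ N) in HN; [|apply Rmult_lt_0_compat; lra].
  replace ((M + 1) * q1 ^ N * (q2 ^ N / q1 ^ N)) with ((M + 1) * q2 ^ N) in HN by (field; lra).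
  replace ((M + 1) * q1 ^ N * (f t0 / 2 * d / (M + 1))) with (f t0 / 2 * d * q1 ^ N) in HN by (field; lra).
  assert (0 <= q2 ^ N) by (apply pow_le; auto). lra.
Qed.

Lemma fourier_unique (f : R -> R) :
  (forall t, 0 <= t <= 1 -> continuous f t) -> orthogonal_modes f ->
  forall t, 0 < t < 1 -> f t = 0.
Proof.
  intros Hf HO t Ht. apply Rle_antisym.
  - apply fourier_nonpos; auto.
  - assert (H : - f t <= 0); [|lra].
    apply (fourier_nonpos (fun t => - f t)); auto.
    + intros s Hs. apply (continuous_opp f); auto.
    + intros m. split.
      * apply is_RInt_ext_R with (2 := is_RInt_0_lincomb _ _ (-1) 0 (proj1 (HO m)) (proj1 (HO m))).
        intros; ring.
      * apply is_RInt_ext_R with (2 := is_RInt_0_lincomb _ _ (-1) 0 (proj2 (HO m)) (proj2 (HO m))).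
        intros; ring.
Qed.

(** * Goursat's lemma for closed forms in the plane *)

(** Differentiability at one point of the plane, with partial derivatives [p] and [q]. This
    pointwise notion is what complex differentiability supplies and all that the bisection argument
    consumes. *)
Definition diff2 (P : R -> R -> R) (x y p q : R) : Prop :=
  forall eps, 0 < eps -> exists d, 0 < d /\ forall u v,
    Rabs (u - x) < d -> Rabs (v - y) < d ->
    Rabs (P u v - P x y - p * (u - x) - q * (v - y)) <= eps * (Rabs (u - x) + Rabs (v - y)).

Lemma diff2_continuous_l P x y p q : diff2 P x y p q -> continuous (fun u => P u y) x.
Proof.
  intros H. apply filterlim_locally. intros [eps He].
  destruct (H 1 Rlt_0_1) as [d [Hd Hd']].
  assert (Hm : 0 < Rmin d (eps / (Rabs p + 2))).
  { apply Rmin_glb_lt; auto. apply Rdiv_lt_0_compat; auto. generalize (Rabs_pos p); lra. }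
  exists (mkposreal _ Hm). intros u Hu.
  unfold ball in Hu |- *; simpl in Hu |- *; unfold AbsRing_ball, abs, minus, plus, opp in Hu |- *; simpl in Hu |- *.
  change (Rabs (u - x) < Rmin d (eps / (Rabs p + 2))) in Hu. change (Rabs (P u y - P x y) < eps).
  assert (Q1 := Rmin_l d (eps / (Rabs p + 2))). assert (Q2 := Rmin_r d (eps / (Rabs p + 2))).
  specialize (Hd' u y ltac:(lra)). rewrite Rminus_diag, Rabs_R0 in Hd'. specialize (Hd' Hd).
  assert (Hp := Rabs_pos p). assert (Hu0 := Rabs_pos (u - x)).
  replace (P u y - P x y) with ((P u y - P x y - p * (u - x) - q * 0) + p * (u - x)) by ring.
  apply Rle_lt_trans with (1 := Rabs_triang _ _). rewrite (Rabs_mult p).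
  apply Rle_lt_trans with ((Rabs p + 1) * Rabs (u - x)); [lra|].
  apply Rle_lt_trans with ((Rabs p + 1) * (eps / (Rabs p + 2))); [apply Rmult_le_compat_l; lra|].
  apply Rmult_lt_reg_r with (Rabs p + 2); [lra|]. field_simplify; [|lra]. nra.
Qed.

Lemma diff2_swap P x y p q : diff2 P x y p q -> diff2 (fun u v => P v u) y x q p.
Proof.
  intros H eps He. destruct (H eps He) as [d [Hd Hd']]. exists d; split; auto.
  intros u v Hu Hv. rewrite (Rplus_comm (Rabs (u - y))).
  replace (P v u - P x y - q * (u - y) - p * (v - x)) with (P v u - P x y - p * (v - x) - q * (u - y)) by ring.
  apply Hd'; auto.
Qed.

(** The integral of the form [P dx + Q dy] around the boundary of a rectangle, counterclockwise. *)
Definition rect_int (P Q : R -> R -> R) (x1 x2 y1 y2 : R) : R :=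
  RInt (fun x => P x y1) x1 x2 + RInt (fun y => Q x2 y) y1 y2
  - RInt (fun x => P x y2) x1 x2 - RInt (fun y => Q x1 y) y1 y2.

(** Sharing the number [c] expresses the equality of the mixed partial derivatives, [P_y = Q_x]. *)
Definition closed_form (P Q : R -> R -> R) : Prop :=
  forall x y, exists p c q, diff2 P x y p c /\ diff2 Q x y c q.

Section Goursat.
Variables P Q : R -> R -> R.
Hypothesis HPQ : closed_form P Q.

Lemma closed_form_ex_RInt_x y a b : ex_RInt (fun x => P x y) a b.
Proof.
  apply (ex_RInt_continuous (V := R_CompleteNormedModule)). intros x _.
  destruct (HPQ x y) as [p [c [q [H _]]]]. eapply diff2_continuous_l; eauto.
Qed.

Lemma closed_form_ex_RInt_y x a b : ex_RInt (fun y => Q x y) a b.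
Proof.
  apply (ex_RInt_continuous (V := R_CompleteNormedModule)). intros y _.
  destruct (HPQ x y) as [p [c [q [_ H]]]]. apply diff2_swap in H.
  eapply (diff2_continuous_l (fun u v => Q v u)); eauto.
Qed.

Lemma RInt_Chasles_R f a b c :
  ex_RInt f a b -> ex_RInt f b c -> RInt f a c = RInt f a b + RInt f b c.
Proof. intros. symmetry. apply (RInt_Chasles (V := R_CompleteNormedModule)); auto. Qed.

Lemma rect_int_split x1 xm x2 y1 ym y2 :
  rect_int P Q x1 x2 y1 y2 =
    rect_int P Q x1 xm y1 ym + rect_int P Q xm x2 y1 ym +
    rect_int P Q x1 xm ym y2 + rect_int P Q xm x2 ym y2.
Proof.
  unfold rect_int.
  assert (EP := fun y => RInt_Chasles_R (fun x => P x y) x1 xm x2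
    (closed_form_ex_RInt_x y x1 xm) (closed_form_ex_RInt_x y xm x2)).
  assert (EQ := fun x => RInt_Chasles_R (fun y => Q x y) y1 ym y2
    (closed_form_ex_RInt_y x y1 ym) (closed_form_ex_RInt_y x ym y2)).
  rewrite !EP, !EQ. ring.
Qed.

Lemma Rabs_RInt_diff_le f g a b k B :
  a <= b -> ex_RInt f a b -> ex_RInt g a b ->
  (forall t, a <= t <= b -> Rabs (f t - g t - k) <= B) ->
  Rabs (RInt f a b - RInt g a b - k * (b - a)) <= B * (b - a).
Proof.
  intros Hab Hf Hg H.
  assert (HI : is_RInt (fun t => f t - g t - k) a b (RInt f a b - RInt g a b - k * (b - a))).
  { apply (is_RInt_minus (V := R_NormedModule)).
    - apply (is_RInt_minus (V := R_NormedModule)); apply (RInt_correct (V := R_CompleteNormedModule)); auto.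
    - replace (k * (b - a)) with (scal (V := R_NormedModule) (b - a) k) by (unfold scal; simpl; unfold mult; simpl; ring).
      apply (is_RInt_const (V := R_NormedModule)). }
  assert (HB : is_RInt (fun _ => B) a b (B * (b - a))).
  { replace (B * (b - a)) with (scal (V := R_NormedModule) (b - a) B) by (unfold scal; simpl; unfold mult; simpl; ring).
    apply (is_RInt_const (V := R_NormedModule)). }
  exact (norm_RInt_le (V := R_NormedModule) _ _ _ _ _ _ Hab H HI HB).
Qed.

(** The affine parts of [P] and [Q] at [(x0, y0)] contribute [- c * M * L] and [c * L * M], which
    cancel. Only the [eps] errors along the four sides remain. *)
Lemma rect_int_local x0 y0 eps :
  0 < eps -> exists d, 0 < d /\ forall x y L M,
    0 <= L -> 0 <= M -> L < d -> M < d ->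
    x <= x0 <= x + L -> y <= y0 <= y + M ->
    Rabs (rect_int P Q x (x + L) y (y + M)) <= 2 * eps * (L + M) ^ 2.
Proof.
  intros He. destruct (HPQ x0 y0) as [p [c [q [HP HQ]]]].
  destruct (HP eps He) as [d1 [Hd1 H1]]. destruct (HQ eps He) as [d2 [Hd2 H2]].
  exists (Rmin d1 d2). split; [apply Rmin_glb_lt; auto|].
  intros x y L M HL HM HLd HMd Hx Hy.
  assert (Q1 := Rmin_l d1 d2). assert (Q2 := Rmin_r d1 d2).
  assert (HxA : forall t, x <= t <= x + L -> Rabs (t - x0) <= L) by (intros; apply Rabs_le; lra).
  assert (HyA : forall t, y <= t <= y + M -> Rabs (t - y0) <= M) by (intros; apply Rabs_le; lra).
  assert (A1 : Rabs (RInt (fun t => P t y) x (x + L) - RInt (fun t => P t (y + M)) x (x + L) - (- c * M) * (x + L - x))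
     <= (2 * eps * (L + M)) * (x + L - x)).
  { apply Rabs_RInt_diff_le; try apply closed_form_ex_RInt_x; [lra|].
    intros t Ht. specialize (HxA t Ht). assert (B1 := HyA y ltac:(lra)). assert (B2 := HyA (y + M) ltac:(lra)).
    assert (C1 := H1 t y ltac:(lra) ltac:(lra)). assert (C2 := H1 t (y + M) ltac:(lra) ltac:(lra)).
    replace (P t y - P t (y + M) - - c * M) with
      ((P t y - P x0 y0 - p * (t - x0) - c * (y - y0)) - (P t (y + M) - P x0 y0 - p * (t - x0) - c * (y + M - y0))) by ring.
    unfold Rminus at 1. apply Rle_trans with (1 := Rabs_triang _ _). rewrite Rabs_Ropp.
    assert (eps * (Rabs (t - x0) + Rabs (y - y0)) <= eps * (L + M)) by (apply Rmult_le_compat_l; lra).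
    assert (eps * (Rabs (t - x0) + Rabs (y + M - y0)) <= eps * (L + M)) by (apply Rmult_le_compat_l; lra).
    lra. }
  assert (A2 : Rabs (RInt (fun t => Q (x + L) t) y (y + M) - RInt (fun t => Q x t) y (y + M) - (c * L) * (y + M - y))
     <= (2 * eps * (L + M)) * (y + M - y)).
  { apply Rabs_RInt_diff_le; try apply closed_form_ex_RInt_y; [lra|].
    intros t Ht. specialize (HyA t Ht). assert (B1 := HxA x ltac:(lra)). assert (B2 := HxA (x + L) ltac:(lra)).
    assert (C1 := H2 x t ltac:(lra) ltac:(lra)). assert (C2 := H2 (x + L) t ltac:(lra) ltac:(lra)).
    replace (Q (x + L) t - Q x t - c * L) with
      ((Q (x + L) t - Q x0 y0 - c * (x + L - x0) - q * (t - y0)) - (Q x t - Q x0 y0 - c * (x - x0) - q * (t - y0))) by ring.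
    unfold Rminus at 1. apply Rle_trans with (1 := Rabs_triang _ _). rewrite Rabs_Ropp.
    assert (eps * (Rabs (x - x0) + Rabs (t - y0)) <= eps * (L + M)) by (apply Rmult_le_compat_l; lra).
    assert (eps * (Rabs (x + L - x0) + Rabs (t - y0)) <= eps * (L + M)) by (apply Rmult_le_compat_l; lra).
    lra. }
  unfold rect_int.
  match goal with |- Rabs ?z <= _ =>
    replace z with ((RInt (fun t => P t y) x (x + L) - RInt (fun t => P t (y + M)) x (x + L) - (- c * M) * (x + L - x))
    + (RInt (fun t => Q (x + L) t) y (y + M) - RInt (fun t => Q x t) y (y + M) - (c * L) * (y + M - y))) by ring end.
  apply Rle_trans with (1 := Rabs_triang _ _). nra.
Qed.

(** Bisection: halving the sides divides the bound by four, so a rectangle that violates it has a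
    quarter that does. The nested bad quarters shrink to a point, and there [rect_int_local] with
    the same [eps] contradicts them. *)
Lemma rect_int_bound L M x y eps :
  0 <= L -> 0 <= M -> 0 < eps ->
  Rabs (rect_int P Q x (x + L) y (y + M)) <= 2 * eps * (L + M) ^ 2.
Proof.
  intros HL HM He. apply Rnot_lt_le. intros Hbad.
  pose (l := fun n => L / 2 ^ n). pose (m := fun n => M / 2 ^ n).
  assert (H2n : forall n, 0 < 2 ^ n) by (intros; apply pow_lt; lra).
  assert (lS : forall n, l (S n) = l n / 2) by (intros n; unfold l; simpl; field; specialize (H2n n); lra).
  assert (mS : forall n, m (S n) = m n / 2) by (intros n; unfold m; simpl; field; specialize (H2n n); lra).
  assert (l0 : forall n, 0 <= l n) by (intros n; apply Rdiv_le_0_compat; auto).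
  assert (m0 : forall n, 0 <= m n) by (intros n; apply Rdiv_le_0_compat; auto).
  pose (bad := fun n (z : R * R) =>
    2 * eps * (l n + m n) ^ 2 < Rabs (rect_int P Q (fst z) (fst z + l n) (snd z) (snd z + m n))).
  (* The first bad quarter among three, and otherwise the fourth, which must then be bad. The choice
     is by decidable comparison, so the sequence of corners is a plain recursion. *)
  pose (next := fun n (z : R * R) =>
    let x' := fst z + l (S n) in let y' := snd z + m (S n) in
    if Rlt_dec (2 * eps * (l (S n) + m (S n)) ^ 2)
        (Rabs (rect_int P Q (fst z) (fst z + l (S n)) (snd z) (snd z + m (S n)))) then z
    else if Rlt_dec (2 * eps * (l (S n) + m (S n)) ^ 2)
        (Rabs (rect_int P Q x' (x' + l (S n)) (snd z) (snd z + m (S n)))) then (x', snd z)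
    else if Rlt_dec (2 * eps * (l (S n) + m (S n)) ^ 2)
        (Rabs (rect_int P Q (fst z) (fst z + l (S n)) y' (y' + m (S n)))) then (fst z, y')
    else (x', y')).
  assert (Hnext : forall n z, bad n z -> bad (S n) (next n z)).
  { intros n z Hz. unfold next. cbv zeta.
    destruct (Rlt_dec _ _) as [H1|H1]; [exact H1|].
    destruct (Rlt_dec _ _) as [H2|H2]; [exact H2|].
    destruct (Rlt_dec _ _) as [H3|H3]; [exact H3|].
    unfold bad; simpl fst; simpl snd. apply Rnot_le_lt. intros H4.
    apply Rnot_lt_le in H1. apply Rnot_lt_le in H2. apply Rnot_lt_le in H3.
    unfold bad in Hz.
    rewrite (rect_int_split _ (fst z + l (S n)) _ _ (snd z + m (S n))) in Hz.
    replace (fst z + l (S n) + l (S n)) with (fst z + l n) in * by (rewrite lS; field).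
    replace (snd z + m (S n) + m (S n)) with (snd z + m n) in * by (rewrite mS; field).
    replace (l n + m n) with (2 * (l (S n) + m (S n))) in Hz by (rewrite lS, mS; field).
    revert Hz H1 H2 H3 H4.
    set (i1 := rect_int P Q _ _ (snd z) _). set (i2 := rect_int P Q (fst z + l (S n)) _ (snd z) _).
    set (i3 := rect_int P Q (fst z) (fst z + l (S n)) (snd z + m (S n)) _).
    set (i4 := rect_int P Q _ _ _ _). intros Hz H1 H2 H3 H4.
    assert (T1 := Rabs_triang (i1 + i2 + i3) i4). assert (T2 := Rabs_triang (i1 + i2) i3).
    assert (T3 := Rabs_triang i1 i2).
    replace (2 * eps * (2 * (l (S n) + m (S n))) ^ 2) with (4 * (2 * eps * (l (S n) + m (S n)) ^ 2)) in Hz by ring.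
    lra. }
  pose (z := fix z n := match n with O => (x, y) | S n => next n (z n) end).
  assert (Hbadz : forall n, bad n (z n)).
  { induction n as [|n IH]; [|apply Hnext; exact IH].
    assert (El : l O = L) by (unfold l; simpl; field). assert (Em : m O = M) by (unfold m; simpl; field).
    unfold bad. rewrite El, Em. exact Hbad. }
  assert (Hz1 : forall n, fst (z n) <= fst (z (S n)) /\ fst (z (S n)) + l (S n) <= fst (z n) + l n).
  { intros n. change (z (S n)) with (next n (z n)). specialize (l0 (S n)).
    rewrite lS in *. unfold next; cbv zeta; rewrite lS.
    destruct (Rlt_dec _ _); [simpl; lra|]. destruct (Rlt_dec _ _); [simpl; lra|].
    destruct (Rlt_dec _ _); simpl; lra. }
  assert (Hz2 : forall n, snd (z n) <= snd (z (S n)) /\ snd (z (S n)) + m (S n) <= snd (z n) + m n).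
  { intros n. change (z (S n)) with (next n (z n)). specialize (m0 (S n)).
    rewrite mS in *. unfold next; cbv zeta; rewrite mS.
    destruct (Rlt_dec _ _); [simpl; lra|]. destruct (Rlt_dec _ _); [simpl; lra|].
    destruct (Rlt_dec _ _); simpl; lra. }
  assert (Hnest : forall (u w : nat -> R), (forall n, 0 <= w n) ->
     (forall n, u n <= u (S n) /\ u (S n) + w (S n) <= u n + w n) ->
     exists s, forall n, u n <= s <= u n + w n).
  { intros u w Hw Hu.
    assert (Hmono : forall k n, u n <= u (n + k)%nat /\ u (n + k)%nat + w (n + k)%nat <= u n + w n).
    { induction k as [|k IH]; intros n; [rewrite Nat.add_0_r; lra|].
      rewrite Nat.add_succ_r. specialize (IH n). specialize (Hu (n + k)%nat). lra. }
    assert (Hall : forall n k, u k <= u n + w n).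
    { intros n k. destruct (Nat.le_ge_cases n k) as [H|H].
      - replace k with (n + (k - n))%nat by lia. specialize (Hmono (k - n)%nat n).
        specialize (Hw (n + (k - n))%nat). lra.
      - replace n with (k + (n - k))%nat by lia. specialize (Hmono (n - k)%nat k).
        specialize (Hw (k + (n - k))%nat). lra. }
    destruct (completeness (fun r => exists n, r = u n)) as [s [Hs1 Hs2]].
    - exists (u 0%nat + w 0%nat). intros r [n Hn]. rewrite Hn. apply Hall.
    - exists (u 0%nat), 0%nat; auto.
    - exists s. intros n; split.
      + apply Hs1. exists n; auto.
      + apply Hs2. intros r [k Hk]. rewrite Hk. apply Hall. }
  destruct (Hnest (fun n => fst (z n)) l l0 Hz1) as [xs Hxs].
  destruct (Hnest (fun n => snd (z n)) m m0 Hz2) as [ys Hys].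
  destruct (rect_int_local xs ys eps He) as [d [Hd Hd']].
  assert (Hh : Rabs (/ 2) < 1) by (rewrite Rabs_pos_eq; lra).
  destruct (pow_lt_1_zero (/ 2) Hh (d / (L + M + 1))) as [N HN].
  { apply Rdiv_lt_0_compat; lra. }
  specialize (HN N (Nat.le_refl N)). rewrite pow_inv in HN.
  rewrite Rabs_pos_eq in HN by (left; apply Rinv_0_lt_compat; auto).
  assert (Hsmall : (L + M + 1) * / 2 ^ N < d).
  { apply Rmult_lt_compat_l with (r := L + M + 1) in HN; [|lra].
    replace ((L + M + 1) * (d / (L + M + 1))) with d in HN by (field; lra). auto. }
  assert (Hi : 0 < / 2 ^ N) by (apply Rinv_0_lt_compat; auto).
  assert (HlN : l N < d) by (unfold l, Rdiv; nra).
  assert (HmN : m N < d) by (unfold m, Rdiv; nra).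
  specialize (Hd' (fst (z N)) (snd (z N)) (l N) (m N) (l0 N) (m0 N) HlN HmN (Hxs N) (Hys N)).
  specialize (Hbadz N). unfold bad in Hbadz. lra.
Qed.

Lemma goursat x1 x2 y1 y2 : x1 <= x2 -> y1 <= y2 -> rect_int P Q x1 x2 y1 y2 = 0.
Proof.
  intros Hx Hy. set (S2 := (x2 - x1 + (y2 - y1)) ^ 2).
  assert (HS2 : 0 <= S2) by (unfold S2; apply pow2_ge_0).
  assert (H : Rabs (rect_int P Q x1 x2 y1 y2) <= 0).
  { apply le_epsilon. intros eps He. rewrite Rplus_0_l.
    assert (B := rect_int_bound (x2 - x1) (y2 - y1) x1 y1 (eps / (2 * (S2 + 1))) ltac:(lra) ltac:(lra)
      ltac:(apply Rdiv_lt_0_compat; lra)).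
    replace (x1 + (x2 - x1)) with x2 in B by ring. replace (y1 + (y2 - y1)) with y2 in B by ring.
    fold S2 in B. apply Rle_trans with (1 := B).
    apply Rmult_le_reg_r with (S2 + 1); [lra|]. field_simplify; [|lra]. nra. }
  destruct (Req_dec (rect_int P Q x1 x2 y1 y2) 0) as [|Hn]; auto.
  apply Rabs_pos_lt in Hn. lra.
Qed.

End Goursat.

(** * Complex differentiation and the exponential function *)

Definition is_Cderive (f : C -> C) (z l : C) : Prop :=
  is_derive (K := C_AbsRing) (V := C_NormedModule) f z l.

Lemma is_Cderive_eps (f : C -> C) (z l : C) :
  is_Cderive f z l <->
  forall eps, 0 < eps -> exists d, 0 < d /\ forall h, Cmod h < d ->
    Cmod (f (z + h) - f z - l * h)%C <= eps * Cmod h.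
Proof.
  split.
  - intros [_ H] eps He.
    destruct (H z (fun P HP => HP) (mkposreal eps He)) as [d Hd].
    exists d; split; [apply cond_pos|]. intros h Hh.
    assert (B : ball (M := AbsRing_UniformSpace C_AbsRing) z d (z + h)%C).
    { change (Cmod (z + h - z)%C < d). replace (z + h - z)%C with h by ring. auto. }
    specialize (Hd (z + h)%C B).
    change (Cmod (f (z + h) - f z - (z + h - z) * l)%C <= eps * Cmod (z + h - z)%C) in Hd.
    replace (z + h - z)%C with h in Hd by ring. rewrite (Cmult_comm h l) in Hd. exact Hd.
  - intros H. split.
    + apply is_linear_scal_l.
    + intros x Hx.
      assert (E := is_filter_lim_locally_unique (K := C_AbsRing) (V := AbsRing_NormedModule C_AbsRing) z x Hx). subst x.
      intros [eps He]. destruct (H eps He) as [d [Hd Hd']]. exists (mkposreal d Hd).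
      intros y0 Hy; pose (y := y0 : C); change y0 with y in Hy |- *. change (Cmod (y - z)%C < d) in Hy. specialize (Hd' (y - z)%C Hy).
      replace (z + (y - z))%C with y in Hd' by ring.
      rewrite (Cmult_comm l) in Hd'. exact Hd'.
Qed.

(** [C] carries two structures of normed module over itself, and the chain and product rules involve
    the one that comes from the ring. The asymptotic clause is convertible between them; only the
    linearity of the differential is proved again. *)
Lemma is_Cderive_AbsRing (f : C -> C) (z l : C) :
  is_Cderive f z l <->
  is_derive (K := C_AbsRing) (V := AbsRing_NormedModule C_AbsRing) f z l.
Proof. split; intros [_ H]; (split; [apply is_linear_scal_l|exact H]). Qed.

Lemma is_Cderive_comp f g z l l' :
  is_Cderive f (g z) l -> is_Cderive g z l' -> is_Cderive (fun z => f (g z)) z (l * l')%C.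
Proof.
  intros Hf Hg. apply is_Cderive_AbsRing in Hg.
  assert (H := is_derive_comp (K := C_AbsRing) (V := C_NormedModule) f g z l l' Hf Hg).
  rewrite Cmult_comm. exact H.
Qed.

Lemma is_Cderive_mult f g z l l' :
  is_Cderive f z l -> is_Cderive g z l' ->
  is_Cderive (fun z => f z * g z)%C z (l * g z + f z * l')%C.
Proof.
  rewrite !is_Cderive_AbsRing. intros Hf Hg.
  exact (is_derive_mult (K := C_AbsRing) f g z l l' Hf Hg Cmult_comm).
Qed.

Lemma is_Cderive_plus f g z l l' :
  is_Cderive f z l -> is_Cderive g z l' -> is_Cderive (fun z => f z + g z)%C z (l + l')%C.
Proof. exact (is_derive_plus (K := C_AbsRing) (V := C_NormedModule) f g z l l'). Qed.

Lemma is_Cderive_const c z : is_Cderive (fun _ => c) z 0.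
Proof. exact (is_derive_const (K := C_AbsRing) (V := C_NormedModule) c z). Qed.

Lemma is_Cderive_id z : is_Cderive (fun z => z) z 1.
Proof. apply is_Cderive_AbsRing. exact (is_derive_id (K := C_AbsRing) z). Qed.

Lemma is_Cderive_scal f c z l : is_Cderive f z l -> is_Cderive (fun z => c * f z)%C z (c * l)%C.
Proof.
  intros H. replace (c * l)%C with (0 * f z + c * l)%C by ring.
  apply (is_Cderive_mult (fun _ => c)); auto. apply is_Cderive_const.
Qed.

Lemma Cmod_le_Re_Im (z : C) : Cmod z <= Rabs (Re z) + Rabs (Im z).
Proof.
  apply Rsqr_incr_0_var.
  - unfold Rsqr.
    assert (E : Cmod z * Cmod z = Re z * Re z + Im z * Im z).
    { unfold Cmod, Re, Im. rewrite sqrt_sqrt; [ring|]. nra. }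
    rewrite E. generalize (Rabs_pos (Re z)) (Rabs_pos (Im z)). intros.
    rewrite <- (Rabs_pos_eq (Re z * Re z)), <- (Rabs_pos_eq (Im z * Im z)), !Rabs_mult by nra. nra.
  - generalize (Rabs_pos (Re z)) (Rabs_pos (Im z)); lra.
Qed.

Lemma Rabs_Re_le (z : C) : Rabs (Re z) <= Cmod z.
Proof. apply re_le_Cmod. Qed.

Lemma Rabs_Im_le (z : C) : Rabs (Im z) <= Cmod z.
Proof.
  apply Rle_trans with (2 := Rmax_Cmod z). apply Rmax_r.
Qed.

Lemma Rabs_MVT_0 (f df : R -> R) (B x : R) :
  (forall t, is_derive f t (df t)) -> f 0 = 0 ->
  (forall t, Rabs t <= Rabs x -> Rabs (df t) <= B) -> Rabs (f x) <= B * Rabs x.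
Proof.
  intros Hd H0 HB. destruct (MVT_gen f 0 x df) as [c [Hc E]].
  - intros; apply Hd.
  - intros. apply continuity_pt_filterlim. apply (ex_derive_continuous (V := R_NormedModule)).
    eexists; apply Hd.
  - rewrite H0, !Rminus_0_r in E. rewrite E, Rabs_mult.
    apply Rmult_le_compat_r; [apply Rabs_pos|]. apply HB.
    destruct (Rle_dec 0 x).
    + rewrite Rmin_left, Rmax_right in Hc by auto. rewrite !Rabs_pos_eq; lra.
    + rewrite Rmin_right, Rmax_left in Hc by lra. rewrite !Rabs_left1; lra.
Qed.

Lemma exp_Rabs_le x y : Rabs x <= y -> exp x <= exp y.
Proof.
  intros H. assert (Hx : x <= y) by (apply Rle_trans with (2 := H); apply Rle_abs).
  destruct Hx as [Hx|Hx]; [left; apply exp_increasing; auto|rewrite Hx; right; auto].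
Qed.

Lemma Rabs_exp_sub_1_le x r : Rabs x <= r -> Rabs (exp x - 1) <= exp r * Rabs x.
Proof.
  intros Hx. apply (Rabs_MVT_0 (fun x => exp x - 1) exp).
  - intros t. auto_derive; auto. ring.
  - rewrite exp_0; ring.
  - intros t Ht. rewrite Rabs_pos_eq by (left; apply exp_pos). apply exp_Rabs_le; lra.
Qed.

Lemma Rabs_exp_taylor_le x r : Rabs x <= r -> Rabs (exp x - 1 - x) <= exp r * r * Rabs x.
Proof.
  intros Hx. apply (Rabs_MVT_0 (fun x => exp x - 1 - x) (fun x => exp x - 1)).
  - intros t. auto_derive; auto. ring.
  - rewrite exp_0; ring.
  - intros t Ht. apply Rle_trans with (1 := Rabs_exp_sub_1_le t r ltac:(lra)).
    apply Rmult_le_compat_l; [left; apply exp_pos|lra].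
Qed.

Lemma Rabs_sin_le x : Rabs (sin x) <= Rabs x.
Proof.
  rewrite <- (Rmult_1_l (Rabs x)). apply (Rabs_MVT_0 sin cos).
  - intros t. auto_derive; auto. ring.
  - apply sin_0.
  - intros t _. apply Rabs_le. generalize (COS_bound t); lra.
Qed.

Lemma Rabs_cos_sub_1_le x : Rabs (cos x - 1) <= Rabs x * Rabs x.
Proof.
  apply (Rabs_MVT_0 (fun x => cos x - 1) (fun x => - sin x)).
  - intros t. auto_derive; auto. ring.
  - rewrite cos_0; ring.
  - intros t Ht. rewrite Rabs_Ropp. apply Rle_trans with (1 := Rabs_sin_le t). auto.
Qed.

Lemma Rabs_sin_sub_le x : Rabs (sin x - x) <= 2 * (Rabs x * Rabs x).
Proof.
  destruct (Rle_dec (Rabs x) 1) as [H1|H1].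
  - apply Rle_trans with (Rabs x * Rabs x); [|assert (0 <= Rabs x * Rabs x) by apply Rle_0_sqr; lra].
    apply (Rabs_MVT_0 (fun x => sin x - x) (fun x => cos x - 1)).
    + intros t. auto_derive; auto. ring.
    + rewrite sin_0; ring.
    + intros t Ht. apply Rle_trans with (1 := Rabs_cos_sub_1_le t).
      generalize (Rabs_pos t); nra.
  - unfold Rminus. apply Rle_trans with (1 := Rabs_triang _ _). rewrite Rabs_Ropp.
    generalize (Rabs_sin_le x). nra.
Qed.

(** Real and imaginary parts are estimated separately. The cosine, the real Taylor remainder, the
    sine and the mixed term contribute [1 + 1 + 2 + 1 = 5] times [exp r * r^2]. *)
Lemma Cexp_taylor_le (h : C) : Cmod (Cexp h - 1 - h)%C <= 5 * exp (Cmod h) * Cmod h ^ 2.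
Proof.
  set (r := Cmod h). assert (Hx := Rabs_Re_le h). assert (Hy := Rabs_Im_le h). fold r in Hx, Hy.
  apply Rle_trans with (1 := Cmod_le_Re_Im _).
  destruct h as [x y]. unfold Re, Im in Hx, Hy; simpl in Hx, Hy.
  unfold Cexp, Cminus, Cplus, Copp, RtoC, Re, Im; simpl.
  replace (exp x * cos y + - (1) + - x) with (exp x * (cos y - 1) + (exp x - 1 - x)) by ring.
  replace (exp x * sin y + - 0 + - y) with (exp x * (sin y - y) + (exp x - 1) * y) by ring.
  assert (T1 := Rabs_triang (exp x * (cos y - 1)) (exp x - 1 - x)).
  assert (T2 := Rabs_triang (exp x * (sin y - y)) ((exp x - 1) * y)).
  rewrite !Rabs_mult in *. rewrite (Rabs_pos_eq (exp x)) in * by (left; apply exp_pos).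
  assert (E1 := exp_Rabs_le x r Hx). assert (E2 := Rabs_exp_taylor_le x r Hx).
  assert (E3 := Rabs_exp_sub_1_le x r Hx). assert (E4 := Rabs_cos_sub_1_le y).
  assert (E5 := Rabs_sin_sub_le y).
  assert (P1 := Rabs_pos x). assert (P2 := Rabs_pos y). assert (P3 := exp_pos x). assert (P4 := exp_pos r).
  assert (P5 := Rabs_pos (cos y - 1)). assert (P6 := Rabs_pos (sin y - y)). assert (P7 := Rabs_pos (exp x - 1)).
  assert (Y2 : Rabs y * Rabs y <= r * r) by (apply Rmult_le_compat; auto).
  assert (F1 : exp x * Rabs (cos y - 1) <= exp r * (r * r)) by (apply Rmult_le_compat; lra).
  assert (F2 : exp x * Rabs (sin y - y) <= exp r * (2 * (r * r))) by (apply Rmult_le_compat; lra).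
  assert (F3 : Rabs (exp x - 1) * Rabs y <= (exp r * r) * r).
  { apply Rmult_le_compat; auto. apply Rle_trans with (1 := E3). apply Rmult_le_compat_l; lra. }
  assert (F4 : exp r * r * Rabs x <= exp r * r * r) by (apply Rmult_le_compat_l; nra).
  lra.
Qed.

Lemma is_Cderive_Cexp z : is_Cderive Cexp z (Cexp z).
Proof.
  apply is_Cderive_eps. intros eps He.
  set (K := Cmod (Cexp z) * (5 * exp 1)).
  assert (HK : 0 < K) by (unfold K; rewrite Cmod_Cexp; generalize (exp_pos (Re z)) (exp_pos 1); nra).
  exists (Rmin 1 (eps / K)). split. { apply Rmin_glb_lt; [lra|apply Rdiv_lt_0_compat; auto]. }
  intros h Hh. assert (Q1 := Rmin_l 1 (eps / K)). assert (Q2 := Rmin_r 1 (eps / K)).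
  replace (Cexp (z + h) - Cexp z - Cexp z * h)%C with (Cexp z * (Cexp h - 1 - h))%C
    by (rewrite Cexp_plus; ring).
  rewrite Cmod_mult.
  assert (Hm := Cmod_ge_0 h). assert (T := Cexp_taylor_le h).
  assert (E : exp (Cmod h) <= exp 1) by (left; apply exp_increasing; lra).
  apply Rle_trans with (K * Cmod h * Cmod h).
  - unfold K. rewrite !Rmult_assoc. apply Rmult_le_compat_l; [apply Cmod_ge_0|].
    apply Rle_trans with (1 := T). simpl. rewrite Rmult_1_r, !Rmult_assoc.
    apply Rmult_le_compat_l; [lra|]. apply Rmult_le_compat_r; nra.
  - apply Rmult_le_compat_r; auto. apply Rle_trans with (K * (eps / K)).
    + apply Rmult_le_compat_l; lra.
    + right; field; lra.
Qed.

(** The Cauchy-Riemann equations, read off from the real and imaginary parts of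
    [l * (du + i dv)]. *)
Lemma is_Cderive_diff2 f x y l :
  is_Cderive f (x, y) l ->
  diff2 (fun x y => Re (f (x, y))) x y (Re l) (- Im l) /\
  diff2 (fun x y => Im (f (x, y))) x y (Im l) (Re l).
Proof.
  rewrite is_Cderive_eps. intros H.
  assert (G : forall eps, 0 < eps -> exists d, 0 < d /\ forall u v,
    Rabs (u - x) < d -> Rabs (v - y) < d ->
    Cmod (f (u, v) - f (x, y) - l * ((u - x)%R, (v - y)%R))%C <= eps * (Rabs (u - x) + Rabs (v - y))).
  { intros eps He. destruct (H eps He) as [d [Hd Hd']]. exists (d / 2). split; [lra|].
    intros u v Hu Hv. assert (T := Cmod_le_Re_Im ((u - x)%R, (v - y)%R)). unfold Re, Im in T; simpl in T.
    specialize (Hd' ((u - x)%R, (v - y)%R) ltac:(lra)).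
    replace ((x, y) + ((u - x)%R, (v - y)%R))%C with ((u, v) : C) in Hd' by (unfold Cplus; simpl; f_equal; ring).
    apply Rle_trans with (1 := Hd'). apply Rmult_le_compat_l; lra. }
  split; intros eps He; destruct (G eps He) as [d [Hd Hd']]; exists d; split; auto;
    intros u v Hu Hv; apply Rle_trans with (2 := Hd' u v Hu Hv).
  - apply Rle_trans with (2 := Rabs_Re_le _). right; f_equal. destruct l; unfold Re, Im; simpl. ring.
  - apply Rle_trans with (2 := Rabs_Im_le _). right; f_equal. destruct l; unfold Re, Im; simpl. ring.
Qed.

(** * Entire functions with period [2 pi i] *)

Section PeriodicEntire.
Variable f : C -> C.
Hypothesis Hf : forall z, exists l, is_Cderive f z l.
Hypothesis Hper : forall x y, f (x, y + 2 * PI) = f (x, y).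

(** These two forms are the real and imaginary parts of [f dz]. *)
Lemma entire_closed_form :
  closed_form (fun x y => Re (f (x, y))) (fun x y => - Im (f (x, y))) /\
  closed_form (fun x y => Im (f (x, y))) (fun x y => Re (f (x, y))).
Proof.
  split; intros x y; destruct (Hf (x, y)) as [l Hl]; destruct (is_Cderive_diff2 f x y l Hl) as [H1 H2].
  - exists (Re l), (- Im l), (- Re l). split; auto.
    intros eps He. destruct (H2 eps He) as [d [Hd Hd']]. exists d; split; auto.
    intros u v Hu Hv. apply Rle_trans with (2 := Hd' u v Hu Hv). right.
    rewrite <- Rabs_Ropp. f_equal; ring.
  - exists (Im l), (Re l), (- Im l). split; auto.
Qed.

Lemma entire_continuous x y :
  continuous (fun y => Re (f (x, y))) y /\ continuous (fun y => Im (f (x, y))) y.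
Proof.
  destruct (Hf (x, y)) as [l Hl]. destruct (is_Cderive_diff2 f x y l Hl) as [H1 H2].
  apply diff2_swap in H1. apply diff2_swap in H2. split.
  - exact (diff2_continuous_l (fun u v => Re (f (v, u))) y x _ _ H1).
  - exact (diff2_continuous_l (fun u v => Im (f (v, u))) y x _ _ H2).
Qed.

(** In a rectangle whose height is one period the integrals along the two horizontal sides cancel,
    so [goursat] equates those along the vertical ones. *)
Lemma periodic_mean_const x1 x2 : x1 <= x2 ->
  RInt (fun y => Re (f (x1, y))) 0 (2 * PI) = RInt (fun y => Re (f (x2, y))) 0 (2 * PI) /\
  RInt (fun y => Im (f (x1, y))) 0 (2 * PI) = RInt (fun y => Im (f (x2, y))) 0 (2 * PI).
Proof.
  intros Hx. assert (HPI := PI_RGT_0). destruct entire_closed_form as [H1 H2].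
  assert (G1 := goursat _ _ H1 x1 x2 0 (2 * PI) Hx ltac:(lra)).
  assert (G2 := goursat _ _ H2 x1 x2 0 (2 * PI) Hx ltac:(lra)).
  unfold rect_int in G1, G2.
  assert (Hp : forall x, f (x, 2 * PI) = f (x, 0)).
  { intros x. rewrite <- (Hper x 0). rewrite Rplus_0_l; auto. }
  rewrite (RInt_ext (fun x => Re (f (x, 2 * PI))) (fun x => Re (f (x, 0)))) in G1
    by (intros; rewrite Hp; auto).
  rewrite (RInt_ext (fun x => Im (f (x, 2 * PI))) (fun x => Im (f (x, 0)))) in G2
    by (intros; rewrite Hp; auto).
  assert (Hi : forall x, RInt (fun y => - Im (f (x, y))) 0 (2 * PI) = - RInt (fun y => Im (f (x, y))) 0 (2 * PI)).
  { intros x. apply (RInt_opp (V := R_CompleteNormedModule)).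
    apply (ex_RInt_continuous (V := R_CompleteNormedModule)). intros z _; exact (proj2 (entire_continuous x z)). }
  rewrite !Hi in G1. split; lra.
Qed.

Lemma periodic_mean_zero :
  (forall z, Re z < 0 -> f z = 0) -> forall x,
  is_RInt (fun y => Re (f (x, y))) 0 (2 * PI) 0 /\ is_RInt (fun y => Im (f (x, y))) 0 (2 * PI) 0.
Proof.
  intros H0 x.
  assert (Hx : Rmin x (-1) <= x) by apply Rmin_l. assert (Hx' : Rmin x (-1) <= -1) by apply Rmin_r.
  destruct (periodic_mean_const _ _ Hx) as [H1 H2].
  assert (Z : forall y, f (Rmin x (-1), y) = 0) by (intros y; apply H0; unfold Re; simpl; lra).
  assert (Zc : RInt (fun _ : R => 0) 0 (2 * PI) = 0).
  { rewrite RInt_const. unfold scal; simpl; unfold mult; simpl. ring. }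
  rewrite (RInt_ext _ (fun _ => 0)) in H1 by (intros; rewrite Z; auto).
  rewrite (RInt_ext _ (fun _ => 0)) in H2 by (intros; rewrite Z; auto).
  rewrite Zc in H1, H2.
  split; [rewrite H1 at 2|rewrite H2 at 2]; apply (RInt_correct (V := R_CompleteNormedModule));
    apply (ex_RInt_continuous (V := R_CompleteNormedModule)); intros y _.
  - exact (proj1 (entire_continuous x y)).
  - exact (proj2 (entire_continuous x y)).
Qed.
End PeriodicEntire.

Lemma Cexp_real_mult (n x y : R) :
  Cexp (RtoC n * (x, y))%C = (exp (n * x) * cos (n * y), exp (n * x) * sin (n * y)).
Proof. unfold Cexp, Re, Im, RtoC; simpl. f_equal; f_equal; f_equal; ring. Qed.

Lemma cos_sin_nat_period (n : nat) (y : R) :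
  cos (INR n * (y + 2 * PI)) = cos (INR n * y) /\ sin (INR n * (y + 2 * PI)) = sin (INR n * y).
Proof.
  replace (INR n * (y + 2 * PI)) with (INR n * y + 2 * INR n * PI) by ring.
  split; [apply cos_period|apply sin_period].
Qed.

Lemma is_RInt_rescale_period (g : R -> R) :
  is_RInt g 0 (2 * PI) 0 -> is_RInt (fun t => g (2 * PI * t)) 0 1 0.
Proof.
  intros H. assert (HPI := PI_RGT_0).
  assert (H' : is_RInt g (2 * PI * 0 + 0) (2 * PI * 1 + 0) 0) by (rewrite Rmult_0_r, Rmult_1_r, !Rplus_0_r; auto).
  apply (is_RInt_comp_lin (V := R_NormedModule)) in H'.
  apply (is_RInt_scal (V := R_NormedModule)) with (k := / (2 * PI)) in H'.
  change (scal (/ (2 * PI)) 0) with (/ (2 * PI) * 0) in H'. rewrite Rmult_0_r in H'.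
  apply is_RInt_ext_R with (2 := H'). intros t _.
  unfold scal; simpl; unfold mult; simpl. rewrite Rplus_0_r. field; lra.
Qed.

(** Multiplied by [exp (n z)] or [exp (- n z)], the function remains entire, periodic and zero on
    the left half-plane, so its mean over every vertical segment of one period vanishes. Up to a
    positive factor these means are the Fourier coefficients of [y |-> f (x, y)]. *)
Lemma periodic_entire_zero (f : C -> C) :
  (forall z, exists l, is_Cderive f z l) ->
  (forall x y, f (x, y + 2 * PI) = f (x, y)) ->
  (forall z, Re z < 0 -> f z = 0) ->
  forall x y, 0 < y < 2 * PI -> f (x, y) = 0.
Proof.
  intros Hf Hper H0 x y Hy. assert (HPI := PI_RGT_0).
  pose (mode := fun (s : R) z => (f z * Cexp (RtoC s * z))%C).
  assert (Hmode : forall n : nat, forall s, s = INR n \/ s = - INR n ->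
    is_RInt (fun y => Re (mode s (x, y))) 0 (2 * PI) 0 /\
    is_RInt (fun y => Im (mode s (x, y))) 0 (2 * PI) 0).
  { intros n s Hs. apply periodic_mean_zero.
    - intros z. destruct (Hf z) as [l Hl].
      eexists. apply is_Cderive_mult; [exact Hl|].
      apply (is_Cderive_comp Cexp); [apply is_Cderive_Cexp|]. apply is_Cderive_scal, is_Cderive_id.
    - intros u v. unfold mode. rewrite Hper, !Cexp_real_mult.
      destruct (cos_sin_nat_period n v) as [C1 C2].
      destruct Hs as [-> | ->]; [rewrite C1, C2; auto|].
      rewrite !Ropp_mult_distr_l_reverse, !cos_neg, !sin_neg, C1, C2; auto.
    - intros z Hz. unfold mode. rewrite H0 by auto. ring. }
  pose (gr := fun t => Re (f (x, 2 * PI * t))). pose (gi := fun t => Im (f (x, 2 * PI * t))).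
  assert (Hparts : forall n : nat,
     (is_RInt (fun t => gr t * cos_mode n t) 0 1 0 /\ is_RInt (fun t => gr t * sin_mode n t) 0 1 0) /\
     (is_RInt (fun t => gi t * cos_mode n t) 0 1 0 /\ is_RInt (fun t => gi t * sin_mode n t) 0 1 0)).
  { intros n. destruct (Hmode n (INR n) (or_introl eq_refl)) as [A1 A2].
    destruct (Hmode n (- INR n) (or_intror eq_refl)) as [B1 B2].
    apply is_RInt_rescale_period in A1. apply is_RInt_rescale_period in A2.
    apply is_RInt_rescale_period in B1. apply is_RInt_rescale_period in B2.
    (* [c1] and [c2] remove the factors [exp (n x)] and [exp (- n x)] and halve. Sums and
       differences of the modes [n] and [- n] then separate cosine from sine and real from imaginary
       part. *)
    set (c1 := exp (- (INR n * x)) / 2). set (c2 := exp (INR n * x) / 2).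
    assert (Hcc : c2 * 2 * (c1 * 2) = 1).
    { unfold c1, c2. replace (_ * _) with (exp (INR n * x) * exp (- (INR n * x))) by field.
      rewrite <- exp_plus, Rplus_opp_r. apply exp_0. }
    assert (Hform : forall t,
       c1 * Re (mode (INR n) (x, 2 * PI * t)) = (gr t * cos_mode n t - gi t * sin_mode n t) / 2 /\
       c1 * Im (mode (INR n) (x, 2 * PI * t)) = (gr t * sin_mode n t + gi t * cos_mode n t) / 2 /\
       c2 * Re (mode (- INR n) (x, 2 * PI * t)) = (gr t * cos_mode n t + gi t * sin_mode n t) / 2 /\
       c2 * Im (mode (- INR n) (x, 2 * PI * t)) = (- gr t * sin_mode n t + gi t * cos_mode n t) / 2).
    { intros t. unfold mode. rewrite !Cexp_real_mult.
      rewrite !Ropp_mult_distr_l_reverse, cos_neg, sin_neg.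
      replace (INR n * (2 * PI * t)) with (2 * PI * INR n * t) by ring.
      fold (cos_mode n t) (sin_mode n t). unfold gr, gi.
      destruct (f (x, 2 * PI * t)) as [a b]. unfold Re, Im; simpl.
      replace (exp (INR n * x)) with (c2 * 2) by (unfold c2; field).
      replace (exp (- (INR n * x))) with (c1 * 2) by (unfold c1; field).
      repeat split.
      - transitivity ((c2 * 2 * (c1 * 2)) * (a * cos_mode n t - b * sin_mode n t) / 2); [field|rewrite Hcc; field].
      - transitivity ((c2 * 2 * (c1 * 2)) * (a * sin_mode n t + b * cos_mode n t) / 2); [field|rewrite Hcc; field].
      - transitivity ((c2 * 2 * (c1 * 2)) * (a * cos_mode n t + b * sin_mode n t) / 2); [field|rewrite Hcc; field].
      - transitivity ((c2 * 2 * (c1 * 2)) * (- a * sin_mode n t + b * cos_mode n t) / 2); [field|rewrite Hcc; field]. }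
    split; split.
    - apply is_RInt_ext_R with (2 := is_RInt_0_lincomb _ _ c1 c2 A1 B1). intros t _.
      destruct (Hform t) as [-> [_ [-> _]]]. field.
    - apply is_RInt_ext_R with (2 := is_RInt_0_lincomb _ _ c1 (- c2) A2 B2). intros t _.
      destruct (Hform t) as [_ [-> [_ E]]]. rewrite Ropp_mult_distr_l_reverse, E. field.
    - apply is_RInt_ext_R with (2 := is_RInt_0_lincomb _ _ c1 c2 A2 B2). intros t _.
      destruct (Hform t) as [_ [-> [_ ->]]]. field.
    - apply is_RInt_ext_R with (2 := is_RInt_0_lincomb _ _ (- c1) c2 A1 B1). intros t _.
      destruct (Hform t) as [E [_ [-> _]]]. rewrite Ropp_mult_distr_l_reverse, E. field. }
  assert (Hlin : forall t, continuous (fun t => 2 * PI * t) t).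
  { intros t. apply (ex_derive_continuous (V := R_NormedModule)). auto_derive; auto. }
  assert (Hgr : forall t, 0 < t < 1 -> gr t = 0).
  { apply fourier_unique.
    - intros t _. apply (continuous_comp (fun t => 2 * PI * t) (fun y => Re (f (x, y)))); auto.
      exact (proj1 (entire_continuous f Hf x (2 * PI * t))).
    - intros n. exact (proj1 (Hparts n)). }
  assert (Hgi : forall t, 0 < t < 1 -> gi t = 0).
  { apply fourier_unique.
    - intros t _. apply (continuous_comp (fun t => 2 * PI * t) (fun y => Im (f (x, y)))); auto.
      exact (proj2 (entire_continuous f Hf x (2 * PI * t))).
    - intros n. exact (proj2 (Hparts n)). }
  assert (Ht : 0 < y / (2 * PI) < 1).
  { split; [apply Rdiv_lt_0_compat; lra|]. apply Rmult_lt_reg_r with (2 * PI); [lra|].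
    unfold Rdiv. rewrite Rmult_assoc, Rinv_l; lra. }
  specialize (Hgr _ Ht). specialize (Hgi _ Ht). unfold gr, gi in Hgr, Hgi.
  replace (2 * PI * (y / (2 * PI))) with y in Hgr, Hgi by (field; lra).
  destruct (f (x, y)) as [a b]. unfold Re, Im in Hgr, Hgi; simpl in Hgr, Hgi. subst; auto.
Qed.

(** * Uniqueness of the continuation of the Hurwitz zeta function *)

Lemma is_series_C_unique (u : nat -> C) (l l' : C) :
  is_Cseries u l ->
  is_Cseries u l' -> l = l'.
Proof.
  intros H H'.
  exact (filterlim_locally_unique (K := C_AbsRing) (V := C_NormedModule) (F := eventually) _ l l' H H').
Qed.

(* [z |-> 1 + exp (exp z)] omits [1], is [2 pi i]-periodic and has values close to [2] when [Re z] is
   very negative: uniqueness on the punctured plane becomes uniqueness for entire periodic functions. *)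
Lemma hurwitz_continuation_unique (alpha : R) (F G : C -> C) (r : R) :
  0 < r -> is_hurwitz_continuation alpha F -> is_hurwitz_continuation alpha G ->
  F (RtoC (1 - r)) = G (RtoC (1 - r)).
Proof.
  intros Hr [HF1 HF2] [HG1 HG2]. assert (HPI := PI_RGT_0).
  pose (w := fun z => (1 + Cexp (Cexp z))%C).
  pose (f := fun z => (F (w z) + - (1) * G (w z))%C).
  assert (Hw : forall z, w z <> RtoC 1).
  { intros z E. apply (Cexp_neq_0 (Cexp z)).
    replace (Cexp (Cexp z)) with (w z - 1)%C by (unfold w; ring). rewrite E. ring. }
  assert (Hwd : forall z, is_Cderive w z (0 + Cexp (Cexp z) * Cexp z)%C).
  { intros z. apply (is_Cderive_plus (fun _ => 1)); [apply is_Cderive_const|].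
    apply (is_Cderive_comp Cexp Cexp); apply is_Cderive_Cexp. }
  assert (Hz : forall x y, 0 < y < 2 * PI -> f (x, y) = 0).
  { apply periodic_entire_zero.
    - intros z. destruct (HF1 (w z) (Hw z)) as [l Hl]. destruct (HG1 (w z) (Hw z)) as [l' Hl'].
      eexists. apply is_Cderive_plus.
      + exact (is_Cderive_comp F w z l _ Hl (Hwd z)).
      + apply is_Cderive_scal. exact (is_Cderive_comp G w z l' _ Hl' (Hwd z)).
    - intros x y. unfold f, w.
      replace (Cexp (x, y + 2 * PI)) with (Cexp (x, y)); auto.
      unfold Cexp, Re, Im; simpl. rewrite sin_plus, cos_plus, sin_2PI, cos_2PI. f_equal; ring.
    (* For [Re z < 0] the imaginary part of [exp z] is below [1] in modulus, hence below [pi / 2],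
       so [exp (exp z)] has positive real part and both functions are given by the series. *)
    - intros z Hz. assert (Hre : 1 < Re (w z)).
      { unfold w. assert (E : Re (1 + Cexp (Cexp z))%C = 1 + exp (Re (Cexp z)) * cos (Im (Cexp z))) by reflexivity.
        rewrite E. assert (Him : Rabs (Im (Cexp z)) < 1).
        { apply Rle_lt_trans with (1 := Rabs_Im_le _). rewrite Cmod_Cexp, <- exp_0. apply exp_increasing; auto. }
        apply Rabs_def2 in Him. assert (HP2 := PI2_1).
        assert (0 < cos (Im (Cexp z))) by (apply cos_gt_0; lra).
        assert (0 < exp (Re (Cexp z)) * cos (Im (Cexp z))) by (apply Rmult_lt_0_compat; auto; apply exp_pos).
        lra. }
      unfold f. rewrite (is_series_C_unique _ _ _ (HF2 _ Hre) (HG2 _ Hre)). ring. }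
  (* Solves [exp z = ln r + i pi], for which [exp (exp z) = - r]. Modulus and argument of
     [ln r + i pi] are [rho] and [phi]; writing the argument through [atan] shows that it lies in
     [(0, pi)]. *)
  pose (t := ln r / PI). pose (phi := PI / 2 - atan t). pose (rho := PI * sqrt (1 + t²)).
  assert (Hs : 0 < 1 + t²) by (generalize (Rle_0_sqr t); lra).
  assert (Hsq : 0 < sqrt (1 + t²)) by (apply sqrt_lt_R0; auto).
  assert (Hrho : 0 < rho) by (unfold rho; nra).
  assert (Hphi : 0 < phi < PI) by (unfold phi; generalize (atan_bound t); lra).
  specialize (Hz (ln rho) phi ltac:(lra)).
  assert (E : w (ln rho, phi) = RtoC (1 - r)).
  { unfold w. replace (Cexp (ln rho, phi)) with ((ln r, PI) : C).
    - unfold Cexp, Re, Im; simpl. rewrite exp_ln, cos_PI, sin_PI by auto.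
      unfold Cplus, RtoC; simpl. f_equal; ring.
    - unfold Cexp, Re, Im; simpl. rewrite exp_ln by auto. unfold phi.
      rewrite cos_shift, sin_shift, sin_atan, cos_atan. unfold rho.
      f_equal; [|field; lra].
      transitivity (PI * t); [unfold t; field; lra|field; lra]. }
  unfold f in Hz. rewrite E in Hz.
  replace (F (RtoC (1 - r))) with ((F (RtoC (1 - r)) + - (1) * G (RtoC (1 - r))) + G (RtoC (1 - r)))%C by ring.
  rewrite Hz. ring.
Qed.

(** [epsilon] returns a value taken by some continuation as soon as one exists, and uniqueness
    identifies that value with the one of [F]. *)
Lemma hurwitz_zeta_eq (alpha : R) (F : C -> C) (r : R) :
  0 < r -> is_hurwitz_continuation alpha F -> hurwitz_zeta (RtoC (1 - r)) alpha = F (RtoC (1 - r)).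
Proof.
  intros Hr HF. unfold hurwitz_zeta.
  pose (P := fun v => exists F, is_hurwitz_continuation alpha F /\ F (RtoC (1 - r)) = v).
  assert (HP : P (ClassicalEpsilon.epsilon (inhabits (RtoC 0)) P)).
  { apply ClassicalEpsilon.epsilon_spec. exists (F (RtoC (1 - r))), F; auto. }
  fold P. destruct HP as [G [HG E]]. rewrite <- E. apply (hurwitz_continuation_unique alpha); auto.
Qed.

(** * Bernoulli polynomials *)

(* [bern j] is the Bernoulli polynomial [B_j(x) / j!]. *)
Fixpoint bern (j : nat) : R -> R :=
  match j with
  | O => fun _ => 1
  | S j => fun x => RInt (bern j) 0 x - RInt (fun t => RInt (bern j) 0 t) 0 1
  end.

Lemma bern_continuous_derive (j : nat) :
  (forall x, continuous (bern j) x) /\ (forall x, is_derive (bern (S j)) x (bern j x)).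
Proof.
  assert (H : forall j, (forall x, continuous (bern j) x) -> forall x, is_derive (bern (S j)) x (bern j x)).
  { intros i Hi x. simpl.
    evar_last.
    - apply (is_derive_minus (K := R_AbsRing) (V := R_NormedModule)).
      + apply (is_derive_RInt (V := R_NormedModule) (bern i) (fun y => RInt (bern i) 0 y) 0 x).
        * exists (mkposreal 1 Rlt_0_1). intros y _. apply (RInt_correct (V := R_CompleteNormedModule)).
          apply (ex_RInt_continuous (V := R_CompleteNormedModule)). auto.
        * apply Hi.
      + apply (is_derive_const (K := R_AbsRing) (V := R_NormedModule)).
    - unfold minus, plus, opp, zero; simpl. ring. }
  assert (HC : forall j x, continuous (bern j) x).
  { intros i. induction i as [|i IH]; intros x.
    - apply continuous_const.
    - apply (ex_derive_continuous (V := R_NormedModule)). eexists. apply H; auto. }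
  split; auto.
Qed.

Lemma bern_continuous j x : continuous (bern j) x.
Proof. apply (proj1 (bern_continuous_derive j)). Qed.

Lemma bern_derive j x : is_derive (bern (S j)) x (bern j x).
Proof. apply (proj2 (bern_continuous_derive j)). Qed.

Lemma bern_RInt j a b : is_RInt (bern j) a b (bern (S j) b - bern (S j) a).
Proof.
  apply (is_RInt_derive (V := R_CompleteNormedModule) (bern (S j)) (bern j)).
  - intros; apply bern_derive.
  - intros; apply bern_continuous.
Qed.

Lemma is_RInt_R_eq (f : R -> R) (a b I J : R) : is_RInt f a b I -> I = J -> is_RInt f a b J.
Proof. intros H <-. exact H. Qed.

Lemma bern_mean j : is_RInt (bern (S j)) 0 1 0.
Proof.
  assert (Hc : forall x, continuous (fun t => RInt (bern j) 0 t) x).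
  { intros x. apply continuous_ext with (fun t => bern (S j) t - bern (S j) 0).
    - intros t. symmetry. apply (is_RInt_unique (V := R_CompleteNormedModule)). apply bern_RInt.
    - apply (continuous_minus (V := R_NormedModule) (bern (S j)) (fun _ => bern (S j) 0)).
      + apply bern_continuous.
      + apply continuous_const. }
  assert (H1 : is_RInt (fun t => RInt (bern j) 0 t) 0 1 (RInt (fun t => RInt (bern j) 0 t) 0 1)).
  { apply (RInt_correct (V := R_CompleteNormedModule)).
    apply (ex_RInt_continuous (V := R_CompleteNormedModule)). auto. }
  assert (H2 := is_RInt_const (V := R_NormedModule) 0 1 (RInt (fun t => RInt (bern j) 0 t) 0 1)).
  assert (H3 := is_RInt_minus (V := R_NormedModule) _ _ _ _ _ _ H1 H2).
  change (is_RInt (fun x => RInt (bern j) 0 x - RInt (fun t => RInt (bern j) 0 t) 0 1) 0 1 0).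
  apply is_RInt_R_eq with (1 := H3).
  unfold minus, plus, opp, scal; simpl; unfold mult; simpl. ring.
Qed.

(** The zero mean of [bern (S j)] makes the next polynomial return to its initial value. Only
    [bern 1] jumps, by the mean [1] of [bern 0]. *)
Lemma bern_period j : bern (S (S j)) 1 = bern (S (S j)) 0.
Proof.
  assert (H := bern_RInt (S j) 0 1).
  apply (is_RInt_unique (V := R_CompleteNormedModule)) in H.
  rewrite (is_RInt_unique (V := R_CompleteNormedModule) _ _ _ _ (bern_mean j)) in H. lra.
Qed.

Lemma bern_1_jump : bern 1 1 = bern 1 0 + 1.
Proof.
  assert (H := bern_RInt 0 0 1). apply (is_RInt_unique (V := R_CompleteNormedModule)) in H.
  change (bern 0) with (fun _ : R => 1) in H. rewrite RInt_const in H.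
  unfold scal in H; simpl in H; unfold mult in H; simpl in H. simpl. lra.
Qed.

Lemma bern_bounded j : exists B, 0 < B /\ forall x, 0 <= x <= 1 -> Rabs (bern j x) <= B.
Proof.
  destruct (bounded_continuity (K := R_AbsRing) (V := R_NormedModule) (bern j) 0 1) as [M HM].
  { intros; apply bern_continuous. }
  exists (Rmax M 1). split; [apply Rlt_le_trans with 1; [lra|apply Rmax_r]|].
  intros x Hx. apply Rle_trans with M; [left; apply HM; auto|apply Rmax_l].
Qed.

Lemma is_derive_monomial (c x : R) (m : nat) :
  is_derive (fun u => c * (u ^ S m / INR (fact (S m)))) x (c * (x ^ m / INR (fact m))).
Proof.
  assert (E : INR (fact (S m)) = INR (S m) * INR (fact m)) by (rewrite <- mult_INR; reflexivity).
  assert (K1 := INR_fact_neq_0 m). assert (K2 := not_0_INR (S m) (Nat.neq_succ_0 m)).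
  set (f := INR (fact (S m))) in *. clearbody f.
  assert (H := is_derive_pow (fun u => u) (S m) x 1 (is_derive_id x)).
  apply (is_derive_scal _ _ (c * / f)) in H.
  replace (c * (x ^ m / INR (fact m))) with (c * / f * (INR (S m) * 1 * x ^ Nat.pred (S m))).
  - revert H. apply is_derive_ext. intros u. change (c * / f * u ^ S m = c * (u ^ S m / f)). unfold Rdiv; ring.
  - rewrite E. simpl Nat.pred. field; auto.
Qed.

(** In the inductive step both sides have derivative [bern n] and agree at [0]. The Euler-Maclaurin
    main term at a negative integer will appear in exactly this shape. *)
Lemma bern_taylor (n : nat) (u : R) :
  bern n u = sum_f_R0 (fun i => bern i 0 * (u ^ (n - i) / INR (fact (n - i)))) n.
Proof.
  revert u. induction n as [|n IH]; intros u.
  - simpl. field.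
  - pose (T := fun u => sum_f_R0 (fun i => bern i 0 * (u ^ (S n - i) / INR (fact (S n - i)))) (S n)).
    assert (HT : forall u, is_derive T u (bern n u)).
    { intros x. rewrite IH. unfold T.
      assert (Hgen : forall m, (m <= n)%nat ->
        is_derive (fun u => sum_f_R0 (fun i => bern i 0 * (u ^ (S n - i) / INR (fact (S n - i)))) m) x
          (sum_f_R0 (fun i => bern i 0 * (x ^ (n - i) / INR (fact (n - i)))) m)).
      { assert (Hone : forall i, (i <= n)%nat ->
          is_derive (fun u => bern i 0 * (u ^ (S n - i) / INR (fact (S n - i)))) x
            (bern i 0 * (x ^ (n - i) / INR (fact (n - i))))).
        { intros i Hi. replace (S n - i)%nat with (S (n - i)) by lia.
          apply is_derive_monomial. }
        induction m as [|m IHm]; intros Hm.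
        - apply Hone; lia.
        - exact (is_derive_plus (K := R_AbsRing) (V := R_NormedModule) _ _ _ _ _
            (IHm ltac:(lia)) (Hone (S m) Hm)). }
      apply is_derive_ext with (fun u => sum_f_R0 (fun i => bern i 0 * (u ^ (S n - i) / INR (fact (S n - i)))) n
         + bern (S n) 0).
      - intros t. rewrite (tech5 _ n). f_equal. rewrite Nat.sub_diag. simpl. field.
      - evar_last.
        + apply (is_derive_plus (K := R_AbsRing) (V := R_NormedModule)).
          * apply Hgen; lia.
          * apply (is_derive_const (K := R_AbsRing) (V := R_NormedModule)).
        + unfold plus, zero; simpl. ring. }
    assert (H1 := is_RInt_derive (V := R_CompleteNormedModule) T (bern n) 0 u
       (fun x _ => HT x) (fun x _ => bern_continuous n x)).
    assert (H2 := bern_RInt n 0 u).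
    apply (is_RInt_unique (V := R_CompleteNormedModule)) in H1.
    rewrite (is_RInt_unique (V := R_CompleteNormedModule) _ _ _ _ H2) in H1.
    change (bern (S n) u - bern (S n) 0 = T u - T 0) in H1.
    assert (HT0 : T 0 = bern (S n) 0).
    { unfold T. rewrite tech5, Nat.sub_diag.
      assert (Z : sum_f_R0 (fun i => bern i 0 * (0 ^ (S n - i) / INR (fact (S n - i)))) n = 0).
      { transitivity (sum_f_R0 (fun _ => 0) n); [|rewrite sum_cte; ring]. apply sum_eq.
        intros i Hi. rewrite pow_i by lia. unfold Rdiv. ring. }
      rewrite Z. simpl. field. }
    fold (T u). lra.
Qed.

(** * Sums of powers over arithmetic progressions *)

Lemma Rpower_neg_le (x y p : R) : 0 < x -> x <= y -> 0 <= p -> Rpower y (- p) <= Rpower x (- p).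
Proof.
  intros Hx Hxy Hp. rewrite !Rpower_Ropp. apply Rinv_le_contravar; [apply Rpower_pos|].
  apply Rpower_le_compat; auto.
Qed.

Lemma Rpower_neg_lim (a p : R) :
  0 < a -> 0 < p -> is_lim_seq (fun n => Rpower (INR n + a) (- p)) 0.
Proof.
  intros Ha Hp. apply is_lim_seq_spec. intros [eps He]. simpl.
  destruct (Rpower_large p (/ eps) Hp) as [B [HB H]]; [apply Rinv_0_lt_compat; auto|].
  destruct (INR_unbounded B) as [N HN]. exists N. intros n Hn.
  assert (Hn' : INR N <= INR n) by (apply le_INR; auto).
  specialize (H (INR n + a) ltac:(lra)).
  rewrite Rminus_0_r, Rabs_pos_eq by (left; apply Rpower_pos).
  rewrite Rpower_Ropp. rewrite <- (Rinv_inv eps). apply Rinv_lt_contravar; auto.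
  apply Rmult_lt_0_compat; [apply Rinv_0_lt_compat; auto|apply Rpower_pos].
Qed.

Lemma is_series_telescope (t : nat -> R) (l : R) :
  is_lim_seq t l -> is_series (fun n => t n - t (S n)) (t 0%nat - l).
Proof.
  intros H.
  assert (E : forall n, sum_n (fun n => t n - t (S n)) n = t 0%nat - t (S n)).
  { induction n as [|n IH]; [rewrite sum_O; auto|]. rewrite sum_Sn, IH. unfold plus; simpl. ring. }
  change (is_lim_seq (sum_n (fun n => t n - t (S n))) (t 0%nat - l)).
  apply is_lim_seq_ext with (fun n => t 0%nat - t (S n)); [intros; rewrite E; auto|].
  apply is_lim_seq_minus'; [apply is_lim_seq_const|]. apply (is_lim_seq_incr_1 t l); auto.
Qed.

(** Integral test in discrete form: by the mean value theorem the term at [n + 1] is at most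
    [1 / (p - 1)] times the decrease of [x^(1-p)] from [n + a] to [n + 1 + a], and these decreases
    telescope. *)
Lemma ex_series_Rpower (a p : R) :
  0 < a -> 1 < p -> ex_series (fun n => Rpower (INR n + a) (- p)).
Proof.
  intros Ha Hp. apply ex_series_incr_1.
  pose (t := fun n => Rpower (INR n + a) (- (p - 1))).
  apply (ex_series_le (V := R_CompleteNormedModule) _ (fun n => / (p - 1) * (t n - t (S n)))).
  - intros n. change (Rabs (Rpower (INR (S n) + a) (- p)) <= / (p - 1) * (t n - t (S n))).
    rewrite Rabs_pos_eq by (left; apply Rpower_pos).
    assert (Hn := pos_INR n).
    set (x := INR n + a). assert (Hx : 0 < x) by (unfold x; lra).
    assert (Ex : INR (S n) + a = x + 1) by (rewrite S_INR; unfold x; ring).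
    unfold t. rewrite Ex. fold x.
    destruct (MVT_gen (fun y => - Rpower y (- (p - 1))) x (x + 1) (fun y => (p - 1) * Rpower y (- p))) as [c [Hc Hc']].
    + intros y Hy. rewrite Rmin_left in Hy by lra. evar_last.
      * apply (is_derive_opp (K := R_AbsRing) (V := R_NormedModule)). apply is_derive_Rpower_l; lra.
      * unfold opp; simpl. replace (- (p - 1) - 1) with (- p) by ring. ring.
    + intros y Hy. rewrite Rmin_left in Hy by lra. apply continuity_pt_filterlim.
      apply (ex_derive_continuous (V := R_NormedModule) (fun y => - Rpower y (- (p - 1)))). eexists.
      apply (is_derive_opp (K := R_AbsRing) (V := R_NormedModule)). apply is_derive_Rpower_l; lra.
    + rewrite Rmin_left, Rmax_right in Hc by lra.
      replace (Rpower x (- (p - 1)) - Rpower (x + 1) (- (p - 1))) with ((p - 1) * Rpower c (- p)) by lra.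
      rewrite <- Rmult_assoc, Rinv_l, Rmult_1_l by lra. apply Rpower_neg_le; lra.
  - exists (/ (p - 1) * (t 0%nat - 0)).
    apply (is_series_scal (K := R_AbsRing) (V := R_NormedModule) (/ (p - 1)) (fun n => t n - t (S n))).
    apply is_series_telescope. apply Rpower_neg_lim; lra.
Qed.

(** * Calculus of complex-valued functions of a real variable *)

Definition is_path_derive (f : R -> C) (t : R) (l : C) : Prop :=
  is_derive (fun t => Re (f t)) t (Re l) /\ is_derive (fun t => Im (f t)) t (Im l).

Lemma is_path_derive_mult f g t l m :
  is_path_derive f t l -> is_path_derive g t m ->
  is_path_derive (fun t => f t * g t)%C t (l * g t + f t * m)%C.
Proof.
  intros [F1 F2] [G1 G2].
  assert (M : forall u v du dv, is_derive u t du -> is_derive v t dv ->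
     is_derive (fun t => u t * v t) t (du * v t + u t * dv)).
  { intros u v du dv Hu Hv.
    exact (is_derive_mult (K := R_AbsRing) u v t du dv Hu Hv Rmult_comm). }
  split.
  - evar_last.
    + apply (is_derive_minus (K := R_AbsRing) (V := R_NormedModule)
        (fun t => Re (f t) * Re (g t)) (fun t => Im (f t) * Im (g t))); apply M; eauto.
    + unfold Re, Im, minus, plus, opp; simpl. ring.
  - evar_last.
    + apply (is_derive_plus (K := R_AbsRing) (V := R_NormedModule)
        (fun t => Re (f t) * Im (g t)) (fun t => Im (f t) * Re (g t))); apply M; eauto.
    + unfold Re, Im, plus; simpl. ring.
Qed.

Lemma is_path_derive_RtoC h t d : is_derive h t d -> is_path_derive (fun t => RtoC (h t)) t (RtoC d).
Proof.
  intros H. split; [exact H|exact (is_derive_const (K := R_AbsRing) (V := R_NormedModule) 0 t)].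
Qed.

Lemma is_path_derive_const c t : is_path_derive (fun _ => c) t 0.
Proof.
  split; [exact (is_derive_const (K := R_AbsRing) (V := R_NormedModule) (Re c) t)|
          exact (is_derive_const (K := R_AbsRing) (V := R_NormedModule) (Im c) t)].
Qed.

Lemma is_path_derive_plus f g t l m :
  is_path_derive f t l -> is_path_derive g t m -> is_path_derive (fun t => f t + g t)%C t (l + m)%C.
Proof.
  intros [F1 F2] [G1 G2].
  split; [exact (is_derive_plus (K := R_AbsRing) (V := R_NormedModule) _ _ _ _ _ F1 G1)|
          exact (is_derive_plus (K := R_AbsRing) (V := R_NormedModule) _ _ _ _ _ F2 G2)].
Qed.

Lemma is_path_derive_Cexp (z : C) (h : R -> R) t d :
  is_derive h t d -> is_path_derive (fun t => Cexp (z * RtoC (h t)))%C t (RtoC d * z * Cexp (z * RtoC (h t)))%C.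
Proof.
  intros H. destruct z as [p q].
  assert (G : is_path_derive (fun y => Cexp ((p, q) * RtoC y))%C (h t) ((p, q) * Cexp ((p, q) * RtoC (h t)))%C).
  { assert (E : forall y, Cexp ((p, q) * RtoC y)%C = (exp (p * y) * cos (q * y), exp (p * y) * sin (q * y))).
    { intros y. unfold Cexp, Re, Im, RtoC; simpl.
      replace (p * y - q * 0) with (p * y) by ring. replace (p * 0 + q * y) with (q * y) by ring. auto. }
    rewrite E. split.
    - apply is_derive_ext with (fun y => exp (p * y) * cos (q * y)); [intros y; rewrite E; auto|].
      auto_derive; auto. unfold Re; simpl. ring.
    - apply is_derive_ext with (fun y => exp (p * y) * sin (q * y)); [intros y; rewrite E; auto|].
      auto_derive; auto. unfold Im; simpl. ring. }
  destruct G as [G1 G2]. split.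
  - evar_last. + apply (is_derive_comp (K := R_AbsRing) (V := R_NormedModule) (fun y => Re (Cexp ((p, q) * RtoC y))) h); eauto.
    + unfold scal, Re, Im; simpl; unfold mult; simpl. ring.
  - evar_last. + apply (is_derive_comp (K := R_AbsRing) (V := R_NormedModule) (fun y => Im (Cexp ((p, q) * RtoC y))) h); eauto.
    + unfold scal, Re, Im; simpl; unfold mult; simpl. ring.
Qed.

Lemma is_path_derive_Rpow_C (u : R) (z : C) x :
  0 < u + x -> is_path_derive (fun x => Rpow_C (u + x) z) x (z * Rpow_C (u + x) (z - 1))%C.
Proof.
  intros H. unfold Rpow_C.
  replace (z * Cexp ((z - 1) * RtoC (ln (u + x))))%C with
    (RtoC (/ (u + x)) * z * Cexp (z * RtoC (ln (u + x))))%C.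
  - apply (is_path_derive_Cexp z (fun x => ln (u + x))). auto_derive; auto. field; lra.
  - replace ((z - 1) * RtoC (ln (u + x)))%C with (z * RtoC (ln (u + x)) + RtoC (- ln (u + x)))%C
      by (rewrite RtoC_opp; ring).
    rewrite Cexp_plus, Cexp_RtoC, exp_Ropp, exp_ln by auto. ring.
Qed.

Lemma path_derive_continuous f t l :
  is_path_derive f t l -> continuous (fun t => Re (f t)) t /\ continuous (fun t => Im (f t)) t.
Proof.
  intros [H1 H2]. split; apply (ex_derive_continuous (V := R_NormedModule)); eexists; eauto.
Qed.

Lemma is_CInt_derive (f df : R -> C) (a b : R) :
  a <= b -> (forall t, a <= t <= b -> is_path_derive f t (df t)) ->
  (forall t, a <= t <= b -> exists l, is_path_derive df t l) ->
  is_CInt df a b (f b - f a)%C.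
Proof.
  intros Hab Hf Hdf. apply is_RInt_fct_extend_pair.
  - apply (is_RInt_derive (V := R_CompleteNormedModule) (fun t => Re (f t)) (fun t => Re (df t)));
      intros x Hx; rewrite Rmin_left, Rmax_right in Hx by auto.
    + exact (proj1 (Hf x Hx)).
    + destruct (Hdf x Hx) as [l Hl]. exact (proj1 (path_derive_continuous _ _ _ Hl)).
  - apply (is_RInt_derive (V := R_CompleteNormedModule) (fun t => Im (f t)) (fun t => Im (df t)));
      intros x Hx; rewrite Rmin_left, Rmax_right in Hx by auto.
    + exact (proj2 (Hf x Hx)).
    + destruct (Hdf x Hx) as [l Hl]. exact (proj2 (path_derive_continuous _ _ _ Hl)).
Qed.

(** * Analytic continuation of the Hurwitz zeta function by Euler-Maclaurin summation *)

Definition pow_kernel (b : R -> R) (w : C) (u x : R) : C := (Rpow_C (u + x) (- w) * RtoC (b x))%C.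

Definition pow_int (b : R -> R) (w : C) (u : R) : C :=
  RInt (V := C_R_CompleteNormedModule) (pow_kernel b w u) 0 1.

Lemma ex_CInt_shift (s : C) (b : R -> R) (u : R) :
  0 < u -> (forall x, continuous b x) -> exists I, is_CInt (fun x => Rpow_C (u + x) s * RtoC (b x))%C 0 1 I.
Proof.
  intros Hu Hb.
  destruct (ex_CInt_Rpow_C s (fun t => b (t - u)) u (u + 1)) as [I HI]; try lra.
  - intros t _. apply (continuous_comp (fun t => t - u) b); auto.
    apply (ex_derive_continuous (V := R_NormedModule)). auto_derive; auto.
  - exists I. assert (H := is_RInt_comp_lin (V := C_R_NormedModule)
      (fun t => Rpow_C t s * RtoC (b (t - u)%R))%C 1 u 0 1 I).
    replace (1 * 0 + u) with u in H by ring. replace (1 * 1 + u) with (u + 1) in H by ring.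
    specialize (H HI). apply (is_RInt_ext (V := C_R_NormedModule)) with (2 := H).
    intros x _. replace (1 * x + u) with (u + x) by ring. replace (u + x - u) with x by ring.
    exact (scal_one (V := C_R_NormedModule) (Rpow_C (u + x) s * RtoC (b x))%C).
Qed.

Lemma pow_int_correct b w u :
  0 < u -> (forall x, continuous b x) -> is_CInt (pow_kernel b w u) 0 1 (pow_int b w u).
Proof.
  intros Hu Hb. apply (RInt_correct (V := C_R_CompleteNormedModule)).
  destruct (ex_CInt_shift (- w) b u Hu Hb) as [I HI]. exists I; exact HI.
Qed.

(** Reflection makes [bern_refl (S N)] a primitive of [- bern_refl N], so repeated integration by
    parts against it creates no alternating signs. *)
Definition bern_refl (N : nat) (x : R) : R := bern N (1 - x).

Lemma bern_refl_derive N x : is_derive (bern_refl (S N)) x (- bern_refl N x).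
Proof.
  unfold bern_refl. evar_last.
  - apply (is_derive_comp (K := R_AbsRing) (V := R_NormedModule) (bern (S N)) (fun x => 1 - x)).
    + apply bern_derive.
    + auto_derive; auto.
  - unfold scal; simpl; unfold mult; simpl. ring.
Qed.

Lemma bern_refl_continuous N x : continuous (bern_refl N) x.
Proof.
  apply (continuous_comp (fun x => 1 - x) (bern N)); [|apply bern_continuous].
  apply (ex_derive_continuous (V := R_NormedModule)). auto_derive; auto.
Qed.

Lemma bern_refl_bounded N : exists B, 0 < B /\ forall x, 0 <= x <= 1 -> Rabs (bern_refl N x) <= B.
Proof.
  destruct (bern_bounded N) as [B [HB H]]. exists B; split; auto. intros x Hx. apply H; lra.
Qed.

(** The two integrands on the left add up to the derivative of
    [- (u + x)^(-w) * bern_refl (S N) x]. *)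
Lemma pow_int_by_parts (N : nat) (w : C) (u : R) :
  0 < u ->
  (pow_int (bern_refl N) w u + w * pow_int (bern_refl (S N)) (w + 1) u
   = RtoC (bern (S N) 1) * Rpow_C u (- w) - RtoC (bern (S N) 0) * Rpow_C (u + 1) (- w))%C.
Proof.
  intros Hu.
  assert (H1 := pow_int_correct (bern_refl N) w u Hu (bern_refl_continuous N)).
  assert (H2 := pow_int_correct (bern_refl (S N)) (w + 1) u Hu (bern_refl_continuous (S N))).
  assert (H3 := is_CInt_plus _ _ _ _ _ _ H1 (is_CInt_scal _ _ _ _ w H2)).
  apply (is_CInt_unique _ _ _ _ _ H3).
  assert (Em : RtoC (- 1) = (- RtoC 1)%C) by (unfold RtoC, Copp; simpl; f_equal; ring).
  pose (f := fun x => (Rpow_C (u + x) (- w) * (RtoC (- 1) * RtoC (bern_refl (S N) x)))%C).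
  assert (Hd : forall M z t, 0 <= t <= 1 ->
    is_path_derive (fun x => Rpow_C (u + x) z * RtoC (bern_refl (S M) x))%C t
      (z * Rpow_C (u + t) (z - 1) * RtoC (bern_refl (S M) t) + Rpow_C (u + t) z * RtoC (- bern_refl M t))%C).
  { intros M z t Ht.
    apply (is_path_derive_mult (fun x => Rpow_C (u + x) z) (fun x => RtoC (bern_refl (S M) x))).
    - apply is_path_derive_Rpow_C; lra.
    - apply is_path_derive_RtoC, bern_refl_derive. }
  replace (RtoC (bern (S N) 1) * Rpow_C u (- w) - RtoC (bern (S N) 0) * Rpow_C (u + 1) (- w))%C
    with (f 1 - f 0)%C.
  2:{ unfold f, bern_refl. rewrite Rplus_0_r, Rminus_diag, Rminus_0_r, Em. ring. }
  assert (Hfd : forall t, 0 <= t <= 1 -> is_path_derive f t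
     (pow_kernel (bern_refl N) w u t + w * pow_kernel (bern_refl (S N)) (w + 1) u t)%C).
  { intros t Ht. unfold f, pow_kernel.
    assert (E := is_path_derive_mult _ _ _ _ _ (is_path_derive_const (RtoC (-1)) t) (Hd N (- w)%C t Ht)).
    replace (Rpow_C (u + t) (- w) * RtoC (bern_refl N t) + w * (Rpow_C (u + t) (- (w + 1)) * RtoC (bern_refl (S N) t)))%C with
     (0 * (Rpow_C (u + t) (- w) * RtoC (bern_refl (S N) t)) +
     RtoC (-1) * (- w * Rpow_C (u + t) (- w - 1) * RtoC (bern_refl (S N) t) + Rpow_C (u + t) (- w) * RtoC (- bern_refl N t)))%C.
    - destruct E as [E1 E2]. split.
      + revert E1. apply is_derive_ext. intros x. f_equal. ring.
      + revert E2. apply is_derive_ext. intros x. f_equal. ring.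
    - replace (- (w + 1))%C with (- w - 1)%C by ring. rewrite Em, RtoC_opp. ring. }
  apply is_CInt_derive; [lra|exact Hfd|].
  intros t Ht.
  assert (Hex : forall M z, exists l, is_path_derive (fun x => Rpow_C (u + x) z * RtoC (bern_refl M x))%C t l).
  { intros M z.
    assert (HM : exists d, is_derive (bern_refl M) t d).
    { destruct M; [|eexists; apply bern_refl_derive].
      exists 0. exact (is_derive_const (K := R_AbsRing) (V := R_NormedModule) 1 t). }
    destruct HM as [d HM]. eexists.
    apply (is_path_derive_mult (fun x => Rpow_C (u + x) z) (fun x => RtoC (bern_refl M x))).
    - apply is_path_derive_Rpow_C; lra.
    - apply is_path_derive_RtoC; exact HM. }
  destruct (Hex N (- w)%C) as [l1 L1]. destruct (Hex (S N) (- (w + 1))%C) as [l2 L2].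
  eexists. apply (is_path_derive_plus (pow_kernel (bern_refl N) w u)); [exact L1|].
  apply (is_path_derive_mult (fun _ => w)); [apply is_path_derive_const|exact L2].
Qed.

Definition Csum (u : nat -> C) : C :=
  epsilon (inhabits (RtoC 0)) (fun l => is_Cseries u l).

Lemma Csum_correct (u : nat -> C) :
  (exists l, is_Cseries u l) ->
  is_Cseries u (Csum u).
Proof. apply epsilon_spec. Qed.

Lemma is_series_C_scal (u : nat -> C) (l c : C) :
  is_Cseries u l ->
  is_Cseries (fun n => c * u n)%C (c * l)%C.
Proof. exact (is_series_scal (K := C_AbsRing) (V := C_NormedModule) c u l). Qed.

Lemma is_series_C_plus (u v : nat -> C) (l m : C) :
  is_Cseries u l ->
  is_Cseries v m ->
  is_Cseries (fun n => u n + v n)%C (l + m)%C.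
Proof. exact (is_series_plus (K := C_AbsRing) (V := C_NormedModule) u v l m). Qed.

Lemma is_series_C_ext (u v : nat -> C) (l : C) :
  (forall n, u n = v n) ->
  is_Cseries u l ->
  is_Cseries v l.
Proof. exact (is_series_ext (K := C_AbsRing) (V := C_NormedModule) u v l). Qed.

(** Taylor remainders quadratic in [h] with summable constants add up to a remainder of the same
    kind, so the series may be differentiated term by term. *)
Lemma is_Cderive_series (f : nat -> C -> C) (g : nat -> C) (c : nat -> R) (w : C) (d : R) :
  0 < d -> ex_series c ->
  (forall n h, Cmod h < d -> Cmod (f n (w + h) - f n w - g n * h)%C <= c n * Cmod h ^ 2) ->
  (forall h, Cmod h < d -> exists l, is_Cseries (fun n => f n (w + h)%C) l) ->
  (exists l, is_Cseries g l) ->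
  exists G, is_Cderive (fun w => Csum (fun n => f n w)) w G.
Proof.
  intros Hd [K HK] Hq Hf Hg. exists (Csum g). apply is_Cderive_eps. intros eps He.
  assert (HK0 : 0 < Rabs K + 1) by (generalize (Rabs_pos K); lra).
  exists (Rmin d (eps / (Rabs K + 1))).
  split. { apply Rmin_glb_lt; auto. apply Rdiv_lt_0_compat; auto. }
  intros h Hh. assert (Q1 := Rmin_l d (eps / (Rabs K + 1))). assert (Q2 := Rmin_r d (eps / (Rabs K + 1))).
  assert (S1 := Csum_correct _ (Hf h ltac:(lra))).
  assert (S0 : is_Cseries (fun n => f n w) (Csum (fun n => f n w))).
  { apply Csum_correct. destruct (Hf 0) as [l Hl]; [rewrite Cmod_0; auto|].
    exists l. apply is_series_C_ext with (2 := Hl). intros n. f_equal; ring. }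
  assert (S2 := Csum_correct _ Hg).
  assert (T := is_series_C_plus _ _ _ _ S1 (is_series_C_plus _ _ _ _ (is_series_C_scal _ _ (- 1) S0)
     (is_series_C_scal _ _ (- h) S2))).
  replace (Csum (fun n => f n (w + h)) - Csum (fun n => f n w) - Csum g * h)%C with
     (Csum (fun n => f n (w + h)) + ((- 1) * Csum (fun n => f n w) + - h * Csum g))%C by ring.
  assert (Hm := Cmod_ge_0 h).
  apply Rle_trans with (Cmod h ^ 2 * K).
  - apply Cmod_series_le with (2 := is_series_scal (Cmod h ^ 2) c K HK) (3 := T).
    intros n. replace (f n (w + h) + ((- 1) * f n w + - h * g n))%C with (f n (w + h) - f n w - g n * h)%C by ring.
    apply Rle_trans with (1 := Hq n h ltac:(lra)). right. unfold scal; simpl; unfold mult; simpl. ring.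
  - simpl. rewrite Rmult_1_r. rewrite (Rmult_comm eps), Rmult_assoc. apply Rmult_le_compat_l; auto.
    apply Rle_trans with (Cmod h * Rabs K); [apply Rmult_le_compat_l; auto; apply Rle_abs|].
    apply Rle_trans with (eps / (Rabs K + 1) * (Rabs K + 1)); [|right; field; lra].
    apply Rmult_le_compat; try lra. apply Rabs_pos.
Qed.

Lemma sqr_le_exp (y : R) : 0 <= y -> y ^ 2 <= 4 * exp y.
Proof.
  intros Hy. assert (E := exp_ineq1_le (y / 2)).
  assert (E2 : exp y = exp (y / 2) * exp (y / 2)) by (rewrite <- exp_plus; f_equal; field).
  rewrite E2. nra.
Qed.

(** The exponential is [v^(2d)] when [v >= 1] and [v^(-2d)] below [1], where the excess [v^(-4d)] is
    bounded since [v >= a]. Powers of the logarithm thus cost a shift of the exponent by [2 d]. *)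
Lemma Rpower_exp_ln_le (a t d v : R) :
  0 < a -> 0 <= d -> a <= v ->
  Rpower v (- t) * exp (2 * d * Rabs (ln v)) <= (1 + Rpower a (- (4 * d))) * Rpower v (- (t - 2 * d)).
Proof.
  intros Ha Hd Hv.
  assert (Ev : Rpower v (- (t - 2 * d)) = Rpower v (- t) * Rpower v (2 * d)).
  { rewrite <- Rpower_plus. f_equal; ring. }
  rewrite Ev. assert (P1 := Rpower_pos v (- t)). assert (P2 := Rpower_pos v (2 * d)).
  assert (P3 := Rpower_pos a (- (4 * d))).
  replace ((1 + Rpower a (- (4 * d))) * (Rpower v (- t) * Rpower v (2 * d))) with
    (Rpower v (- t) * ((1 + Rpower a (- (4 * d))) * Rpower v (2 * d))) by ring.
  apply Rmult_le_compat_l; [lra|].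
  destruct (Rle_dec 0 (ln v)) as [H|H].
  - rewrite Rabs_pos_eq by auto. change (exp (2 * d * ln v)) with (Rpower v (2 * d)). nra.
  - rewrite Rabs_left by lra. replace (2 * d * - ln v) with ((2 * d + - (4 * d)) * ln v) by ring.
    change (exp ((2 * d + - (4 * d)) * ln v)) with (Rpower v (2 * d + - (4 * d))). rewrite Rpower_plus.
    assert (Rpower v (- (4 * d)) <= Rpower a (- (4 * d))) by (apply Rpower_neg_le; lra).
    rewrite Rmult_comm. apply Rmult_le_compat_r; lra.
Qed.

(** First-order expansion of [v^(-w)] in the exponent, uniform over [v >= a]. The logarithms are
    absorbed by [Rpower_exp_ln_le]; [20 = 5 * 4] comes from [Cexp_taylor_le] and [sqr_le_exp], and
    [/ d] from [d * |ln v| <= exp (2 d |ln v|)]. *)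
Lemma Rpow_C_opp_taylor (a d : R) (w h : C) :
  0 < a -> 0 < d -> Cmod h <= d ->
  let K := (20 / d ^ 2 + / d) * (1 + Rpower a (- (4 * d))) in
  forall v, a <= v ->
    Cmod (Rpow_C v (- (w + h)) - Rpow_C v (- w) - (- RtoC (ln v) * Rpow_C v (- w)) * h)%C
      <= K * Rpower v (- (Re w - 2 * d)) * Cmod h ^ 2 /\
    Cmod (- RtoC (ln v) * Rpow_C v (- w))%C <= K * Rpower v (- (Re w - 2 * d)).
Proof.
  intros Ha Hd Hh K v Hv.
  assert (B := Rpower_exp_ln_le a (Re w) d v Ha (Rlt_le _ _ Hd) Hv).
  set (L := ln v) in *. set (A := 1 + Rpower a (- (4 * d))) in *.
  assert (HA : 0 < A) by (unfold A; generalize (Rpower_pos a (- (4 * d))); lra).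
  set (X := A * Rpower v (- (Re w - 2 * d))) in *.
  assert (HKX : K * Rpower v (- (Re w - 2 * d)) = (20 / d ^ 2 + / d) * X) by (unfold K, X; ring).
  rewrite HKX.
  assert (HmL := Rabs_pos L). assert (Hmh := Cmod_ge_0 h).
  assert (Hpw : Cmod (Rpow_C v (- w)) = Rpower v (- Re w)).
  { rewrite Cmod_Rpow_C. f_equal. }
  assert (Ppos := Rpower_pos v (- Re w)).
  assert (Hd2 : 0 < 20 / d ^ 2) by (apply Rdiv_lt_0_compat; [lra|apply pow_lt; auto]).
  assert (Hd1 : 0 < / d) by (apply Rinv_0_lt_compat; auto).
  assert (HX : 0 <= X) by (apply Rle_trans with (2 := B); apply Rmult_le_pos; [lra|left; apply exp_pos]).
  split.
  - replace (Rpow_C v (- (w + h)) - Rpow_C v (- w) - - RtoC L * Rpow_C v (- w) * h)%C with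
      (Rpow_C v (- w) * (Cexp (- h * RtoC L) - 1 - (- h * RtoC L)))%C.
    2:{ replace (- (w + h))%C with (- w + - h)%C by ring. rewrite Rpow_C_plus.
        change (Rpow_C v (- h)) with (Cexp (- h * RtoC L)). ring. }
    rewrite Cmod_mult, Hpw.
    assert (T := Cexp_taylor_le (- h * RtoC L)). rewrite Cmod_mult, Cmod_opp, Cmod_R in T.
    set (y := d * Rabs L). assert (Hy : 0 <= y) by (unfold y; nra).
    assert (Hyd : Cmod h * Rabs L <= y) by (unfold y; apply Rmult_le_compat_r; auto).
    assert (S := sqr_le_exp y Hy).
    assert (E2 : exp (2 * d * Rabs L) = exp y * exp y) by (rewrite <- exp_plus; f_equal; unfold y; ring).
    rewrite E2 in B. assert (Pe := exp_pos y).
    assert (Ee : exp (Cmod h * Rabs L) <= exp y).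
    { destruct Hyd as [Hyd|Hyd]; [left; apply exp_increasing; auto|rewrite Hyd; right; auto]. }
    assert (EL : Rabs L ^ 2 = y ^ 2 / d ^ 2) by (unfold y; field; lra).
    apply Rle_trans with (Rpower v (- Re w) * ((5 * exp y) * (4 * exp y / d ^ 2 * Cmod h ^ 2))).
    + apply Rmult_le_compat_l; [lra|]. apply Rle_trans with (1 := T).
      apply Rmult_le_compat; [generalize (exp_pos (Cmod h * Rabs L)); lra|apply pow2_ge_0|lra|].
      rewrite Rpow_mult_distr, (Rmult_comm (Cmod h ^ 2)), EL. apply Rmult_le_compat_r; [apply pow2_ge_0|].
      apply Rmult_le_compat_r; [left; apply Rinv_0_lt_compat, pow_lt; auto|auto].
    + replace (Rpower v (- Re w) * (5 * exp y * (4 * exp y / d ^ 2 * Cmod h ^ 2))) with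
        (20 / d ^ 2 * (Rpower v (- Re w) * (exp y * exp y)) * Cmod h ^ 2) by (field; lra).
      apply Rmult_le_compat_r; [apply pow2_ge_0|].
      apply Rle_trans with (20 / d ^ 2 * X); [apply Rmult_le_compat_l; lra|].
      apply Rmult_le_compat_r; lra.
  - rewrite Cmod_mult, Hpw, Cmod_opp, Cmod_R.
    assert (E := exp_ineq1_le (2 * d * Rabs L)).
    assert (HL : Rabs L <= / d * exp (2 * d * Rabs L)).
    { apply Rmult_le_reg_l with d; auto. rewrite <- Rmult_assoc, Rinv_r, Rmult_1_l by lra. nra. }
    apply Rle_trans with (/ d * (Rpower v (- Re w) * exp (2 * d * Rabs L))).
    + rewrite (Rmult_comm (Rabs L)). rewrite <- Rmult_assoc, (Rmult_comm (/ d)), Rmult_assoc.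
      apply Rmult_le_compat_l; lra.
    + apply Rle_trans with (/ d * X); [apply Rmult_le_compat_l; lra|].
      apply Rmult_le_compat_r; lra.
Qed.

Lemma Cmod_CInt_const_le (f : R -> C) (I : C) (B : R) :
  is_CInt f 0 1 I -> (forall x, 0 <= x <= 1 -> Cmod (f x) <= B) -> Cmod I <= B.
Proof.
  intros HI HB. apply (Cmod_CInt_le f (fun _ => B) 0 1 I B); auto; [lra|].
  apply is_RInt_R_eq with (1 := is_RInt_const (V := R_NormedModule) 0 1 B).
  unfold scal; simpl; unfold mult; simpl; ring.
Qed.

Lemma Cmod_pow_int_le (b : R -> R) (B : R) (w : C) (u : R) :
  0 < u -> 0 <= B -> 0 <= Re w -> (forall x, continuous b x) -> (forall x, 0 <= x <= 1 -> Rabs (b x) <= B) ->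
  Cmod (pow_int b w u) <= B * Rpower u (- Re w).
Proof.
  intros Hu HB Hw Hc Hb. apply (Cmod_CInt_const_le (pow_kernel b w u)).
  - apply pow_int_correct; auto.
  - intros x Hx. unfold pow_kernel. rewrite Cmod_mult, Cmod_Rpow_C, Cmod_R, Rmult_comm.
    apply Rmult_le_compat; [apply Rabs_pos|left; apply Rpower_pos|auto|].
    replace (Re (- w)%C) with (- Re w) by reflexivity. apply Rpower_neg_le; lra.
Qed.

Section PowIntSeries.
Variables (b : R -> R) (B a : R).
Hypothesis (Hc : forall x, continuous b x).
Hypothesis (HB : 0 <= B).
Hypothesis (Hb : forall x, 0 <= x <= 1 -> Rabs (b x) <= B).
Hypothesis (Ha : 0 < a).

Lemma pos_shift (n : nat) : 0 < INR n + a /\ a <= INR n + a.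
Proof. generalize (pos_INR n); lra. Qed.

Lemma ex_series_pow_int (w : C) :
  1 < Re w ->
  exists l, is_Cseries (fun n => pow_int b w (INR n + a)) l.
Proof.
  intros Hw. apply ex_series_C_le with (fun n => B * Rpower (INR n + a) (- Re w)).
  - intros n. apply Cmod_pow_int_le; auto; [apply pos_shift|lra].
  - apply (ex_series_scal (K := R_AbsRing) (V := R_NormedModule) B). apply ex_series_Rpower; auto.
Qed.

Lemma Csum_pow_int_derive (w : C) :
  1 < Re w -> exists G, is_Cderive (fun w => Csum (fun n => pow_int b w (INR n + a))) w G.
Proof.
  (* A quarter of the available room: [Re w - 2 d] is still above [1], so the bounds are summable,
     and [Re (w + h) > 1] for [|h| < d]. *)
  intros Hw. pose (d := (Re w - 1) / 4). assert (Hd : 0 < d) by (unfold d; lra).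
  pose (K := (20 / d ^ 2 + / d) * (1 + Rpower a (- (4 * d)))).
  assert (HK : 0 < K).
  { apply Rmult_lt_0_compat; [|generalize (Rpower_pos a (- (4 * d))); lra].
    apply Rplus_lt_0_compat; [apply Rdiv_lt_0_compat; [lra|apply pow_lt; auto]|apply Rinv_0_lt_compat; auto]. }
  pose (k := fun u x => (- RtoC (ln (u + x)) * Rpow_C (u + x) (- w) * RtoC (b x))%C).
  assert (Hk : forall n, is_CInt (k (INR n + a)%R) 0 1
     (RInt (V := C_R_CompleteNormedModule) (k (INR n + a)%R) 0 1)).
  { intros n. destruct (pos_shift n) as [Hn _].
    (* [Rabs] makes the logarithm continuous on the whole line, as [ex_CInt_shift] demands; on the
       unit interval it changes nothing. *)
    destruct (ex_CInt_shift (- w) (fun x => b x * ln (INR n + a + Rabs x)) (INR n + a) Hn) as [I HI].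
    { intros x. apply (continuous_mult b (fun x => ln (INR n + a + Rabs x))); auto.
      apply (continuous_comp (fun x => INR n + a + Rabs x) ln).
      - apply (continuous_plus (V := R_NormedModule) (fun _ => INR n + a) Rabs).
        + apply continuous_const. + apply continuous_Rabs.
      - apply (ex_derive_continuous (V := R_NormedModule)). auto_derive. generalize (Rabs_pos x); lra. }
    apply (RInt_correct (V := C_R_CompleteNormedModule)). exists (- 1 * I)%C.
    apply is_CInt_ext with (2 := is_CInt_scal _ _ _ _ (- 1) HI).
    intros x Hx. rewrite Rmin_left in Hx by lra. unfold k. rewrite Rabs_pos_eq, RtoC_mult by lra. ring. }
  assert (Hsum : ex_series (fun n => B * K * Rpower (INR n + a) (- (Re w - 2 * d)))).
  { apply (ex_series_scal (K := R_AbsRing) (V := R_NormedModule) (B * K)). apply ex_series_Rpower; auto.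
    unfold d; lra. }
  assert (Htau : 0 <= Re w - 2 * d) by (unfold d; lra).
  apply (is_Cderive_series (fun n w => pow_int b w (INR n + a))
     (fun n => RInt (V := C_R_CompleteNormedModule) (k (INR n + a)%R) 0 1)
     (fun n => B * K * Rpower (INR n + a) (- (Re w - 2 * d))) w d Hd Hsum).
  - intros n h Hh. destruct (pos_shift n) as [Hn Hn'].
    assert (I1 := pow_int_correct b (w + h) _ Hn Hc). assert (I0 := pow_int_correct b w _ Hn Hc).
    assert (T := is_CInt_plus _ _ _ _ _ _ I1 (is_CInt_plus _ _ _ _ _ _ (is_CInt_scal _ _ _ _ (- 1) I0)
       (is_CInt_scal _ _ _ _ (- h) (Hk n)))).
    replace (pow_int b (w + h) (INR n + a) - pow_int b w (INR n + a) -
        RInt (V := C_R_CompleteNormedModule) (k (INR n + a)%R) 0 1 * h)%C with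
      (pow_int b (w + h) (INR n + a) + (- 1 * pow_int b w (INR n + a) +
       - h * RInt (V := C_R_CompleteNormedModule) (k (INR n + a)%R) 0 1))%C by ring.
    apply (Cmod_CInt_const_le _ _ _ T). intros x Hx. unfold pow_kernel, k.
    set (v := INR n + a + x).
    replace (Rpow_C v (- (w + h)) * RtoC (b x) + (- 1 * (Rpow_C v (- w) * RtoC (b x)) +
       - h * (- RtoC (ln v) * Rpow_C v (- w) * RtoC (b x))))%C with
      (RtoC (b x) * (Rpow_C v (- (w + h)) - Rpow_C v (- w) - (- RtoC (ln v) * Rpow_C v (- w)) * h))%C by ring.
    rewrite Cmod_mult, Cmod_R.
    destruct (Rpow_C_opp_taylor a d w h Ha Hd ltac:(lra) v ltac:(unfold v; lra)) as [E _]. fold K in E.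
    assert (Em : Rpower v (- (Re w - 2 * d)) <= Rpower (INR n + a) (- (Re w - 2 * d))).
    { apply Rpower_neg_le; unfold v; lra. }
    rewrite !Rmult_assoc. apply Rmult_le_compat; [apply Rabs_pos|apply Cmod_ge_0|auto|].
    apply Rle_trans with (1 := E). rewrite !Rmult_assoc. apply Rmult_le_compat_l; [lra|].
    apply Rmult_le_compat_r; [apply pow2_ge_0|auto].
  - intros h Hh. apply ex_series_pow_int.
    assert (Hre : Re (w + h)%C = Re w + Re h) by reflexivity. rewrite Hre.
    assert (E := Rabs_Re_le h). assert (E2 := Rle_abs (- Re h)). rewrite Rabs_Ropp in E2.
    unfold d in Hh. lra.
  - apply ex_series_C_le with (fun n => B * K * Rpower (INR n + a) (- (Re w - 2 * d))); auto.
    intros n. destruct (pos_shift n) as [Hn Hn'].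
    apply (Cmod_CInt_const_le _ _ _ (Hk n)). intros x Hx. unfold k. set (v := INR n + a + x).
    rewrite Cmod_mult, Cmod_R, Rmult_comm.
    destruct (Rpow_C_opp_taylor a d w 0 Ha Hd ltac:(rewrite Cmod_0; lra) v ltac:(unfold v; lra)) as [_ E]. fold K in E.
    assert (Em : Rpower v (- (Re w - 2 * d)) <= Rpower (INR n + a) (- (Re w - 2 * d))).
    { apply Rpower_neg_le; unfold v; lra. }
    rewrite Rmult_assoc. apply Rmult_le_compat; [apply Rabs_pos|apply Cmod_ge_0|auto|].
    apply Rle_trans with (1 := E). apply Rmult_le_compat_l; lra.
Qed.
End PowIntSeries.

Definition Cdiffable (f : C -> C) (z : C) : Prop := exists l, is_Cderive f z l.

Lemma Cdiffable_plus f g z : Cdiffable f z -> Cdiffable g z -> Cdiffable (fun z => f z + g z)%C z.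
Proof. intros [l Hl] [m Hm]. eexists. apply is_Cderive_plus; eauto. Qed.

Lemma Cdiffable_mult f g z : Cdiffable f z -> Cdiffable g z -> Cdiffable (fun z => f z * g z)%C z.
Proof. intros [l Hl] [m Hm]. eexists. apply is_Cderive_mult; eauto. Qed.

Lemma Cdiffable_const c z : Cdiffable (fun _ => c) z.
Proof. eexists. apply is_Cderive_const. Qed.

Lemma Cdiffable_id z : Cdiffable (fun z => z) z.
Proof. eexists. apply is_Cderive_id. Qed.

Lemma Cdiffable_comp f g z : Cdiffable f (g z) -> Cdiffable g z -> Cdiffable (fun z => f (g z)) z.
Proof. intros [l Hl] [m Hm]. eexists. apply (is_Cderive_comp f g); eauto. Qed.

Lemma Cdiffable_ext f g z : (forall z, f z = g z) -> Cdiffable f z -> Cdiffable g z.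
Proof.
  intros E [l Hl]. exists l. apply is_Cderive_eps. intros eps He.
  destruct (proj1 (is_Cderive_eps _ _ _) Hl eps He) as [d [Hd H]]. exists d; split; auto.
  intros h Hh. rewrite <- !E. auto.
Qed.

Lemma Cdiffable_ext_loc f g z d :
  0 < d -> (forall h, Cmod h < d -> f (z + h)%C = g (z + h)%C) -> Cdiffable f z -> Cdiffable g z.
Proof.
  intros Hd0 E [l Hl]. exists l. apply is_Cderive_eps. intros eps He.
  destruct (proj1 (is_Cderive_eps _ _ _) Hl eps He) as [d' [Hd H]].
  exists (Rmin d d'). split; [apply Rmin_glb_lt; auto|]. intros h Hh.
  assert (Q1 := Rmin_l d d'). assert (Q2 := Rmin_r d d').
  rewrite <- (E h) by lra.
  assert (E0 := E 0 ltac:(rewrite Cmod_0; auto)). rewrite Cplus_0_r in E0. rewrite <- E0.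
  apply H; lra.
Qed.

Lemma Cdiffable_Rpow_C u f z : Cdiffable f z -> Cdiffable (fun z => Rpow_C u (f z)) z.
Proof.
  intros Hf. unfold Rpow_C. apply (Cdiffable_comp Cexp (fun z => f z * RtoC (ln u))%C).
  - eexists; apply is_Cderive_Cexp.
  - apply Cdiffable_mult; [auto|apply Cdiffable_const].
Qed.

Lemma Cdiffable_inv (z : C) : z <> 0 -> Cdiffable (fun z => / z)%C z.
Proof.
  intros Hz. exists (- / (z * z))%C. apply is_Cderive_eps. intros eps He.
  assert (Hm : 0 < Cmod z) by (apply Cmod_gt_0; auto).
  set (r := Cmod z) in *. assert (Hr3 : 0 < r ^ 3) by (apply pow_lt; auto).
  exists (Rmin (r / 2) (eps * r ^ 3 / 2)).
  split. { apply Rmin_glb_lt; [lra|]. apply Rdiv_lt_0_compat; [apply Rmult_lt_0_compat; auto|lra]. }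
  intros h Hh. assert (Q1 := Rmin_l (r / 2) (eps * r ^ 3 / 2)). assert (Q2 := Rmin_r (r / 2) (eps * r ^ 3 / 2)).
  assert (Hzh : r / 2 <= Cmod (z + h)).
  { assert (T := Cmod_triangle (z + h) (- h)). replace (z + h + - h)%C with z in T by ring.
    rewrite Cmod_opp in T. fold r in T. lra. }
  assert (Hzh0 : (z + h <> 0)%C) by (apply Cmod_gt_0; lra).
  replace (/ (z + h) - / z - - / (z * z) * h)%C with (h * h / (z * z * (z + h)))%C by (field; auto).
  rewrite Cmod_div by (repeat apply Cmult_neq_0; auto). rewrite !Cmod_mult. fold r.
  assert (Hh0 := Cmod_ge_0 h).
  apply Rle_trans with (Cmod h * Cmod h / (r * r * (r / 2))).
  - apply Rmult_le_compat_l; [nra|]. apply Rinv_le_contravar; [|apply Rmult_le_compat_l; nra].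
    assert (0 < r * r) by nra. nra.
  - replace (Cmod h * Cmod h / (r * r * (r / 2))) with ((2 * Cmod h / r ^ 3) * Cmod h) by (field; lra).
    apply Rmult_le_compat_r; auto. apply Rmult_le_reg_r with (r ^ 3); auto.
    unfold Rdiv. rewrite Rmult_assoc, Rinv_l by lra. lra.
Qed.

Lemma is_series_C_telescope (t : nat -> C) (l : C) :
  (forall eps, 0 < eps -> exists N, forall n, (N <= n)%nat -> Cmod (t n - l) < eps) ->
  is_Cseries (fun n => t n - t (S n))%C (t 0%nat - l)%C.
Proof.
  intros H. apply is_series_C_eps. intros eps He. destruct (H eps He) as [N HN].
  exists N. intros n Hn.
  assert (E : forall n, sum_n (G := C_AbelianMonoid) (fun n => t n - t (S n))%C n = (t 0%nat - t (S n))%C).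
  { induction n0 as [|m IH]; [apply sum_O|]. rewrite sum_Sn, IH.
    change ((t 0%nat - t (S m) + (t (S m) - t (S (S m))))%C = (t 0%nat - t (S (S m)))%C). ring. }
  rewrite E. replace (t 0%nat - t (S n) - (t 0%nat - l))%C with (- (t (S n) - l))%C by ring.
  rewrite Cmod_opp. apply HN; lia.
Qed.

Lemma Rpow_C_shift_lim (a : R) (z c : C) :
  0 < a -> Re z < 0 -> forall eps, 0 < eps ->
  exists N, forall n, (N <= n)%nat -> Cmod (c * Rpow_C (INR n + a) z)%C < eps.
Proof.
  intros Ha Hz eps He. assert (L := Rpower_neg_lim a (- Re z) Ha ltac:(lra)).
  apply is_lim_seq_spec in L. assert (Hc := Cmod_ge_0 c).
  assert (He' : 0 < eps / (Cmod c + 1)) by (apply Rdiv_lt_0_compat; lra).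
  destruct (L (mkposreal _ He')) as [N HN]. exists N. intros n Hn. specialize (HN n Hn).
  simpl in HN. rewrite Rminus_0_r, Rabs_pos_eq, Ropp_involutive in HN by (left; apply Rpower_pos).
  rewrite Cmod_mult, Cmod_Rpow_C. apply Rle_lt_trans with (Cmod c * (eps / (Cmod c + 1))).
  - apply Rmult_le_compat_l; lra.
  - apply Rmult_lt_reg_r with (Cmod c + 1); [lra|]. field_simplify; [|lra]. nra.
Qed.

(* [cpoch N s * Rpow_C u (- (s + N))] is the [N]-th derivative of [u ^ (-s)] in [u]. *)
Fixpoint cpoch (N : nat) (s : C) : C :=
  match N with O => 1 | S n => (cpoch n s * - (s + RtoC (INR n)))%C end.

(** The boundary terms of the Euler-Maclaurin expansion of the sum of [(n + u)^(-s)] over [n >= 0]: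
    the integral [u^(1-s) / (s - 1)] minus [B_(j+1) / (j+1)!] times the [j]-th derivative of
    [u^(-s)], for [j < N]. *)
Fixpoint em_main (N : nat) (s : C) (u : R) : C :=
  match N with
  | O => (Rpow_C u (1 - s) / (s - 1))%C
  | S n => (em_main n s u - RtoC (bern (S n) 0) * (cpoch n s * Rpow_C u (- (s + RtoC (INR n)))))%C
  end.

Definition em_tail (N : nat) (s : C) (a : R) : C :=
  Csum (fun n => pow_int (bern_refl N) (s + RtoC (INR N)) (INR n + a)).

Definition em_zeta (N : nat) (a : R) (s : C) : C := (em_main N s a - cpoch N s * em_tail N s a)%C.

Lemma em_tail_correct N s a :
  0 < a -> 1 < Re s + INR N ->
  is_Cseries
    (fun n => pow_int (bern_refl N) (s + RtoC (INR N)) (INR n + a)) (em_tail N s a).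
Proof.
  intros Ha Hs. apply Csum_correct. destruct (bern_refl_bounded N) as [B [HB HB']].
  apply (ex_series_pow_int (bern_refl N) B a); auto; [apply bern_refl_continuous|lra].
Qed.

Lemma RtoC_INR_S n : RtoC (INR (S n)) = (RtoC (INR n) + 1)%C.
Proof. rewrite S_INR, RtoC_plus. auto. Qed.

Lemma em_main_diff_0 (s : C) (u : R) : s <> 1 -> 0 < u ->
  (em_main 0 s (u + 1) - em_main 0 s u = - pow_int (bern_refl 0) s u)%C.
Proof.
  intros Hs Hu. assert (Hs1 : (s - 1 <> 0)%C).
  { intros K. apply Hs. replace s with (s - 1 + 1)%C by ring. rewrite K. ring. }
  pose (f := fun x => (/ (1 - s) * Rpow_C (u + x) (1 - s))%C).
  assert (Hs2 : (1 - s <> 0)%C).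
  { intros K. apply Hs1. replace (s - 1)%C with (- (1 - s))%C by ring. rewrite K. ring. }
  assert (Hf : forall t, 0 <= t <= 1 -> is_path_derive f t (pow_kernel (bern_refl 0) s u t)).
  { intros t Ht.
    assert (E := is_path_derive_mult (fun _ => / (1 - s))%C (fun x => Rpow_C (u + x) (1 - s)) t _ _
      (is_path_derive_const _ t) (is_path_derive_Rpow_C u (1 - s) t ltac:(lra))).
    replace (pow_kernel (bern_refl 0) s u t) with
      (0 * Rpow_C (u + t) (1 - s) + / (1 - s) * ((1 - s) * Rpow_C (u + t) (1 - s - 1)))%C; [exact E|].
    unfold pow_kernel, bern_refl. simpl. replace (1 - s - 1)%C with (- s)%C by ring. field; auto. }
  assert (H := is_CInt_derive f (pow_kernel (bern_refl 0) s u) 0 1 ltac:(lra) Hf).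
  assert (Hd : forall t, 0 <= t <= 1 -> exists l, is_path_derive (pow_kernel (bern_refl 0) s u) t l).
  { intros t Ht. eexists.
    apply (is_path_derive_mult (fun x => Rpow_C (u + x) (- s)) (fun x => RtoC (bern_refl 0 x))).
    - apply is_path_derive_Rpow_C; lra.
    - apply (is_path_derive_const 1). }
  specialize (H Hd).
  rewrite (is_CInt_unique _ _ _ _ _ (pow_int_correct (bern_refl 0) s u Hu (bern_refl_continuous 0)) H).
  unfold f. simpl. rewrite Rplus_0_r. field. auto.
Qed.

(** The Euler-Maclaurin formula over one step. Its single term [u^(-s)] comes from the jump of
    [bern 1]; later Bernoulli polynomials have equal end values, so each further integration by
    parts only moves the remainder up by one order. Over [u = n + a] the differences of [em_main]
    telescope. *)
Lemma em_main_diff (N : nat) (s : C) (u : R) : s <> 1 -> 0 < u ->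
  (em_main (S N) s (u + 1) - em_main (S N) s u + Rpow_C u (- s)
   = - (cpoch (S N) s * pow_int (bern_refl (S N)) (s + RtoC (INR (S N))) u))%C.
Proof.
  intros Hs Hu. induction N as [|N IH].
  - assert (E0 := em_main_diff_0 s u Hs Hu).
    assert (P := pow_int_by_parts 0 s u Hu).
    rewrite bern_1_jump, RtoC_plus in P.
    change (em_main 1 s (u + 1)) with (em_main 0 s (u + 1) - RtoC (bern 1 0) * (1 * Rpow_C (u + 1) (- (s + 0))))%C.
    change (em_main 1 s u) with (em_main 0 s u - RtoC (bern 1 0) * (1 * Rpow_C u (- (s + 0))))%C.
    change (cpoch 1 s) with (1 * - (s + 0))%C. change (RtoC (INR 1)) with (RtoC 1).
    rewrite !Cplus_0_r in *.
    replace (em_main 0 s (u + 1)) with (em_main 0 s u + - pow_int (bern_refl 0) s u)%C by (rewrite <- E0; ring).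
    replace (pow_int (bern_refl 0) s u) with
      ((RtoC (bern 1 0) + 1) * Rpow_C u (- s) - RtoC (bern 1 0) * Rpow_C (u + 1) (- s) -
        s * pow_int (bern_refl 1) (s + 1) u)%C by (rewrite <- P; ring).
    ring.
  - set (n := S N) in *.
    assert (P := pow_int_by_parts n (s + RtoC (INR n)) u Hu).
    assert (Eb : bern (S n) 1 = bern (S n) 0) by apply bern_period. rewrite Eb in P.
    change (em_main (S n) s (u + 1)) with (em_main n s (u + 1) - RtoC (bern (S n) 0) * (cpoch n s * Rpow_C (u + 1) (- (s + RtoC (INR n)))))%C.
    change (em_main (S n) s u) with (em_main n s u - RtoC (bern (S n) 0) * (cpoch n s * Rpow_C u (- (s + RtoC (INR n)))))%C.
    change (cpoch (S n) s) with (cpoch n s * - (s + RtoC (INR n)))%C.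
    rewrite RtoC_INR_S, Cplus_assoc.
    replace (em_main n s (u + 1)) with (em_main n s u - Rpow_C u (- s)
       + - (cpoch n s * pow_int (bern_refl n) (s + RtoC (INR n)) u))%C by (rewrite <- IH; ring).
    replace (pow_int (bern_refl n) (s + RtoC (INR n)) u) with
      (RtoC (bern (S n) 0) * Rpow_C u (- (s + RtoC (INR n))) - RtoC (bern (S n) 0) * Rpow_C (u + 1) (- (s + RtoC (INR n)))
        - (s + RtoC (INR n)) * pow_int (bern_refl (S n)) (s + RtoC (INR n) + 1) u)%C by (rewrite <- P; ring).
    ring.
Qed.

(** Integration by parts summed over [u = n + a]: the boundary terms telescope to their value at
    [n = 0], which is the term that [em_main] gains. *)
Lemma em_zeta_step N s a : 0 < a -> 1 < Re s + INR (S N) -> em_zeta (S N) a s = em_zeta (S (S N)) a s.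
Proof.
  intros Ha Hs. set (n := S N) in *.
  assert (Hs' : 1 < Re s + INR (S n)) by (rewrite S_INR; lra).
  assert (T1 := em_tail_correct n s a Ha Hs). assert (T2 := em_tail_correct (S n) s a Ha Hs').
  pose (t := fun m => (RtoC (bern (S n) 0) * Rpow_C (INR m + a) (- (s + RtoC (INR n))))%C).
  assert (Hre : Re (- (s + RtoC (INR n)))%C = - (Re s + INR n)) by reflexivity.
  assert (T3 : is_Cseries (fun m => t m - t (S m))%C (t 0%nat - 0)%C).
  { apply is_series_C_telescope. intros eps He.
    destruct (Rpow_C_shift_lim a (- (s + RtoC (INR n))) (RtoC (bern (S n) 0)) Ha ltac:(lra) eps He) as [M HM].
    exists M. intros m Hm. replace (t m - 0)%C with (t m) by ring. apply HM; auto. }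
  assert (E : em_tail n s a = ((t 0%nat - 0) + - (s + RtoC (INR n)) * em_tail (S n) s a)%C).
  { apply (is_series_C_unique _ _ _ T1).
    apply is_series_C_ext with (2 := is_series_C_plus _ _ _ _ T3 (is_series_C_scal _ _ (- (s + RtoC (INR n))) T2)).
    intros m. destruct (pos_shift a Ha m) as [Hm _].
    assert (P := pow_int_by_parts n (s + RtoC (INR n)) (INR m + a) Hm).
    assert (Eb : bern (S n) 1 = bern (S n) 0) by apply bern_period. rewrite Eb in P.
    unfold t. rewrite RtoC_INR_S, Cplus_assoc. replace (INR (S m) + a) with (INR m + a + 1) by (rewrite S_INR; ring).
    rewrite <- P. ring. }
  unfold em_zeta. rewrite E.
  change (em_main (S n) s a) with (em_main n s a - RtoC (bern (S n) 0) * (cpoch n s * Rpow_C a (- (s + RtoC (INR n)))))%C.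
  change (cpoch (S n) s) with (cpoch n s * - (s + RtoC (INR n)))%C.
  unfold t. replace (INR 0 + a) with a by (simpl; ring). ring.
Qed.

Lemma em_zeta_const s a N M :
  0 < a -> (1 <= N)%nat -> (N <= M)%nat -> 1 < Re s + INR N -> em_zeta N a s = em_zeta M a s.
Proof.
  intros Ha HN HM Hs. induction HM as [|M HM IH]; [reflexivity|].
  rewrite IH. destruct M as [|M]; [lia|]. apply em_zeta_step; auto.
  apply Rlt_le_trans with (1 := Hs). apply Rplus_le_compat_l, le_INR; auto.
Qed.

Lemma em_zeta_series (s : C) (a : R) :
  0 < a -> 1 < Re s ->
  is_Cseries (fun n => Rpow_C (INR n + a) (- s)) (em_zeta 1 a s).
Proof.
  intros Ha Hs. assert (Hs1 : s <> 1) by (intros K; rewrite K in Hs; simpl in Hs; lra).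
  assert (T1 := em_tail_correct 1 s a Ha ltac:(simpl; lra)).
  pose (t := fun m => em_main 1 s (INR m + a)).
  assert (T3 : is_Cseries (fun m => t m - t (S m))%C (t 0%nat - 0)%C).
  { apply is_series_C_telescope. intros eps He.
    destruct (Rpow_C_shift_lim a (1 - s) (/ (s - 1)) Ha ltac:(unfold Re in *; simpl; lra) (eps / 2) ltac:(lra)) as [M HM].
    destruct (Rpow_C_shift_lim a (- (s + 0)) (RtoC (bern 1 0)) Ha ltac:(unfold Re in *; simpl; lra) (eps / 2) ltac:(lra)) as [M' HM'].
    exists (max M M'). intros m Hm.
    replace (t m - 0)%C with (/ (s - 1) * Rpow_C (INR m + a) (1 - s) + - (RtoC (bern 1 0) * Rpow_C (INR m + a) (- (s + 0))))%C.
    2:{ unfold t. change (em_main 1 s (INR m + a)) with (Rpow_C (INR m + a) (1 - s) / (s - 1) - RtoC (bern 1 0) * (1 * Rpow_C (INR m + a) (- (s + 0))))%C.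
        unfold Cdiv. ring. }
    apply Rle_lt_trans with (1 := Cmod_triangle _ _). rewrite Cmod_opp.
    specialize (HM m ltac:(lia)). specialize (HM' m ltac:(lia)). lra. }
  assert (T := is_series_C_plus _ _ _ _ T3 (is_series_C_scal _ _ (- cpoch 1 s) T1)).
  replace (em_zeta 1 a s) with (t 0%nat - 0 + - cpoch 1 s * em_tail 1 s a)%C.
  2:{ unfold em_zeta, t. replace (INR 0 + a) with a by (simpl; ring). ring. }
  apply is_series_C_ext with (2 := T). intros n. destruct (pos_shift a Ha n) as [Hn _].
  assert (E := em_main_diff 0 s (INR n + a) Hs1 Hn).
  unfold t. replace (INR (S n) + a) with (INR n + a + 1) by (rewrite S_INR; ring).
  replace (Rpow_C (INR n + a) (- s)) with (- (cpoch 1 s * pow_int (bern_refl 1) (s + RtoC (INR 1)) (INR n + a))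
     - (em_main 1 s (INR n + a + 1) - em_main 1 s (INR n + a)))%C by (rewrite <- E; ring).
  ring.
Qed.

Lemma Cdiffable_cpoch N s : Cdiffable (cpoch N) s.
Proof.
  induction N as [|N IH]; [apply Cdiffable_const|].
  apply (Cdiffable_mult (cpoch N) (fun s => - (s + RtoC (INR N)))%C); auto.
  apply Cdiffable_ext with (fun s => - (1) * (s + RtoC (INR N)))%C; [intros; ring|].
  apply Cdiffable_mult; [apply Cdiffable_const|]. apply Cdiffable_plus; [apply Cdiffable_id|apply Cdiffable_const].
Qed.

Lemma Cdiffable_em_main (N : nat) (a : R) (s : C) : s <> 1 -> Cdiffable (fun s => em_main N s a) s.
Proof.
  intros Hs. induction N as [|N IH].
  - apply (Cdiffable_mult (fun s => Rpow_C a (1 - s)) (fun s => / (s - 1))%C).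
    + apply (Cdiffable_Rpow_C a (fun s => 1 - s)%C).
      apply Cdiffable_ext with (fun s => 1 + - (1) * s)%C; [intros; ring|].
      apply Cdiffable_plus; [apply Cdiffable_const|]. apply Cdiffable_mult; [apply Cdiffable_const|apply Cdiffable_id].
    + apply (Cdiffable_comp (fun z => / z)%C (fun s => s - 1)%C).
      * apply Cdiffable_inv. intros K. apply Hs. replace s with (s - 1 + 1)%C by ring. rewrite K. ring.
      * apply (Cdiffable_plus (fun s => s) (fun _ => - (1))%C); [apply Cdiffable_id|apply Cdiffable_const].
  - apply Cdiffable_ext with (fun s => em_main N s a + (- RtoC (bern (S N) 0)) * (cpoch N s * Rpow_C a (- (1) * (s + RtoC (INR N)))))%C.
    + intros z.
      change (em_main (S N) z a) with (em_main N z a - RtoC (bern (S N) 0) * (cpoch N z * Rpow_C a (- (z + RtoC (INR N)))))%C.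
      replace (- (1) * (z + RtoC (INR N)))%C with (- (z + RtoC (INR N)))%C by ring. ring.
    + apply Cdiffable_plus; auto. apply Cdiffable_mult; [apply Cdiffable_const|].
      apply Cdiffable_mult; [apply Cdiffable_cpoch|]. apply (Cdiffable_Rpow_C a (fun s => - (1) * (s + RtoC (INR N)))%C).
      apply Cdiffable_mult; [apply Cdiffable_const|]. apply Cdiffable_plus; [apply Cdiffable_id|apply Cdiffable_const].
Qed.

Lemma Cdiffable_em_zeta (N : nat) (a : R) (s : C) : 0 < a -> s <> 1 -> 1 < Re s + INR N -> Cdiffable (em_zeta N a) s.
Proof.
  intros Ha Hs HN.
  apply Cdiffable_ext with (fun s => em_main N s a + (- (1) * cpoch N s) * em_tail N s a)%C.
  { intros z. unfold em_zeta. ring. }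
  apply Cdiffable_plus; [apply Cdiffable_em_main; auto|].
  apply Cdiffable_mult; [apply Cdiffable_mult; [apply Cdiffable_const|apply Cdiffable_cpoch]|].
  destruct (bern_refl_bounded N) as [B [HB HB']].
  apply (Cdiffable_comp (fun w => Csum (fun n => pow_int (bern_refl N) w (INR n + a))) (fun s => s + RtoC (INR N))%C).
  - apply (Csum_pow_int_derive (bern_refl N) B a); auto; [apply bern_refl_continuous|lra].
  - apply Cdiffable_plus; [apply Cdiffable_id|apply Cdiffable_const].
Qed.

(** The number of Euler-Maclaurin terms required for convergence depends on [Re s]. Any admissible
    number is chosen; by [em_zeta_const] the value does not depend on it. *)
Definition hurwitz_fun (a : R) (s : C) : C :=
  em_zeta (epsilon (inhabits O) (fun N => (1 <= N)%nat /\ 1 < Re s + INR N)) a s.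

Lemma hurwitz_fun_eq a s N :
  0 < a -> (1 <= N)%nat -> 1 < Re s + INR N -> hurwitz_fun a s = em_zeta N a s.
Proof.
  intros Ha HN Hs. unfold hurwitz_fun.
  set (P := fun N => (1 <= N)%nat /\ 1 < Re s + INR N).
  assert (HP : P (epsilon (inhabits O) P)) by (apply epsilon_spec; exists N; split; auto).
  destruct HP as [H1 H2]. set (M := epsilon (inhabits O) P) in *.
  destruct (Nat.le_ge_cases N M) as [H|H].
  - symmetry. apply em_zeta_const; auto.
  - apply em_zeta_const; auto.
Qed.

Lemma hurwitz_fun_continuation a : 0 < a -> is_hurwitz_continuation a (hurwitz_fun a).
Proof.
  intros Ha. split.
  (* [N > 2 - Re z] keeps [N] admissible on the whole unit disc about [z], so that [hurwitz_fun]
     coincides there with one fixed [em_zeta N]. *)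
  - intros z Hz. destruct (INR_unbounded (Rmax 1 (2 - Re z))) as [N HN].
    assert (Q1 := Rmax_l 1 (2 - Re z)). assert (Q2 := Rmax_r 1 (2 - Re z)).
    assert (HN1 : (1 <= N)%nat) by (destruct N; [simpl in HN; lra|lia]).
    apply (Cdiffable_ext_loc (em_zeta N a) (hurwitz_fun a) z 1 Rlt_0_1).
    + intros h Hh. symmetry. apply hurwitz_fun_eq; auto.
      assert (Hre : Re (z + h)%C = Re z + Re h) by reflexivity. rewrite Hre.
      assert (E := Rabs_Re_le h). assert (E2 := Rle_abs (- Re h)). rewrite Rabs_Ropp in E2. lra.
    + apply Cdiffable_em_zeta; auto. lra.
  - intros s Hs. rewrite (hurwitz_fun_eq a s 1); auto; [|simpl; lra]. apply em_zeta_series; auto.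
Qed.

Lemma cpoch_neg_nat (k j : nat) :
  (j <= k)%nat -> cpoch j (RtoC (- INR k)) = RtoC (INR (fact k) / INR (fact (k - j))).
Proof.
  induction j as [|j IH]; intros Hj.
  - rewrite Nat.sub_0_r. unfold Rdiv. rewrite Rinv_r by apply INR_fact_neq_0. reflexivity.
  - change (cpoch (S j) (RtoC (- INR k))) with (cpoch j (RtoC (- INR k)) * - (RtoC (- INR k) + RtoC (INR j)))%C.
    rewrite IH by lia. rewrite <- RtoC_plus, <- RtoC_opp, <- RtoC_mult. f_equal.
    replace (k - j)%nat with (S (k - S j)) by lia. rewrite fact_simpl, mult_INR, S_INR, minus_INR, S_INR by lia.
    assert (INR (S j) <= INR k) by (apply le_INR; lia). rewrite S_INR in H.
    field. split; [apply INR_fact_neq_0|lra].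
Qed.

Lemma cpoch_neg_nat_zero (k N : nat) : (k < N)%nat -> cpoch N (RtoC (- INR k)) = 0.
Proof.
  intros HN. induction HN as [|N HN IH].
  - change (cpoch (S k) (RtoC (- INR k))) with (cpoch k (RtoC (- INR k)) * - (RtoC (- INR k) + RtoC (INR k)))%C.
    rewrite RtoC_opp. ring.
  - change (cpoch (S N) (RtoC (- INR k))) with (cpoch N (RtoC (- INR k)) * - (RtoC (- INR k) + RtoC (INR N)))%C.
    rewrite IH. ring.
Qed.

Lemma em_main_neg_nat (k J : nat) (a : R) :
  0 < a -> (J <= k)%nat ->
  em_main (S J) (RtoC (- INR k)) a
  = RtoC (- INR (fact k) * sum_f_R0 (fun i => bern i 0 * (a ^ (S k - i) / INR (fact (S k - i)))) (S J)).
Proof.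
  intros Ha. set (s := RtoC (- INR k)).
  assert (Hpow : forall j, (j <= k)%nat -> Rpow_C a (- (s + RtoC (INR j))) = RtoC (a ^ (k - j))).
  { intros j Hj. rewrite <- Rpow_C_INR by auto. f_equal. unfold s.
    rewrite <- RtoC_plus, <- RtoC_opp, minus_INR by lia. f_equal. ring. }
  induction J as [|J IH]; intros HJ.
  - change (em_main 1 s a) with (Rpow_C a (1 - s) / (s - 1) - RtoC (bern 1 0) * (1 * Rpow_C a (- (s + RtoC (INR 0)))))%C.
    rewrite (Hpow 0%nat) by lia.
    replace (Rpow_C a (1 - s)) with (RtoC (a ^ S k)).
    2:{ rewrite <- Rpow_C_INR by auto. f_equal. unfold s. rewrite S_INR, RtoC_plus, RtoC_opp. ring. }
    unfold s. rewrite <- RtoC_minus, <- RtoC_div, !Cmult_1_l, <- RtoC_mult, <- RtoC_minus.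
    + f_equal. change (sum_f_R0 (fun i => bern i 0 * (a ^ (S k - i) / INR (fact (S k - i)))) 1) with
       (1 * (a ^ S k / INR (fact (S k))) + bern 1 0 * (a ^ (S k - 1) / INR (fact (S k - 1)))).
      replace (S k - 1)%nat with k by lia. rewrite Nat.sub_0_r, (fact_simpl k), mult_INR, S_INR.
      assert (Hk := pos_INR k). field. split; [|split]; try lra. apply INR_fact_neq_0.
    + assert (Hk := pos_INR k). lra.
  - change (em_main (S (S J)) s a) with (em_main (S J) s a - RtoC (bern (S (S J)) 0) * (cpoch (S J) s * Rpow_C a (- (s + RtoC (INR (S J))))))%C.
    rewrite IH, Hpow by lia. unfold s. rewrite cpoch_neg_nat by auto.
    rewrite <- !RtoC_mult, <- RtoC_minus. f_equal.
    rewrite (tech5 _ (S J)). replace (S k - S (S J))%nat with (k - S J)%nat by lia.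
    field. apply INR_fact_neq_0.
Qed.

(** At [s = - k] the factor [cpoch] vanishes from index [k + 1] on. The remainder disappears, and
    what is left of the main term is [- k!] times the Taylor expansion of [bern (S k)] at [0]. *)
Lemma hurwitz_zeta_neg_nat (k : nat) (a : R) :
  0 < a -> hurwitz_zeta (RtoC (- INR k)) a = RtoC (- INR (fact k) * bern (S k) a).
Proof.
  intros Ha. assert (Hk := pos_INR k).
  replace (- INR k) with (1 - (INR k + 1)) by ring.
  rewrite (hurwitz_zeta_eq a (hurwitz_fun a)); [|lra|apply hurwitz_fun_continuation; auto].
  replace (1 - (INR k + 1)) with (- INR k) by ring.
  (* [k + 2] terms are the fewest with [Re s + N > 1]; the last one vanishes as well. *)
  rewrite (hurwitz_fun_eq a _ (S (S k))); auto; [|lia|].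
  2:{ unfold Re, RtoC; simpl fst. rewrite !S_INR. lra. }
  unfold em_zeta.
  change (em_main (S (S k)) (RtoC (- INR k)) a) with (em_main (S k) (RtoC (- INR k)) a
    - RtoC (bern (S (S k)) 0) * (cpoch (S k) (RtoC (- INR k)) * Rpow_C a (- (RtoC (- INR k) + RtoC (INR (S k))))))%C.
  rewrite !cpoch_neg_nat_zero by lia. rewrite em_main_neg_nat, <- bern_taylor by auto. ring.
Qed.

(** * Fourier series at the endpoint and coefficients of the Bernoulli polynomials *)

Lemma continuous_series (f : nat -> R -> R) (b : nat -> R) (F : R -> R) (x d : R) :
  0 < d -> ex_series b ->
  (forall n, continuous (f n) x) ->
  (forall n t, Rabs (t - x) < d -> Rabs (f n t) <= b n) ->
  (forall t, Rabs (t - x) < d -> is_series (fun n => f n t) (F t)) ->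
  continuous F x.
Proof.
  intros Hd [B HB] Hc Hb HF.
  assert (Hxx : Rabs (x - x) < d) by (rewrite Rminus_diag, Rabs_R0; auto).
  assert (Hb0 : forall n, 0 <= b n).
  { intros n. apply Rle_trans with (2 := Hb n x Hxx). apply Rabs_pos. }
  apply filterlim_locally. intros [eps He].
  assert (He3 : 0 < eps / 3) by lra.
  destruct (is_series_tail b B Hb0 HB (eps / 3) He3) as [N HN]. specialize (HN N (Nat.le_refl N)).
  assert (Hrem : forall t, Rabs (t - x) < d -> Rabs (sum_n (fun n => f n t) N - F t) < eps / 3).
  { intros t Ht. apply Rle_lt_trans with (2 := HN).
    exact (norm_series_remainder (V := R_NormedModule) (fun n => f n t) b (F t) B N (fun n => Hb n t Ht) HB (HF t Ht)). }
  assert (HcN : continuous (fun t => sum_n (fun n => f n t) N) x).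
  { clear -Hc. induction N as [|N IH].
    - apply continuous_ext with (f 0%nat); [intros; rewrite sum_O; auto|apply Hc].
    - apply continuous_ext with (fun t => plus (sum_n (fun n => f n t) N) (f (S N) t)).
      + intros; rewrite sum_Sn; auto.
      + apply (continuous_plus (V := R_NormedModule)); [exact IH|apply Hc]. }
  destruct (proj1 (filterlim_locally _ _) HcN (mkposreal _ He3)) as [d' Hd'].
  assert (Hm : 0 < Rmin d d') by (apply Rmin_glb_lt; [auto|apply cond_pos]).
  exists (mkposreal _ Hm). intros t Ht.
  change (Rabs (t - x) < Rmin d d') in Ht. change (Rabs (F t - F x) < eps).
  assert (Q1 := Rmin_l d d'). assert (Q2 := Rmin_r d d').
  assert (Ht' : Rabs (t - x) < d') by lra. specialize (Hd' t Ht').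
  change (Rabs (sum_n (fun n => f n t) N - sum_n (fun n => f n x) N) < eps / 3) in Hd'.
  assert (R1 := Hrem t ltac:(lra)). assert (R2 := Hrem x Hxx).
  apply Rabs_def2 in R1. apply Rabs_def2 in R2. apply Rabs_def2 in Hd'. apply Rabs_def1; lra.
Qed.

Lemma is_RInt_series_R (f : nat -> R -> R) (b : nat -> R) (F : R -> R)
  (I : nat -> R) (x y : R) :
  x <= y -> ex_series b ->
  (forall n t, x <= t <= y -> Rabs (f n t) <= b n) ->
  (forall t, x <= t <= y -> is_series (fun n => f n t) (F t)) ->
  (forall n, is_RInt (f n) x y (I n)) ->
  exists L, is_series I L /\ is_RInt F x y L.
Proof. exact (is_RInt_series (V := R_CompleteNormedModule) f b F I x y). Qed.

Lemma cos_mode_refl m t : cos_mode m (1 - t) = cos_mode m t.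
Proof.
  unfold cos_mode. replace (2 * PI * INR m * (1 - t)) with (- (2 * PI * INR m * t) + 2 * INR m * PI) by ring.
  rewrite cos_period. apply cos_neg.
Qed.

Lemma sin_mode_refl m t : sin_mode m (1 - t) = - sin_mode m t.
Proof.
  unfold sin_mode. replace (2 * PI * INR m * (1 - t)) with (- (2 * PI * INR m * t) + 2 * INR m * PI) by ring.
  rewrite sin_period. apply sin_neg.
Qed.

Lemma Rabs_cos_mode_le m t : Rabs (cos_mode m t) <= 1.
Proof. apply Rabs_le. unfold cos_mode. generalize (COS_bound (2 * PI * INR m * t)); lra. Qed.

Lemma cos_mode_continuous m t : continuous (cos_mode m) t.
Proof. apply (ex_derive_continuous (V := R_NormedModule)). unfold cos_mode. auto_derive; auto. Qed.

Lemma sin_mode_continuous m t : continuous (sin_mode m) t.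
Proof. apply (ex_derive_continuous (V := R_NormedModule)). unfold sin_mode. auto_derive; auto. Qed.

Lemma is_RInt_refl (f : R -> R) (I : R) :
  is_RInt f 0 1 I -> is_RInt (fun t => f (1 - t)) 0 1 I.
Proof.
  intros H. apply (is_RInt_swap (V := R_NormedModule)) in H.
  assert (H' : is_RInt f (-1 * 0 + 1) (-1 * 1 + 1) (- I)).
  { replace (-1 * 0 + 1) with 1 by ring. replace (-1 * 1 + 1) with 0 by ring. exact H. }
  apply (is_RInt_comp_lin (V := R_NormedModule)) in H'.
  apply (is_RInt_opp (V := R_NormedModule)) in H'.
  apply is_RInt_R_eq with (I := - (- I)); [|ring].
  apply is_RInt_ext_R with (2 := H'). intros t _.
  unfold opp, scal; simpl; unfold mult; simpl. replace (-1 * t + 1) with (1 - t) by ring. ring.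
Qed.

(** The reflection [t |-> 1 - t] carries the integral to its own negative. Symmetric functions
    therefore only need their cosine coefficients checked. *)
Lemma is_RInt_sym_sin (f : R -> R) (m : nat) :
  (forall t, 0 <= t <= 1 -> continuous f t) -> (forall t, 0 < t < 1 -> f (1 - t) = f t) ->
  is_RInt (fun t => f t * sin_mode m t) 0 1 0.
Proof.
  intros Hc Hs.
  assert (HE : ex_RInt (fun t => f t * sin_mode m t) 0 1).
  { apply (ex_RInt_continuous (V := R_CompleteNormedModule)). intros t Ht.
    rewrite Rmin_left, Rmax_right in Ht by lra.
    apply (continuous_mult f (sin_mode m)); [auto|apply sin_mode_continuous]. }
  destruct HE as [I HI]. assert (H2 := is_RInt_refl _ _ HI).
  assert (H3 : is_RInt (fun t => f t * sin_mode m t) 0 1 (- I)).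
  { apply (is_RInt_opp (V := R_NormedModule)) in H2. apply is_RInt_ext_R with (2 := H2).
    intros t Ht. rewrite Rmin_left, Rmax_right in Ht by lra.
    rewrite Hs, sin_mode_refl by auto. unfold opp; simpl. ring. }
  apply is_RInt_R_eq with (1 := HI).
  apply (is_RInt_unique (V := R_CompleteNormedModule)) in HI.
  apply (is_RInt_unique (V := R_CompleteNormedModule)) in H3. rewrite HI in H3. change (I = - I) in H3. lra.
Qed.

Lemma is_RInt_cos_mode (j : nat) : is_RInt (cos_mode j) 0 1 (if Nat.eqb j 0 then 1 else 0).
Proof.
  destruct j as [|j]; simpl Nat.eqb; cbv iota.
  - apply is_RInt_ext_R with (fun _ => 1); [intros; rewrite cos_mode_0; auto|].
    apply is_RInt_R_eq with (1 := is_RInt_const (V := R_NormedModule) 0 1 1).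
    unfold scal; simpl; unfold mult; simpl; ring.
  - set (om := 2 * PI * INR (S j)).
    assert (Hom : om <> 0).
    { unfold om. assert (H := PI_RGT_0). assert (H1 : 0 < INR (S j)) by (apply lt_0_INR; lia). nra. }
    assert (H := is_RInt_derive (V := R_CompleteNormedModule) (fun t => sin (om * t) / om) (cos_mode (S j)) 0 1).
    apply is_RInt_R_eq with (1 := H ltac:(intros x _; unfold cos_mode; fold om; auto_derive; auto; field; auto)
      ltac:(intros; apply cos_mode_continuous)).
    unfold minus, plus, opp; simpl. fold om. rewrite Rmult_1_r, Rmult_0_r, sin_0.
    replace om with (0 + 2 * INR (S j) * PI) by (unfold om; ring). rewrite sin_period, sin_0.
    unfold Rdiv. ring.
Qed.

(** Product to sum. As [S m] is positive, the sum of the two frequencies is never the zero mode, and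
    the integral merely detects equality; the pair [(0, 0)], with integral [1], is kept out by the
    successor. *)
Lemma is_RInt_cos_cos (m n : nat) :
  is_RInt (fun t => cos_mode (S m) t * cos_mode n t) 0 1 (if Nat.eqb (S m) n then 1 / 2 else 0).
Proof.
  assert (Hadd : forall i j t, cos_mode (i + j) t = cos_mode i t * cos_mode j t - sin_mode i t * sin_mode j t).
  { intros i j t. unfold cos_mode, sin_mode. rewrite plus_INR.
    replace (2 * PI * (INR i + INR j) * t) with (2 * PI * INR i * t + 2 * PI * INR j * t) by ring. apply cos_plus. }
  assert (Hsub : forall i j t, cos_mode i t = cos_mode (i + j) t * cos_mode j t + sin_mode (i + j) t * sin_mode j t).
  { intros i j t. unfold cos_mode, sin_mode. rewrite plus_INR.
    replace (2 * PI * INR i * t) with (2 * PI * (INR i + INR j) * t - 2 * PI * INR j * t) at 1 by ring. apply cos_minus. }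
  assert (Hgen : forall p q i : nat, (forall t, cos_mode p t * cos_mode q t = 1 / 2 * cos_mode (p + q) t + 1 / 2 * cos_mode i t) ->
    is_RInt (fun t => cos_mode p t * cos_mode q t) 0 1 (1 / 2 * (if Nat.eqb (p + q) 0 then 1 else 0) + 1 / 2 * (if Nat.eqb i 0 then 1 else 0))).
  { intros p q i E. apply is_RInt_ext_R with (fun t => 1 / 2 * cos_mode (p + q) t + 1 / 2 * cos_mode i t); [intros; rewrite E; auto|].
    apply (is_RInt_plus (V := R_NormedModule)); apply (is_RInt_scal (V := R_NormedModule)); apply is_RInt_cos_mode. }
  destruct (Nat.le_ge_cases (S m) n) as [H|H].
  - apply is_RInt_R_eq with (1 := Hgen (S m) n (n - S m)%nat
      ltac:(intros t; rewrite (Hadd (S m) n), (Hsub (n - S m)%nat (S m)); replace (n - S m + S m)%nat with n by lia; field)).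
    replace (Nat.eqb (S m + n) 0) with false by (symmetry; apply Nat.eqb_neq; lia).
    destruct (Nat.eqb_spec (n - S m) 0), (Nat.eqb_spec (S m) n); try lia; lra.
  - apply is_RInt_R_eq with (1 := Hgen (S m) n (S m - n)%nat
      ltac:(intros t; rewrite (Hadd (S m) n), (Hsub (S m - n)%nat n); replace (S m - n + n)%nat with (S m) by lia; field)).
    replace (Nat.eqb (S m + n) 0) with false by (symmetry; apply Nat.eqb_neq; lia).
    destruct (Nat.eqb_spec (S m - n) 0), (Nat.eqb_spec (S m) n); try lia; lra.
Qed.

Lemma is_series_single (n : nat) (v : R) :
  is_series (fun m => if Nat.eqb (S m) n then v else 0) (if Nat.eqb n 0 then 0 else v).
Proof.
  assert (E : forall N, sum_n (fun m => if Nat.eqb (S m) n then v else 0) N = if andb (Nat.leb 1 n) (Nat.leb n (S N)) then v else 0).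
  { induction N as [|N IH].
    - rewrite sum_O. destruct (Nat.eqb_spec 1 n), (Nat.leb_spec 1 n), (Nat.leb_spec n 1); simpl; auto; lia.
    - rewrite sum_Sn, IH.
      match goal with |- plus ?x ?y = _ => change (plus x y) with (x + y) end.
      destruct (Nat.eqb_spec (S (S N)) n), (Nat.leb_spec 1 n), (Nat.leb_spec n (S (S N))), (Nat.leb_spec n (S N)); simpl; try lia; ring. }
  apply is_series_eps. intros eps He. exists n. intros N HN. rewrite E.
  match goal with |- norm (minus ?x ?y) < _ => change (Rabs (x - y) < eps); replace (x - y) with 0 end;
    [rewrite Rabs_R0; auto|].
  destruct (Nat.eqb_spec n 0), (Nat.leb_spec 1 n), (Nat.leb_spec n (S N)); simpl; try lia; ring.
Qed.

(** Subtracting the absolutely convergent cosine series leaves a continuous function orthogonal to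
    all modes. It vanishes inside the interval by [fourier_unique] and at [0] by continuity.
    Evaluation at the endpoint is what Poisson summation needs. *)
Lemma fourier_at_0 (f : R -> R) (c : nat -> R) (b : nat -> R) :
  (forall t, 0 <= t <= 1 -> continuous f t) ->
  (forall t, 0 < t < 1 -> f (1 - t) = f t) ->
  (forall m, is_RInt (fun t => f t * cos_mode m t) 0 1 (c m)) ->
  (forall m, Rabs (c (S m)) <= b m) -> ex_series b ->
  f 0 = c 0%nat + 2 * Series (fun m => c (S m)).
Proof.
  intros Hc Hs Hm Hcb Hb.
  assert (HS : forall t, is_series (fun m => c (S m) * cos_mode (S m) t) (Series (fun m => c (S m) * cos_mode (S m) t))).
  { intros t. apply Series_correct. apply (ex_series_le (V := R_CompleteNormedModule)) with b; auto.
    intros m. change (Rabs (c (S m) * cos_mode (S m) t) <= b m). rewrite Rabs_mult.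
    generalize (Rabs_cos_mode_le (S m) t) (Hcb m) (Rabs_pos (c (S m))) (Rabs_pos (cos_mode (S m) t)). nra. }
  set (Sf := fun t => Series (fun m => c (S m) * cos_mode (S m) t)) in HS.
  assert (HSc : forall t, continuous Sf t).
  { intros t. apply (continuous_series (fun m t => c (S m) * cos_mode (S m) t) b Sf t 1 Rlt_0_1 Hb).
    - intros m. apply (continuous_mult (fun _ => c (S m)) (cos_mode (S m))); [apply continuous_const|apply cos_mode_continuous].
    - intros m s _. rewrite Rabs_mult.
      generalize (Rabs_cos_mode_le (S m) s) (Hcb m) (Rabs_pos (c (S m))) (Rabs_pos (cos_mode (S m) s)). nra.
    - intros s _. apply HS. }
  pose (g := fun t => f t - c 0%nat - 2 * Sf t).
  assert (Hgc : forall t, 0 <= t <= 1 -> continuous g t).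
  { intros t Ht. apply (continuous_minus (V := R_NormedModule) (fun t => f t - c 0%nat) (fun t => 2 * Sf t)).
    - apply (continuous_minus (V := R_NormedModule) f (fun _ => c 0%nat)); [auto|apply continuous_const].
    - apply (continuous_mult (fun _ => 2) Sf); [apply continuous_const|apply HSc]. }
  assert (Hg : forall t, 0 < t < 1 -> g t = 0).
  { apply fourier_unique; auto. intros n. split.
    - destruct (is_RInt_series_R (fun m t => c (S m) * cos_mode (S m) t * cos_mode n t) b (fun t => Sf t * cos_mode n t)
        (fun m => if Nat.eqb (S m) n then c n / 2 else 0) 0 1 ltac:(lra) Hb) as [L [HL1 HL2]].
      + intros m t _. rewrite !Rabs_mult.
        generalize (Rabs_cos_mode_le (S m) t) (Rabs_cos_mode_le n t) (Hcb m) (Rabs_pos (c (S m))) (Rabs_pos (cos_mode (S m) t)) (Rabs_pos (cos_mode n t)). intros.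
        assert (Rabs (c (S m)) * Rabs (cos_mode (S m) t) <= b m) by nra.
        assert (0 <= Rabs (c (S m)) * Rabs (cos_mode (S m) t)) by nra. nra.
      + intros t _. apply is_series_ext with (fun m => cos_mode n t * (c (S m) * cos_mode (S m) t)); [intros; apply Rmult_comm|].
        rewrite Rmult_comm. apply (is_series_scal (K := R_AbsRing) (V := R_NormedModule) (cos_mode n t) _ (Sf t)). apply HS.
      + intros m.
        apply is_RInt_ext_R with (fun t => c (S m) * (cos_mode (S m) t * cos_mode n t)); [intros; ring|].
        apply is_RInt_R_eq with (1 := is_RInt_scal (V := R_NormedModule) _ _ _ (c (S m)) _ (is_RInt_cos_cos m n)).
        unfold scal; simpl; unfold mult; simpl.
        destruct n as [|n]; simpl; [ring|]. destruct (Nat.eqb_spec m n); [subst; field|ring].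
      + assert (EL : L = if Nat.eqb n 0 then 0 else c n / 2).
        { rewrite <- (is_series_unique _ _ HL1). apply is_series_unique, is_series_single. }
        assert (H1 := Hm n). assert (H2 := is_RInt_scal (V := R_NormedModule) _ _ _ (c 0%nat) _ (is_RInt_cos_mode n)).
        assert (H3 := is_RInt_scal (V := R_NormedModule) _ _ _ 2 _ HL2).
        assert (H4 := is_RInt_minus (V := R_NormedModule) _ _ _ _ _ _ (is_RInt_minus (V := R_NormedModule) _ _ _ _ _ _ H1 H2) H3).
        apply is_RInt_R_eq with (I := (c n - c 0%nat * (if Nat.eqb n 0 then 1 else 0) - 2 * L)).
        * apply is_RInt_ext_R with (2 := H4). intros t _. unfold g, minus, plus, opp, scal; simpl; unfold mult; simpl. ring.
        * rewrite EL. destruct n; simpl; field.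
    - apply is_RInt_sym_sin; auto. intros t Ht. unfold g. rewrite Hs by auto. f_equal. f_equal.
      unfold Sf. apply Series_ext. intros m. rewrite cos_mode_refl. auto. }
  assert (Hg0 : g 0 = 0).
  { destruct (Req_dec (g 0) 0) as [E|E]; auto. exfalso.
    assert (Hc0 := Hgc 0 ltac:(lra)). assert (Hp : 0 < Rabs (g 0)) by (apply Rabs_pos_lt; auto).
    apply filterlim_locally with (eps := mkposreal _ Hp) in Hc0. destruct Hc0 as [d Hd].
    assert (Hdp := cond_pos d).
    pose (t := Rmin (d / 2) (1 / 2)). assert (Q1 := Rmin_l (d / 2) (1 / 2)). assert (Q2 := Rmin_r (d / 2) (1 / 2)).
    assert (Q3 : 0 < t) by (apply Rmin_glb_lt; lra). fold t in Q1, Q2.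
    assert (Ht : Rabs (t - 0) < d) by (rewrite Rminus_0_r, Rabs_pos_eq; lra).
    specialize (Hd t Ht). change (Rabs (g t - g 0) < Rabs (g 0)) in Hd.
    rewrite Hg in Hd by lra. rewrite Rminus_0_l, Rabs_Ropp in Hd. lra. }
  unfold g in Hg0.
  replace (Series (fun m => c (S m))) with (Sf 0); [lra|].
  unfold Sf. apply Series_ext. intros m. unfold cos_mode. rewrite Rmult_0_r, cos_0. ring.
Qed.

Lemma is_derive_ext_R (f g : R -> R) (t l : R) :
  (forall t, f t = g t) -> is_derive f t l -> is_derive g t l.
Proof. exact (is_derive_ext (K := R_AbsRing) (V := R_NormedModule) f g t l). Qed.

(** Two integrations by parts at once: the derivative of [bern (j+2) * sin / om + bern (j+1) * cos /
    om^2] is [bern (j+2) * cos + bern j * cos / om^2]. The sine vanishes at both ends and the cosine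
    leaves the jump of [bern (S j)]. *)
Lemma bern_cos_step (j m : nat) (I : R) :
  is_RInt (fun t => bern j t * cos_mode (S m) t) 0 1 I ->
  is_RInt (fun t => bern (S (S j)) t * cos_mode (S m) t) 0 1
    ((bern (S j) 1 - bern (S j) 0 - I) / (2 * PI * INR (S m)) ^ 2).
Proof.
  intros HI. set (om := 2 * PI * INR (S m)).
  assert (Hom : om <> 0).
  { unfold om. assert (H := PI_RGT_0). assert (H1 : 0 < INR (S m)) by (apply lt_0_INR; lia). nra. }
  pose (f := fun t => bern (S (S j)) t * sin (om * t) / om + bern (S j) t * cos (om * t) / om ^ 2).
  pose (g := fun t => bern (S (S j)) t * cos_mode (S m) t + / om ^ 2 * (bern j t * cos_mode (S m) t)).
  assert (Hf : forall t, is_derive f t (g t)).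
  { intros t. unfold f, g, cos_mode. fold om.
    assert (D1 := bern_derive (S j) t). assert (D2 := bern_derive j t).
    evar_last.
    - apply (is_derive_plus (K := R_AbsRing) (V := R_NormedModule)
        (fun t => bern (S (S j)) t * sin (om * t) / om) (fun t => bern (S j) t * cos (om * t) / om ^ 2)).
      + apply is_derive_ext_R with (fun t => (/ om * sin (om * t)) * bern (S (S j)) t); [intros; field; auto|].
        apply (is_derive_mult (K := R_AbsRing) (fun t => / om * sin (om * t)) (bern (S (S j)))); [|exact D1|exact Rmult_comm].
        auto_derive; auto.
      + apply is_derive_ext_R with (fun t => (/ om ^ 2 * cos (om * t)) * bern (S j) t); [intros; field; auto|].
        apply (is_derive_mult (K := R_AbsRing) (fun t => / om ^ 2 * cos (om * t)) (bern (S j))); [|exact D2|exact Rmult_comm].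
        auto_derive; auto.
    - unfold plus, mult; simpl. field; auto. }
  assert (Hg : forall t, continuous g t).
  { intros t. apply (continuous_plus (V := R_NormedModule) (fun t => bern (S (S j)) t * cos_mode (S m) t)
      (fun t => / om ^ 2 * (bern j t * cos_mode (S m) t))).
    - apply (continuous_mult (bern (S (S j))) (cos_mode (S m))); [apply bern_continuous|apply cos_mode_continuous].
    - apply (continuous_mult (fun _ => / om ^ 2) (fun t => bern j t * cos_mode (S m) t)); [apply continuous_const|].
      apply (continuous_mult (bern j) (cos_mode (S m))); [apply bern_continuous|apply cos_mode_continuous]. }
  assert (H := is_RInt_derive (V := R_CompleteNormedModule) f g 0 1 (fun t _ => Hf t) (fun t _ => Hg t)).
  assert (H2 := is_RInt_minus (V := R_NormedModule) _ _ _ _ _ _ H (is_RInt_scal (V := R_NormedModule) _ _ _ (/ om ^ 2) _ HI)).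
  apply is_RInt_R_eq with (I := f 1 - f 0 - / om ^ 2 * I).
  - apply is_RInt_ext_R with (2 := H2). intros t _. unfold g, minus, plus, opp, scal; simpl; unfold mult; simpl. ring.
  - unfold f. rewrite !Rmult_1_r, !Rmult_0_r, sin_0, cos_0.
    replace om with (0 + 2 * INR (S m) * PI) at 1 3 by (unfold om; ring).
    rewrite sin_period, cos_period, sin_0, cos_0. field; auto.
Qed.

Lemma bern_cos_0 (j : nat) : is_RInt (fun t => bern (S j) t * cos_mode 0 t) 0 1 0.
Proof.
  apply is_RInt_ext_R with (2 := bern_mean j). intros t _. rewrite cos_mode_0. ring.
Qed.

Lemma bern_cos (l m : nat) :
  is_RInt (fun t => bern (2 * S l) t * cos_mode (S m) t) 0 1
    ((-1) ^ l / (2 * PI * INR (S m)) ^ (2 * S l)).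
Proof.
  set (om := 2 * PI * INR (S m)).
  assert (Hom : om <> 0).
  { unfold om. assert (H := PI_RGT_0). assert (H1 : 0 < INR (S m)) by (apply lt_0_INR; lia). nra. }
  induction l as [|l IH].
  - apply is_RInt_R_eq with (1 := bern_cos_step 0 m 0 ltac:(
      apply is_RInt_ext_R with (2 := is_RInt_cos_mode (S m)); intros t _; simpl bern; ring)).
    rewrite bern_1_jump. fold om. simpl. field; auto.
  - replace (2 * S (S l))%nat with (S (S (2 * S l))) by lia.
    apply is_RInt_R_eq with (1 := bern_cos_step (2 * S l) m _ IH).
    replace (2 * S l)%nat with (S (S (2 * l))) at 1 2 by lia.
    rewrite bern_period. fold om.
    replace ((-1) ^ S l) with (- (-1) ^ l) by (simpl; ring).
    replace (om ^ S (S (2 * S l))) with (om ^ 2 * om ^ (2 * S l)) by (simpl; ring).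
    field. split; auto. apply pow_nonzero; auto.
Qed.

(** * The Lipschitz formula *)

(** For [z > 0] and [K >= 1], this times [(K - 1)!] is the cosine transform at frequency [om] of
    [u ^ (K - 1) * exp (- z u)] on the half-line. *)
Definition kap (K : nat) (z om : R) : R := Re (/ Cpow (z, om) K)%C.

Lemma Cmod_ge_components (z om : R) : Rabs z <= Cmod (z, om) /\ Rabs om <= Cmod (z, om).
Proof. split; [exact (Rabs_Re_le (z, om))|exact (Rabs_Im_le (z, om))]. Qed.

Lemma kap_bound (K : nat) (z om : R) : 0 < z -> 1 <= om -> Rabs (kap (S (S K)) z om) <= / om ^ 2.
Proof.
  intros Hz Hom. destruct (Cmod_ge_components z om) as [_ H]. rewrite Rabs_pos_eq in H by lra.
  assert (H0 : ((z, om) : C) <> 0) by (intros E; apply (f_equal Re) in E; unfold Re in E; simpl in E; lra).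
  unfold kap. apply Rle_trans with (1 := Rabs_Re_le _).
  rewrite Cmod_inv by (apply Cpow_nz; auto). rewrite Cmod_pow.
  apply Rinv_le_contravar; [nra|].
  set (r := Cmod (z, om)) in *. replace (r ^ S (S K)) with (r ^ 2 * r ^ K) by (simpl; ring).
  assert (1 <= r ^ K) by (apply pow_R1_Rle; lra).
  assert (om ^ 2 <= r ^ 2) by (apply pow_incr; lra). assert (0 <= om ^ 2) by apply pow2_ge_0. nra.
Qed.

(* Antiderivative of [u ^ j * exp (- z u)], [z] complex. *)
Fixpoint pow_exp_prim (z : C) (j : nat) (u : R) : C :=
  match j with
  | O => (- / z * Cexp (- z * RtoC u))%C
  | S i => (RtoC (u ^ S i) * (- / z * Cexp (- z * RtoC u)) + RtoC (INR (S i)) / z * pow_exp_prim z i u)%C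
  end.

Lemma pow_exp_prim_derive (z : C) (j : nat) (u : R) : z <> 0 ->
  is_path_derive (pow_exp_prim z j) u (RtoC (u ^ j) * Cexp (- z * RtoC u))%C.
Proof.
  intros Hz.
  assert (H0 : is_path_derive (fun u => - / z * Cexp (- z * RtoC u))%C u (Cexp (- z * RtoC u))).
  { assert (E := is_path_derive_mult (fun _ => - / z)%C (fun u => Cexp (- z * RtoC u)) u _ _
      (is_path_derive_const _ u) (is_path_derive_Cexp (- z) (fun u => u) u 1 (is_derive_id u))).
    replace (Cexp (- z * RtoC u)) with (0 * Cexp (- z * RtoC u) + - / z * (1 * - z * Cexp (- z * RtoC u)))%C at 1; [exact E|].
    field; auto. }
  induction j as [|j IH].
  - replace (RtoC (u ^ 0)) with (RtoC 1) by reflexivity. rewrite Cmult_1_l. exact H0.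
  - assert (Hp : is_path_derive (fun u => RtoC (u ^ S j)) u (RtoC (INR (S j) * u ^ j))).
    { apply is_path_derive_RtoC. assert (E := is_derive_pow (fun u => u) (S j) u 1 (is_derive_id u)).
      simpl Nat.pred in E. rewrite Rmult_1_r in E. exact E. }
    assert (E := is_path_derive_plus _ _ _ _ _ (is_path_derive_mult _ _ _ _ _ Hp H0)
      (is_path_derive_mult _ _ _ _ _ (is_path_derive_const (RtoC (INR (S j)) / z)%C u) IH)).
    replace (RtoC (u ^ S j) * Cexp (- z * RtoC u))%C with
     (RtoC (INR (S j) * u ^ j) * (- / z * Cexp (- z * RtoC u)) + RtoC (u ^ S j) * Cexp (- z * RtoC u)
      + (0 * pow_exp_prim z j u + RtoC (INR (S j)) / z * (RtoC (u ^ j) * Cexp (- z * RtoC u))))%C; [exact E|].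
    rewrite RtoC_mult. field; auto.
Qed.

Lemma pow_exp_prim_0 (z : C) (j : nat) : z <> 0 -> pow_exp_prim z j 0 = (- RtoC (INR (fact j)) / Cpow z (S j))%C.
Proof.
  intros Hz. induction j as [|j IH].
  - simpl pow_exp_prim. rewrite Cmult_0_r, Cexp_0. simpl. field; auto.
  - change (pow_exp_prim z (S j) 0) with (RtoC (0 ^ S j) * (- / z * Cexp (- z * RtoC 0)) + RtoC (INR (S j)) / z * pow_exp_prim z j 0)%C.
    rewrite IH, pow_i, fact_simpl, mult_INR, RtoC_mult, (Cpow_S z (S j)) by lia.
    field. split; auto. apply Cpow_nz; auto.
Qed.

(** The free exponent [p] trades decay in [x] against growth as [z] tends to [0]. Its later choices
    make the sums, and the integral over [t], converge. *)
Lemma pow_exp_le (k : nat) (p : R) :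
  0 < p -> exists M, 0 < M /\ forall z x, 0 < z -> 0 < x ->
    x ^ k * exp (- (x * z)) <= M * Rpower z (- p) * Rpower x (INR k - p).
Proof.
  intros Hp. destruct (exp_opp_le_Rpower p Hp) as [M [HM H]]. exists M; split; auto.
  intros z x Hz Hx. specialize (H (x * z) ltac:(nra)).
  rewrite <- Rpower_mult_distr in H by auto.
  unfold Rminus. rewrite Rpower_plus, Rpower_pow by auto.
  assert (Hk : 0 < x ^ k) by (apply pow_lt; auto).
  replace (M * Rpower z (- p) * (x ^ k * Rpower x (- p))) with (x ^ k * (M * (Rpower x (- p) * Rpower z (- p)))) by ring.
  apply Rmult_le_compat_l; lra.
Qed.

Lemma pow_exp_prim_bound (z om : R) (j : nat) :
  0 < z -> exists M, forall u, 0 < u -> Cmod (pow_exp_prim (z, om) j u) <= M * Rpower u (- (1)).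
Proof.
  intros Hz. assert (Hz0 : ((z, om) : C) <> 0) by (intros E; apply (f_equal Re) in E; unfold Re in E; simpl in E; lra).
  assert (Hc : forall u, Cmod (Cexp (- (z, om) * RtoC u)) = exp (- (u * z))).
  { intros u. rewrite Cmod_Cexp. f_equal. unfold Re; simpl. ring. }
  assert (Hr : 0 < / Cmod (z, om)) by (apply Rinv_0_lt_compat, Cmod_gt_0; auto).
  assert (Hmain : forall i, exists M, forall u, 0 < u ->
     Cmod (RtoC (u ^ i) * (- / (z, om) * Cexp (- (z, om) * RtoC u)))%C <= M * Rpower u (- (1))).
  (* The exponent [i + 1] leaves exactly [u^(-1)], whatever the degree [i]. *)
  { intros i. destruct (pow_exp_le i (INR i + 1)) as [M [HM H]]; [generalize (pos_INR i); lra|].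
    exists (/ Cmod (z, om) * (M * Rpower z (- (INR i + 1)))). intros u Hu.
    rewrite !Cmod_mult, Cmod_opp, Cmod_inv, Hc, Cmod_R, Rabs_pos_eq by (auto; apply pow_le; lra).
    specialize (H z u Hz Hu). replace (INR i - (INR i + 1)) with (- (1)) in H by ring.
    replace (u ^ i * (/ Cmod (z, om) * exp (- (u * z)))) with (/ Cmod (z, om) * (u ^ i * exp (- (u * z)))) by ring.
    rewrite (Rmult_assoc (/ Cmod (z, om))). apply Rmult_le_compat_l; lra. }
  induction j as [|j [M1 IH]].
  - destruct (Hmain 0%nat) as [M H]. exists M. intros u Hu. specialize (H u Hu).
    replace (RtoC (u ^ 0)) with (RtoC 1) in H by reflexivity. rewrite Cmult_1_l in H. exact H.
  - destruct (Hmain (S j)) as [M H]. exists (M + INR (S j) / Cmod (z, om) * M1). intros u Hu.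
    change (pow_exp_prim (z, om) (S j) u) with (RtoC (u ^ S j) * (- / (z, om) * Cexp (- (z, om) * RtoC u)) + RtoC (INR (S j)) / (z, om) * pow_exp_prim (z, om) j u)%C.
    apply Rle_trans with (1 := Cmod_triangle _ _). rewrite Rmult_plus_distr_r. apply Rplus_le_compat; [auto|].
    rewrite Cmod_mult, Cmod_div, Cmod_R, Rabs_pos_eq by (auto; apply pos_INR).
    rewrite (Rmult_assoc (INR (S j) / Cmod (z, om))).
    apply Rmult_le_compat_l; [|auto]. apply Rmult_le_pos; [apply pos_INR|lra].
Qed.

Definition pexp (k : nat) (z u : R) : R := u ^ k * exp (- (u * z)).

Lemma pexp_continuous k z u : continuous (pexp k z) u.
Proof. apply (ex_derive_continuous (V := R_NormedModule)). unfold pexp. auto_derive; auto. Qed.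

(* [int_n^(n+1) u^k exp(-zu) cos(2 pi m u) du], brought back to the unit interval. *)
Definition pexp_coef (k m : nat) (z : R) (n : nat) : R :=
  Re (pow_exp_prim (z, 2 * PI * INR m) k (INR n + 1)) - Re (pow_exp_prim (z, 2 * PI * INR m) k (INR n)).

Lemma pexp_coef_RInt (k m : nat) (z : R) (n : nat) :
  0 < z -> is_RInt (fun t => pexp k z (INR n + t) * cos_mode m t) 0 1 (pexp_coef k m z n).
Proof.
  intros Hz. set (zt := (z, 2 * PI * INR m) : C).
  assert (Hz0 : zt <> 0) by (intros E; apply (f_equal Re) in E; unfold Re in E; simpl in E; lra).
  assert (H : is_RInt (fun u => pexp k z u * cos_mode m u) (INR n) (INR n + 1) (pexp_coef k m z n)).
  { apply (is_RInt_derive (V := R_CompleteNormedModule) (fun u => Re (pow_exp_prim zt k u))).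
    - intros u _. destruct (pow_exp_prim_derive zt k u Hz0) as [H _].
      replace (pexp k z u * cos_mode m u) with (Re (RtoC (u ^ k) * Cexp (- zt * RtoC u))%C); [exact H|].
      unfold zt, Cexp, pexp, cos_mode, Re, Im, RtoC; simpl.
      replace (- z * u - - (2 * PI * INR m) * 0) with (- (u * z)) by ring.
      replace (- z * 0 + - (2 * PI * INR m) * u) with (- (2 * PI * INR m * u)) by ring.
      rewrite cos_neg. ring.
    - intros u _. apply (continuous_mult (pexp k z) (cos_mode m)); [apply pexp_continuous|apply cos_mode_continuous]. }
  assert (H' : is_RInt (fun u => pexp k z u * cos_mode m u) (1 * 0 + INR n) (1 * 1 + INR n) (pexp_coef k m z n)).
  { replace (1 * 0 + INR n) with (INR n) by ring. replace (1 * 1 + INR n) with (INR n + 1) by ring. exact H. }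
  apply (is_RInt_comp_lin (V := R_NormedModule)) in H'. apply is_RInt_ext_R with (2 := H').
  intros t _. unfold scal; simpl; unfold mult; simpl. rewrite !Rmult_1_l, (Rplus_comm t). f_equal.
  unfold cos_mode. replace (2 * PI * INR m * (INR n + t)) with (2 * PI * INR m * t + 2 * INR (m * n) * PI) by (rewrite mult_INR; ring).
  apply cos_period.
Qed.

(** The unit intervals fill the half-line, so the differences of [pow_exp_prim] telescope to minus
    its value at [0]. *)
Lemma pexp_coef_series (k m : nat) (z : R) :
  0 < z -> is_series (pexp_coef k m z) (INR (fact k) * kap (S k) z (2 * PI * INR m)).
Proof.
  intros Hz. set (zt := (z, 2 * PI * INR m) : C).
  assert (Hz0 : zt <> 0) by (intros E; apply (f_equal Re) in E; unfold Re in E; simpl in E; lra).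
  pose (t := fun n => - Re (pow_exp_prim zt k (INR n))).
  assert (Hl : is_lim_seq t 0).
  { destruct (pow_exp_prim_bound z (2 * PI * INR m) k Hz) as [M HM]. fold zt in HM.
    apply is_lim_seq_incr_1.
    apply is_lim_seq_abs_0.
    apply (is_lim_seq_le_le (fun _ => 0) _ (fun n => M * Rpower (INR n + 1) (- (1)))).
    - intros n. split; [apply Rabs_pos|]. unfold t. rewrite Rabs_Ropp.
      apply Rle_trans with (1 := Rabs_Re_le _). rewrite S_INR. apply HM. generalize (pos_INR n); lra.
    - apply is_lim_seq_const.
    - replace (Finite 0) with (Rbar_mult M 0) by (simpl; f_equal; ring).
      apply is_lim_seq_scal_l. apply Rpower_neg_lim; lra. }
  assert (H := is_series_telescope t 0 Hl).
  replace (INR (fact k) * kap (S k) z (2 * PI * INR m)) with (t 0%nat - 0).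
  - apply is_series_ext with (2 := H). intros n. change (t n - t (S n) = pexp_coef k m z n).
    unfold t, pexp_coef. fold zt. rewrite S_INR. ring.
  - unfold t, kap. fold zt. simpl INR. rewrite pow_exp_prim_0 by auto.
    replace (- RtoC (INR (fact k)) / Cpow zt (S k))%C with (RtoC (- INR (fact k)) * / Cpow zt (S k))%C.
    + unfold Re; simpl. ring.
    + rewrite RtoC_opp. reflexivity.
Qed.

(** The sum over the translates [n + t] with [n >= 1]. The translate [n = 0] is kept apart because
    near [t = 0] it is the one that does not decay uniformly when [z] runs through the multiples of
    [w]. *)
Definition tail_sum (k : nat) (z t : R) : R := Series (fun n => pexp k z (INR (S n) + t)).

Lemma ex_series_half : ex_series (fun n => Rpower (INR n + 1 / 2) (- (2))).
Proof. apply ex_series_Rpower; lra. Qed.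

Lemma pexp_nonneg k z u : 0 <= u -> 0 <= pexp k z u.
Proof. intros. unfold pexp. apply Rmult_le_pos; [apply pow_le; auto|left; apply exp_pos]. Qed.

(** The exponent [k + 2] leaves [x^(-2)]. Starting at [n = 1] lets [t] go down to [- 1 / 2], a
    neighbourhood of the endpoint [0], where continuity is needed. *)
Lemma pexp_bound (k : nat) : exists M, 0 < M /\ forall z n t, 0 < z -> - (1 / 2) < t ->
  Rabs (pexp k z (INR (S n) + t)) <= M * Rpower z (- (INR k + 2)) * Rpower (INR n + 1 / 2) (- (2)).
Proof.
  destruct (pow_exp_le k (INR k + 2)) as [M [HM H]]; [generalize (pos_INR k); lra|].
  exists M; split; auto. intros z n t Hz Ht. assert (Hn := pos_INR n).
  assert (Hx : INR n + 1 / 2 < INR (S n) + t) by (rewrite S_INR; lra).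
  rewrite Rabs_pos_eq by (apply pexp_nonneg; lra).
  apply Rle_trans with (1 := H z (INR (S n) + t) Hz ltac:(lra)).
  replace (INR k - (INR k + 2)) with (- (2)) by ring.
  apply Rmult_le_compat_l; [apply Rmult_le_pos; [lra|left; apply Rpower_pos]|].
  apply Rpower_neg_le; lra.
Qed.

Lemma tail_sum_series k z t : 0 < z -> - (1 / 2) < t ->
  is_series (fun n => pexp k z (INR (S n) + t)) (tail_sum k z t).
Proof.
  intros Hz Ht. destruct (pexp_bound k) as [M [HM H]]. apply Series_correct.
  apply (ex_series_le (V := R_CompleteNormedModule)) with (fun n => M * Rpower z (- (INR k + 2)) * Rpower (INR n + 1 / 2) (- (2))).
  - intros n. apply (H z n t Hz Ht).
  - apply (ex_series_scal (K := R_AbsRing) (V := R_NormedModule)). apply ex_series_half.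
Qed.

Lemma tail_sum_bound (k : nat) : exists M, 0 < M /\ forall z t, 0 < z -> - (1 / 2) < t ->
  Rabs (tail_sum k z t) <= M * Rpower z (- (INR k + 2)).
Proof.
  destruct (pexp_bound k) as [M [HM H]]. destruct ex_series_half as [B HB].
  assert (HB0 : 0 <= B).
  { apply is_series_nonneg with (2 := HB). intros n. left; apply Rpower_pos. }
  exists (M * (B + 1)). split; [nra|]. intros z t Hz Ht.
  assert (P := Rpower_pos z (- (INR k + 2))).
  apply Rle_trans with (M * Rpower z (- (INR k + 2)) * B); [|nra].
  exact (norm_series_le (V := R_NormedModule) _ _ _ _ (fun n => H z n t Hz Ht)
    (is_series_scal (K := R_AbsRing) (V := R_NormedModule) (M * Rpower z (- (INR k + 2))) _ B HB) (tail_sum_series k z t Hz Ht)).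
Qed.

Lemma tail_sum_continuous k z t : 0 < z -> 0 <= t -> continuous (tail_sum k z) t.
Proof.
  intros Hz Ht. destruct (pexp_bound k) as [M [HM H]].
  apply (continuous_series (fun n t => pexp k z (INR (S n) + t))
    (fun n => M * Rpower z (- (INR k + 2)) * Rpower (INR n + 1 / 2) (- (2))) _ t (1 / 2)); [lra| | | |].
  - apply (ex_series_scal (K := R_AbsRing) (V := R_NormedModule)). apply ex_series_half.
  - intros n. apply (continuous_comp (fun t => INR (S n) + t) (pexp k z)); [|apply pexp_continuous].
    apply (ex_derive_continuous (V := R_NormedModule)). auto_derive; auto.
  - intros n s Hs. apply Rabs_def2 in Hs. apply H; auto. lra.
  - intros s Hs. apply Rabs_def2 in Hs. apply tail_sum_series; auto. lra.
Qed.

Lemma tail_sum_cos (k m : nat) (z : R) : 0 < z ->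
  is_RInt (fun t => tail_sum k z t * cos_mode m t) 0 1
    (INR (fact k) * kap (S k) z (2 * PI * INR m) - pexp_coef k m z 0).
Proof.
  intros Hz. destruct (pexp_bound k) as [M [HM H]].
  destruct (is_RInt_series_R (fun n t => pexp k z (INR (S n) + t) * cos_mode m t)
    (fun n => M * Rpower z (- (INR k + 2)) * Rpower (INR n + 1 / 2) (- (2)))
    (fun t => tail_sum k z t * cos_mode m t) (fun n => pexp_coef k m z (S n)) 0 1) as [L [HL1 HL2]]; [lra| | | | |].
  - apply (ex_series_scal (K := R_AbsRing) (V := R_NormedModule)). apply ex_series_half.
  - intros n t Ht. rewrite Rabs_mult. specialize (H z n t Hz ltac:(lra)).
    generalize (Rabs_cos_mode_le m t) (Rabs_pos (cos_mode m t)) (Rabs_pos (pexp k z (INR (S n) + t))). nra.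
  - intros t Ht. apply is_series_ext with (fun n => cos_mode m t * pexp k z (INR (S n) + t)); [intros; apply Rmult_comm|].
    rewrite Rmult_comm. apply (is_series_scal (K := R_AbsRing) (V := R_NormedModule) (cos_mode m t) _ (tail_sum k z t)).
    apply tail_sum_series; auto. lra.
  - intros n. apply pexp_coef_RInt; auto.
  - apply is_RInt_R_eq with (1 := HL2).
    assert (Hs := pexp_coef_series k m z Hz).
    assert (Hs' : is_series (fun n => pexp_coef k m z (S n)) (INR (fact k) * kap (S k) z (2 * PI * INR m) - pexp_coef k m z 0)).
    { apply (is_series_incr_1 (K := R_AbsRing) (V := R_NormedModule)).
      match goal with |- is_series _ ?l => replace l with (INR (fact k) * kap (S k) z (2 * PI * INR m)); [exact Hs|] end.
      unfold plus; simpl. ring. }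
    rewrite <- (is_series_unique _ _ HL1). apply is_series_unique. exact Hs'.
Qed.

Lemma cos_coef_sym (g : R -> R) (m : nat) (I : R) :
  is_RInt (fun t => g t * cos_mode m t) 0 1 I ->
  is_RInt (fun t => (g t + g (1 - t)) * cos_mode m t) 0 1 (2 * I).
Proof.
  intros H. assert (H2 := is_RInt_refl _ _ H).
  apply is_RInt_R_eq with (I := I + I); [|ring].
  apply is_RInt_ext_R with (2 := is_RInt_plus (V := R_NormedModule) _ _ _ _ _ _ H H2).
  intros t _. rewrite cos_mode_refl. unfold plus; simpl. ring.
Qed.

Lemma ex_series_inv_sqr : ex_series (fun m => / (2 * PI * INR (S m)) ^ 2).
Proof.
  apply (ex_series_le (V := R_CompleteNormedModule)) with (fun n => Rpower (INR n + 1) (- (2))).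
  - intros n. change (Rabs (/ (2 * PI * INR (S n)) ^ 2) <= Rpower (INR n + 1) (- (2))).
    assert (Hn := pos_INR n). assert (HPI := PI2_1). rewrite <- S_INR.
    assert (Hp : 0 < INR (S n)) by (rewrite S_INR; lra).
    rewrite Rpower_Ropp. replace (Rpower (INR (S n)) 2) with (INR (S n) ^ 2) by (rewrite <- Rpower_pow; auto).
    assert (Hle : INR (S n) <= 2 * PI * INR (S n)) by nra.
    rewrite Rabs_pos_eq by (left; apply Rinv_0_lt_compat, pow_lt; nra).
    apply Rinv_le_contravar; [apply pow_lt; auto|]. apply pow_incr; lra.
  - apply ex_series_Rpower; lra.
Qed.

Lemma om_ge_1 m : 1 <= 2 * PI * INR (S m).
Proof. assert (Hn := pos_INR m). assert (HPI := PI2_1). rewrite S_INR. nra. Qed.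

(** Poisson summation for [u^(k+1) exp (- z u)], extended by zero to [u < 0]. The cosine
    coefficients of the sum [g] of its translates are values of the half-line transform, and
    [fourier_at_0] is applied to [g t + g (1 - t)]. *)
Lemma lipschitz_sum (k : nat) (z : R) : 0 < z ->
  tail_sum (S k) z 0 = INR (fact (S k)) * (kap (S (S k)) z 0 + 2 * Series (fun m => kap (S (S k)) z (2 * PI * INR (S m)))).
Proof.
  intros Hz. set (F := INR (fact (S k))). assert (HF : 0 < F) by apply INR_fact_lt_0.
  pose (g := fun t => pexp (S k) z t + tail_sum (S k) z t).
  assert (Hg : forall m, is_RInt (fun t => g t * cos_mode m t) 0 1 (F * kap (S (S k)) z (2 * PI * INR m))).
  { intros m. assert (H1 := pexp_coef_RInt (S k) m z 0 Hz). assert (H2 := tail_sum_cos (S k) m z Hz).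
    assert (H := is_RInt_plus (V := R_NormedModule) _ _ _ _ _ _ H1 H2).
    apply is_RInt_R_eq with (I := pexp_coef (S k) m z 0 + (F * kap (S (S k)) z (2 * PI * INR m) - pexp_coef (S k) m z 0)); [|ring].
    apply is_RInt_ext_R with (2 := H). intros t _. unfold g, plus; simpl AbelianMonoid.plus. simpl INR. rewrite Rplus_0_l.
    change (pexp (S k) z t * cos_mode m t + tail_sum (S k) z t * cos_mode m t = (pexp (S k) z t + tail_sum (S k) z t) * cos_mode m t). ring. }
  assert (Hgc : forall t, 0 <= t -> continuous g t).
  { intros t Ht. apply (continuous_plus (V := R_NormedModule) (pexp (S k) z) (tail_sum (S k) z)); [apply pexp_continuous|apply tail_sum_continuous; auto]. }
  assert (H := fourier_at_0 (fun t => g t + g (1 - t)) (fun m => 2 * (F * kap (S (S k)) z (2 * PI * INR m)))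
    (fun m => 2 * F * / (2 * PI * INR (S m)) ^ 2)).
  (* The power is at least [1], so [pexp] vanishes at [0] and the periodized function has no jump:
     [g 0] and [g 1] both equal the sum over positive integers. *)
  assert (Hf0 : g 0 + g (1 - 0) = 2 * tail_sum (S k) z 0).
  { unfold g. rewrite Rminus_0_r.
    assert (E0 : pexp (S k) z 0 = 0) by (unfold pexp; rewrite pow_i by lia; ring).
    assert (E1 : tail_sum (S k) z 0 = pexp (S k) z 1 + tail_sum (S k) z 1).
    { unfold tail_sum at 1. rewrite Series_incr_1 by (eexists; apply tail_sum_series; lra).
      f_equal; [f_equal; simpl; ring|]. apply Series_ext. intros n. f_equal. rewrite !S_INR. ring. }
    lra. }
  assert (H' : g 0 + g (1 - 0) = 2 * (F * kap (S (S k)) z (2 * PI * INR 0)) +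
     2 * Series (fun m => 2 * (F * kap (S (S k)) z (2 * PI * INR (S m))))).
  { apply H.
    - intros t Ht. apply (continuous_plus (V := R_NormedModule) g (fun t => g (1 - t))); [apply Hgc; lra|].
      apply (continuous_comp (fun t => 1 - t) g); [|apply Hgc; lra].
      apply (ex_derive_continuous (V := R_NormedModule)). auto_derive; auto.
    - intros t _. replace (1 - (1 - t)) with t by ring. ring.
    - intros m. apply cos_coef_sym. apply Hg.
    - intros m. rewrite !Rabs_mult, (Rabs_pos_eq 2), (Rabs_pos_eq F) by lra.
      rewrite <- Rmult_assoc. apply Rmult_le_compat_l; [lra|]. apply kap_bound; auto. apply om_ge_1.
    - apply (ex_series_scal (K := R_AbsRing) (V := R_NormedModule) (2 * F)). apply ex_series_inv_sqr. }
  rewrite Hf0 in H'.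
  rewrite (Series_ext (fun m => 2 * (F * kap (S (S k)) z (2 * PI * INR (S m)))) (fun m => (2 * F) * kap (S (S k)) z (2 * PI * INR (S m)))) in H' by (intros; ring).
  rewrite Series_scal_l in H'. replace (2 * PI * INR 0) with 0 in H' by (simpl; ring). lra.
Qed.

(** Euler's evaluation of [zeta (2 l + 2)]: the Fourier series of an even-index Bernoulli polynomial
    taken at the endpoint. *)
Lemma bern_at_1 (l : nat) :
  bern (2 * S l) 1 = 2 * (-1) ^ l * Series (fun m => / (2 * PI * INR (S m)) ^ (2 * S l)).
Proof.
  pose (c := fun m => match m with O => 0 | S i => 2 * ((-1) ^ l / (2 * PI * INR (S i)) ^ (2 * S l)) end).
  assert (Hp : forall m, 0 < / (2 * PI * INR (S m)) ^ (2 * S l) <= / (2 * PI * INR (S m)) ^ 2).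
  { intros m. assert (H := om_ge_1 m). split; [apply Rinv_0_lt_compat, pow_lt; lra|].
    apply Rinv_le_contravar; [apply pow_lt; lra|]. apply Rle_pow; [auto|lia]. }
  assert (H := fourier_at_0 (fun t => bern (2 * S l) t + bern (2 * S l) (1 - t)) c (fun m => 2 * / (2 * PI * INR (S m)) ^ 2)).
  assert (H' : bern (2 * S l) 0 + bern (2 * S l) (1 - 0) = c 0%nat + 2 * Series (fun m => c (S m))).
  { apply H.
    - intros t _. apply (continuous_plus (V := R_NormedModule) (bern (2 * S l)) (fun t => bern (2 * S l) (1 - t))); [apply bern_continuous|].
      apply (bern_refl_continuous (2 * S l)).
    - intros t _. replace (1 - (1 - t)) with t by ring. ring.
    - intros m. destruct m as [|m].
      + apply is_RInt_R_eq with (I := 2 * 0); [|simpl; ring]. apply cos_coef_sym.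
        replace (2 * S l)%nat with (S (2 * l + 1)) by lia. apply bern_cos_0.
      + apply cos_coef_sym. apply bern_cos.
    - intros m. unfold c. rewrite Rabs_mult, (Rabs_pos_eq 2) by lra. apply Rmult_le_compat_l; [lra|].
      unfold Rdiv. rewrite Rabs_mult, pow_1_abs, Rmult_1_l, Rabs_pos_eq by (left; apply Hp). apply Hp.
    - apply (ex_series_scal (K := R_AbsRing) (V := R_NormedModule) 2). apply ex_series_inv_sqr. }
  replace (bern (2 * S l) 0) with (bern (2 * S l) 1) in H'.
  2:{ replace (2 * S l)%nat with (S (S (2 * l))) by lia. apply bern_period. }
  rewrite Rminus_0_r in H'. unfold c in H'.
  rewrite (Series_ext _ (fun m => (2 * (-1) ^ l) * / (2 * PI * INR (S m)) ^ (2 * S l))) in H' by (intros; unfold Rdiv; ring).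
  rewrite Series_scal_l in H'. lra.
Qed.

(** * The double sum and its continuity at the endpoint *)

(* [Q_w t = (exp (w t) - 1) / t], extended continuously at [0]. *)
Definition exp_quot (w t : R) : R := if Req_EM_T t 0 then w else (exp (w * t) - 1) / t.

Lemma exp_quot_pos w t : 0 < w -> 0 < exp_quot w t.
Proof.
  intros Hw. unfold exp_quot. destruct (Req_EM_T t 0) as [|Ht]; auto.
  destruct (Rtotal_order t 0) as [H|[H|H]]; [|lra|].
  - assert (exp (w * t) < 1) by (rewrite <- exp_0; apply exp_increasing; nra).
    replace ((exp (w * t) - 1) / t) with ((1 - exp (w * t)) / - t) by (field; auto).
    apply Rdiv_lt_0_compat; lra.
  - assert (1 < exp (w * t)) by (rewrite <- exp_0; apply exp_increasing; nra).
    apply Rdiv_lt_0_compat; lra.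
Qed.

Lemma exp_quot_continuous w t : 0 < w -> continuous (exp_quot w) t.
Proof.
  intros Hw. destruct (Req_EM_T t 0) as [E|Ht].
  - subst t. apply filterlim_locally. intros [eps He].
    assert (K : 0 < w * (exp w * w) + 1) by (generalize (exp_pos w); intros; assert (0 < exp w * w) by nra; nra).
    assert (Hd : 0 < Rmin 1 (eps / (w * (exp w * w) + 1))) by (apply Rmin_glb_lt; [lra|apply Rdiv_lt_0_compat; auto]).
    exists (mkposreal _ Hd). intros s Hs. change (Rabs (s - 0) < Rmin 1 (eps / (w * (exp w * w) + 1))) in Hs.
    change (Rabs (exp_quot w s - exp_quot w 0) < eps). rewrite Rminus_0_r in Hs.
    assert (Q1 := Rmin_l 1 (eps / (w * (exp w * w) + 1))). assert (Q2 := Rmin_r 1 (eps / (w * (exp w * w) + 1))).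
    unfold exp_quot. destruct (Req_EM_T 0 0) as [_|]; [|lra].
    destruct (Req_EM_T s 0) as [_|Hs0]; [rewrite Rminus_diag, Rabs_R0; auto|].
    assert (Hsp : 0 < Rabs s) by (apply Rabs_pos_lt; auto).
    replace ((exp (w * s) - 1) / s - w) with ((exp (w * s) - 1 - w * s) / s) by (field; auto).
    unfold Rdiv. rewrite Rabs_mult, Rabs_inv.
    apply Rmult_lt_reg_r with (Rabs s); auto. rewrite Rmult_assoc, Rinv_l, Rmult_1_r by lra.
    apply Rle_lt_trans with (w * (exp w * w) * Rabs s * Rabs s).
    + apply Rle_trans with (1 := Rabs_exp_taylor_le (w * s) (w * Rabs s) ltac:(rewrite Rabs_mult, (Rabs_pos_eq w); lra)).
      rewrite Rabs_mult, (Rabs_pos_eq w) by lra.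
      assert (exp (w * Rabs s) <= exp w).
      { apply exp_Rabs_le. rewrite Rabs_mult, Rabs_Rabsolu, (Rabs_pos_eq w) by lra. nra. }
      replace (w * (exp w * w) * Rabs s * Rabs s) with (exp w * (w * Rabs s * (w * Rabs s))) by ring.
      rewrite Rmult_assoc. apply Rmult_le_compat_r; auto. apply Rmult_le_pos; nra.
    + apply Rmult_lt_compat_r; auto.
      apply Rlt_le_trans with ((w * (exp w * w) + 1) * Rabs s); [lra|].
      apply Rle_trans with ((w * (exp w * w) + 1) * (eps / (w * (exp w * w) + 1))).
      * apply Rmult_le_compat_l; lra.
      * right; field; lra.
  - apply continuous_ext_loc with (fun t => (exp (w * t) - 1) / t).
    + assert (Hp : 0 < Rabs t) by (apply Rabs_pos_lt; auto). exists (mkposreal _ Hp).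
      intros s Hs. change (Rabs (s - t) < Rabs t) in Hs. unfold exp_quot.
      destruct (Req_EM_T s 0) as [->|]; auto. rewrite Rminus_0_l, Rabs_Ropp in Hs. lra.
    + apply (ex_derive_continuous (V := R_NormedModule)). auto_derive; auto.
Qed.

(* [t ^ (k+1) / (exp (w t) - 1)], extended continuously at [0]. *)
Definition planck (k : nat) (w t : R) : R := t ^ k / exp_quot w t.

Lemma planck_continuous k w t : 0 < w -> continuous (planck k w) t.
Proof.
  intros Hw. apply (continuous_mult (fun t => t ^ k) (fun t => / exp_quot w t)).
  - apply (ex_derive_continuous (V := R_NormedModule)). auto_derive; auto.
  - apply (continuous_comp (exp_quot w) Rinv); [apply exp_quot_continuous; auto|].
    apply continuous_Rinv. apply Rgt_not_eq, exp_quot_pos; auto.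
Qed.

(** A telescoped geometric series: [pexp (S k) (z + w) t] is the drop of
    [exp (- t z) * planck k w t] when [z] grows by [w]. *)
Lemma planck_partial (k N : nat) (w t : R) : 0 < w -> t <> 0 ->
  sum_n (fun r => pexp (S k) (INR (S r) * w) t) N = planck k w t - exp (- (t * (INR (S N) * w))) * planck k w t.
Proof.
  intros Hw Ht.
  assert (Hx : exp (w * t) - 1 <> 0).
  { intros E. assert (P := exp_quot_pos w t Hw). unfold exp_quot in P. destruct (Req_EM_T t 0); [auto|].
    rewrite E in P. unfold Rdiv in P. rewrite Rmult_0_l in P. lra. }
  assert (Hpl : planck k w t = t ^ S k / (exp (w * t) - 1)).
  { unfold planck, exp_quot. destruct (Req_EM_T t 0); [lra|]. simpl. field. auto. }
  assert (Hstep : forall z, exp (- (t * z)) * planck k w t - exp (- (t * (z + w))) * planck k w t = pexp (S k) (z + w) t).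
  { intros z. rewrite Hpl. unfold pexp.
    replace (exp (- (t * z))) with (exp (- (t * (z + w))) * exp (w * t)) by (rewrite <- exp_plus; f_equal; ring).
    field. auto. }
  induction N as [|N IH].
  - rewrite sum_O. change (pexp (S k) (INR 1 * w) t = planck k w t - exp (- (t * (INR 1 * w))) * planck k w t).
    replace (INR 1 * w) with (0 + w) by (simpl; ring). rewrite <- Hstep.
    rewrite Rmult_0_r, Ropp_0, exp_0. ring.
  - rewrite sum_Sn, IH. replace (INR (S (S N)) * w) with (INR (S N) * w + w) by (rewrite (S_INR (S N)); ring).
    rewrite <- Hstep. match goal with |- plus ?x ?y = _ => change (plus x y) with (x + y) end.
    match goal with |- ?x = ?y => change (@eq R x y) end. ring.
Qed.

Lemma planck_series (k : nat) (w t : R) : 0 < w -> 0 < t ->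
  is_series (fun r => pexp (S k) (INR (S r) * w) t) (planck k w t).
Proof.
  intros Hw Ht.
  change (is_lim_seq (sum_n (fun r => pexp (S k) (INR (S r) * w) t)) (planck k w t)).
  apply is_lim_seq_ext with (fun N => planck k w t - exp (- (t * (INR (S N) * w))) * planck k w t).
  { intros N. rewrite planck_partial; auto. lra. }
  replace (Finite (planck k w t)) with (Finite (planck k w t - 0 * planck k w t)) by (f_equal; ring).
  apply is_lim_seq_minus'; [apply is_lim_seq_const|].
  apply is_lim_seq_mult'; [|apply is_lim_seq_const].
  destruct (exp_opp_le_Rpower 1 Rlt_0_1) as [M [HM H]].
  apply (is_lim_seq_le_le (fun _ => 0) _ (fun N => M * Rpower (t * w) (- (1)) * Rpower (INR N + 1) (- (1)))).
  - intros N. split; [left; apply exp_pos|]. assert (Hn := pos_INR N). rewrite S_INR.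
    assert (Htw : 0 < t * w) by nra.
    apply Rle_trans with (1 := H (t * ((INR N + 1) * w)) ltac:(apply Rmult_lt_0_compat; nra)).
    replace (t * ((INR N + 1) * w)) with ((t * w) * (INR N + 1)) by ring.
    rewrite <- Rpower_mult_distr by lra. lra.
  - apply is_lim_seq_const.
  - replace (Finite 0) with (Rbar_mult (M * Rpower (t * w) (- (1))) 0) by (simpl; f_equal; ring).
    apply is_lim_seq_scal_l. apply Rpower_neg_lim; lra.
Qed.

(* For [k = 0] the termwise convergence is not uniform near [0]; the remainder after [N] terms is
   [exp (- N w t) * planck t], whose integral is [O(1 / N)]. *)
Lemma planck_cos (k m : nat) (w : R) : 0 < w ->
  exists H, is_RInt (fun t => planck k w t * cos_mode m t) 0 1 H /\
    is_series (fun r => pexp_coef (S k) m (INR (S r) * w) 0) H.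
Proof.
  intros Hw.
  assert (Hc : forall t, continuous (fun t => planck k w t * cos_mode m t) t).
  { intros t. apply (continuous_mult (planck k w) (cos_mode m)); [apply planck_continuous; auto|apply cos_mode_continuous]. }
  destruct (ex_RInt_continuous (V := R_CompleteNormedModule) _ 0 1 (fun t _ => Hc t)) as [H HH].
  exists H. split; auto.
  destruct (bounded_continuity (K := R_AbsRing) (V := R_NormedModule) (planck k w) 0 1) as [M HM].
  { intros; apply planck_continuous; auto. }
  assert (HM0 : 0 < M).
  { apply Rle_lt_trans with (2 := HM 0 ltac:(lra)). apply norm_ge_0. }
  change (is_lim_seq (sum_n (fun r => pexp_coef (S k) m (INR (S r) * w) 0)) H).
  assert (Hbound : forall N, Rabs (sum_n (fun r => pexp_coef (S k) m (INR (S r) * w) 0) N - H) <= M / w * Rpower (INR N + 1) (- (1))).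
  { intros N. set (J := sum_n (fun r => pexp_coef (S k) m (INR (S r) * w) 0) N).
    assert (Hpos : forall r, 0 < INR (S r) * w).
    { intros r. apply Rmult_lt_0_compat; auto. apply lt_0_INR; lia. }
    assert (HJ : is_RInt (fun t => sum_n (fun r => pexp (S k) (INR (S r) * w) (INR 0 + t) * cos_mode m t) N) 0 1 J).
    { apply (is_RInt_sum_n (V := R_NormedModule)). intros r. apply pexp_coef_RInt. apply Hpos. }
    set (X := INR (S N) * w). assert (HX : 0 < X) by apply Hpos.
    assert (HE : is_RInt (fun t => M * exp (- (t * X))) 0 1 (M * ((1 - exp (- X)) / X))).
    { apply is_RInt_R_eq with (1 := is_RInt_derive (V := R_CompleteNormedModule) (fun t => - M * exp (- (t * X)) / X) (fun t => M * exp (- (t * X))) 0 1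
        ltac:(intros t _; auto_derive; auto; field; lra)
        ltac:(intros t _; apply (ex_derive_continuous (V := R_NormedModule)); auto_derive; auto)).
      unfold minus, plus, opp; simpl. rewrite Rmult_1_l, Rmult_0_l, Ropp_0, exp_0. field; lra. }
    assert (HD := is_RInt_minus (V := R_NormedModule) _ _ _ _ _ _ HJ HH).
    assert (HD' : is_RInt (fun t => - (exp (- (t * X)) * planck k w t * cos_mode m t)) 0 1 (J - H)).
    { apply is_RInt_ext_R with (2 := HD). intros t Ht. rewrite Rmin_left, Rmax_right in Ht by lra.
      assert (E : sum_n (fun r => pexp (S k) (INR (S r) * w) (INR 0 + t) * cos_mode m t) N
         = cos_mode m t * sum_n (fun r => pexp (S k) (INR (S r) * w) t) N).
      { rewrite <- (sum_n_scal_l (K := R_AbsRing) (V := R_NormedModule)). apply sum_n_ext. intros r. simpl INR at 2. rewrite Rplus_0_l. apply Rmult_comm. }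
      rewrite E, planck_partial by lra. fold X. unfold minus, plus, opp; simpl. ring. }
    apply Rle_trans with (M * ((1 - exp (- X)) / X)).
    - apply (norm_RInt_le (V := R_NormedModule) _ (fun t => M * exp (- (t * X))) 0 1 _ _ Rle_0_1) with (2 := HD') (3 := HE).
      intros t Ht. match goal with |- norm ?x <= _ => change (Rabs x <= M * exp (- (t * X))) end.
      rewrite Rabs_Ropp, !Rabs_mult, (Rabs_pos_eq (exp _)) by (left; apply exp_pos).
      specialize (HM t Ht). change (Rabs (planck k w t) < M) in HM.
      assert (P := exp_pos (- (t * X))). assert (C1 := Rabs_cos_mode_le m t).
      assert (C2 := Rabs_pos (cos_mode m t)). assert (C3 := Rabs_pos (planck k w t)).
      assert (exp (- (t * X)) * Rabs (planck k w t) <= M * exp (- (t * X))) by nra.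
      assert (0 <= exp (- (t * X)) * Rabs (planck k w t)) by nra. nra.
    - rewrite Rpower_Ropp, Rpower_1 by (generalize (pos_INR N); lra). rewrite <- S_INR.
      unfold X. unfold Rdiv. rewrite Rinv_mult, !Rmult_assoc. apply Rmult_le_compat_l; [lra|].
      assert (P := exp_pos (- (INR (S N) * w))).
      assert (I1 : 0 < / INR (S N)) by (apply Rinv_0_lt_compat, lt_0_INR; lia).
      assert (I2 : 0 < / w) by (apply Rinv_0_lt_compat; auto). assert (I3 : 0 < / INR (S N) * / w) by nra. nra. }
  apply is_lim_seq_ext with (fun N => H + (sum_n (fun r => pexp_coef (S k) m (INR (S r) * w) 0) N - H)); [intros; ring|].
  replace (Finite H) with (Finite (H + 0)) by (f_equal; ring).
  apply is_lim_seq_plus'; [apply is_lim_seq_const|].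
  apply is_lim_seq_abs_0.
  apply (is_lim_seq_le_le (fun _ => 0) _ (fun N => M / w * Rpower (INR N + 1) (- (1)))).
  - intros N. split; [apply Rabs_pos|auto].
  - apply is_lim_seq_const.
  - replace (Finite 0) with (Rbar_mult (M / w) 0) by (simpl; f_equal; ring).
    apply is_lim_seq_scal_l. apply Rpower_neg_lim; lra.
Qed.

Definition lattice_sum (k : nat) (z t : R) : R := pexp k z t + tail_sum k z t.

Lemma lattice_sum_series (k : nat) (z t : R) : 0 < z -> 0 < t ->
  is_series (fun m => pexp k z (INR m + t)) (lattice_sum k z t).
Proof.
  intros Hz Ht. apply (is_series_decr_1 (K := R_AbsRing) (V := R_NormedModule)).
  match goal with |- is_series _ ?l => replace l with (tail_sum k z t) end.
  - apply tail_sum_series; lra.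
  - unfold lattice_sum, plus, opp; simpl. rewrite Rplus_0_l. ring.
Qed.

(** All points [n + t] with [n >= 1] stay at distance at least [1 / 2] from [0], so the sums decay
    like [r^(-k-2)] uniformly up to the endpoint. *)
Lemma tail_sum_dilate_bound (k : nat) (w : R) : 0 < w ->
  exists b : nat -> R, ex_series b /\ forall r t, - (1 / 2) < t -> Rabs (tail_sum k (INR (S r) * w) t) <= b r.
Proof.
  intros Hw. destruct (tail_sum_bound k) as [M [HM H]]. assert (Hk := pos_INR k).
  exists (fun r => M * Rpower w (- (INR k + 2)) * Rpower (INR r + 1) (- (INR k + 2))). split.
  - apply (ex_series_scal (K := R_AbsRing) (V := R_NormedModule)). apply ex_series_Rpower; lra.
  - intros r t Ht. assert (Hr := pos_INR r). rewrite S_INR.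
    apply Rle_trans with (1 := H ((INR r + 1) * w) t ltac:(nra) Ht).
    rewrite <- Rpower_mult_distr by lra. right; ring.
Qed.

Definition tail_double (k : nat) (w t : R) : R := Series (fun r => tail_sum k (INR (S r) * w) t).

Lemma INR_S_mult_pos (r : nat) (w : R) : 0 < w -> 0 < INR (S r) * w.
Proof. intros Hw. apply Rmult_lt_0_compat; auto. apply lt_0_INR; lia. Qed.

Lemma tail_double_series k w t : 0 < w -> - (1 / 2) < t ->
  is_series (fun r => tail_sum k (INR (S r) * w) t) (tail_double k w t).
Proof.
  intros Hw Ht. destruct (tail_sum_dilate_bound k w Hw) as [b [Hb H]]. apply Series_correct.
  apply (ex_series_le (V := R_CompleteNormedModule)) with b; [intros r; apply H; auto|auto].
Qed.

Lemma tail_double_continuous k w t : 0 < w -> 0 <= t -> continuous (tail_double k w) t.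
Proof.
  intros Hw Ht. destruct (tail_sum_dilate_bound k w Hw) as [b [Hb H]].
  apply (continuous_series (fun r t => tail_sum k (INR (S r) * w) t) b _ t (1 / 2)); [lra|auto| | |].
  - intros r. apply tail_sum_continuous; auto. apply INR_S_mult_pos; auto.
  - intros r s Hs. apply Rabs_def2 in Hs. apply H; lra.
  - intros s Hs. apply Rabs_def2 in Hs. apply tail_double_series; auto; lra.
Qed.

Lemma tail_double_cos (k m : nat) (w : R) : 0 < w ->
  exists L, is_RInt (fun t => tail_double k w t * cos_mode m t) 0 1 L /\
    is_series (fun r => INR (fact k) * kap (S k) (INR (S r) * w) (2 * PI * INR m) - pexp_coef k m (INR (S r) * w) 0) L.
Proof.
  intros Hw. destruct (tail_sum_dilate_bound k w Hw) as [b [Hb H]].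
  destruct (is_RInt_series_R (fun r t => tail_sum k (INR (S r) * w) t * cos_mode m t) b
    (fun t => tail_double k w t * cos_mode m t)
    (fun r => INR (fact k) * kap (S k) (INR (S r) * w) (2 * PI * INR m) - pexp_coef k m (INR (S r) * w) 0) 0 1)
    as [L [HL1 HL2]]; [lra|auto| | | |exists L; auto].
  - intros r t Ht. rewrite Rabs_mult. specialize (H r t ltac:(lra)).
    generalize (Rabs_cos_mode_le m t) (Rabs_pos (cos_mode m t)) (Rabs_pos (tail_sum k (INR (S r) * w) t)). nra.
  - intros t Ht. apply is_series_ext with (fun r => cos_mode m t * tail_sum k (INR (S r) * w) t); [intros; apply Rmult_comm|].
    rewrite Rmult_comm. apply (is_series_scal (K := R_AbsRing) (V := R_NormedModule) (cos_mode m t) _ (tail_double k w t)).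
    apply tail_double_series; auto. lra.
  - intros r. apply tail_sum_cos. apply INR_S_mult_pos; auto.
Qed.

(* [sum_{r >= 1} sum_{m >= 0} (m+t)^(k+1) exp(-r w (m+t))], continuous up to [t = 0]. *)
Definition double_sum (k : nat) (w t : R) : R := planck k w t + tail_double (S k) w t.

Lemma double_sum_series k w t : 0 < w -> 0 < t ->
  is_series (fun r => lattice_sum (S k) (INR (S r) * w) t) (double_sum k w t).
Proof.
  intros Hw Ht.
  apply (is_series_plus (K := R_AbsRing) (V := R_NormedModule) (fun r => pexp (S k) (INR (S r) * w) t)
    (fun r => tail_sum (S k) (INR (S r) * w) t)).
  - apply planck_series; auto.
  - apply tail_double_series; lra.
Qed.

Lemma double_sum_continuous k w t : 0 < w -> 0 <= t -> continuous (double_sum k w) t.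
Proof.
  intros Hw Ht. apply (continuous_plus (V := R_NormedModule) (planck k w) (tail_double (S k) w)).
  - apply planck_continuous; auto.
  - apply tail_double_continuous; auto.
Qed.

(** The coefficients of the [planck] part are integrals over the first unit interval, precisely what
    the tail part misses from the full half-line transform. *)
Lemma double_sum_cos (k m : nat) (w : R) : 0 < w ->
  exists L, is_RInt (fun t => double_sum k w t * cos_mode m t) 0 1 L /\
    is_series (fun r => INR (fact (S k)) * kap (S (S k)) (INR (S r) * w) (2 * PI * INR m)) L.
Proof.
  intros Hw. destruct (planck_cos k m w Hw) as [H [H1 H2]].
  destruct (tail_double_cos (S k) m w Hw) as [L [L1 L2]]. exists (H + L). split.
  - apply is_RInt_ext_R with (2 := is_RInt_plus (V := R_NormedModule) _ _ _ _ _ _ H1 L1).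
    intros t _. unfold double_sum, plus; simpl. ring.
  - assert (E := is_series_plus (K := R_AbsRing) (V := R_NormedModule) _ _ _ _ H2 L2).
    apply is_series_ext with (2 := E). intros r.
    match goal with |- plus ?x ?y = ?z => change (x + y = z) end. ring.
Qed.

(** * The divisor sums *)

Definition fold_sum (l : list R) : R := fold_right Rplus 0 l.

Lemma fold_sum_bound (A : Type) (f : A -> R) (B : R) (l : list A) :
  (forall d, In d l -> Rabs (f d) <= B) -> Rabs (fold_sum (map f l)) <= B * INR (length l).
Proof.
  induction l as [|d l IH]; intros H.
  - simpl. rewrite Rabs_R0. lra.
  - change (Rabs (f d + fold_sum (map f l)) <= B * INR (S (length l))). rewrite S_INR.
    apply Rle_trans with (1 := Rabs_triang _ _).
    assert (H1 := H d (or_introl eq_refl)). assert (H2 := IH (fun e He => H e (or_intror He))). lra.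
Qed.

Lemma fold_sum_continuous (A : Type) (f : A -> R -> R) (l : list A) (t : R) :
  (forall d, continuous (f d) t) -> continuous (fun t => fold_sum (map (fun d => f d t) l)) t.
Proof.
  intros H. induction l as [|d l IH].
  - apply continuous_const.
  - apply (continuous_plus (V := R_NormedModule) (f d) (fun t => fold_sum (map (fun d => f d t) l))); auto.
Qed.

Lemma fold_sum_RInt (A : Type) (f : A -> R -> R) (g : A -> R) (h : R -> R) (l : list A) :
  (forall d, In d l -> is_RInt (fun t => f d t * h t) 0 1 (g d)) ->
  is_RInt (fun t => fold_sum (map (fun d => f d t) l) * h t) 0 1 (fold_sum (map g l)).
Proof.
  induction l as [|d l IH]; intros H.
  - apply is_RInt_ext_R with (fun _ => 0); [intros; simpl; ring|].
    apply is_RInt_R_eq with (1 := is_RInt_const (V := R_NormedModule) 0 1 0).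
    unfold scal; simpl; unfold mult; simpl; ring.
  - assert (H1 := H d (or_introl eq_refl)). assert (H2 := IH (fun e He => H e (or_intror He))).
    apply is_RInt_ext_R with (2 := is_RInt_plus (V := R_NormedModule) _ _ _ _ _ _ H1 H2).
    intros t _. simpl. unfold plus; simpl. ring.
Qed.

Lemma fold_sum_indicator (l : list nat) (d0 : nat) (v : R) :
  NoDup l ->
  fold_sum (map (fun d => if Nat.eqb d d0 then v else 0) l) = if in_dec Nat.eq_dec d0 l then v else 0.
Proof.
  induction l as [|d l IH]; intros Hn.
  - simpl. auto.
  - inversion Hn as [|x y Hd Hl]; subst.
    change ((if Nat.eqb d d0 then v else 0) + fold_sum (map (fun d => if Nat.eqb d d0 then v else 0) l)
      = if in_dec Nat.eq_dec d0 (d :: l) then v else 0).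
    rewrite (IH Hl).
    destruct (Nat.eqb_spec d d0) as [E|E], (in_dec Nat.eq_dec d0 l) as [E2|E2], (in_dec Nat.eq_dec d0 (d :: l)) as [E3|E3];
      simpl in E3; subst; try tauto; try lra.
Qed.

Definition div_list (n : nat) : list nat := filter (fun d => Nat.eqb (Nat.modulo n d) 0) (seq 1 n).

Lemma in_div_list n d : In d (div_list n) <-> (1 <= d <= n)%nat /\ Nat.modulo n d = 0%nat.
Proof.
  unfold div_list. rewrite filter_In, in_seq, Nat.eqb_eq. lia.
Qed.

Lemma div_list_length n : (length (div_list n) <= n)%nat.
Proof.
  unfold div_list. apply Nat.le_trans with (length (seq 1 n)).
  - apply filter_length_le.
  - rewrite length_seq. auto.
Qed.

Definition twisted_sigma (k n : nat) (t : R) : R :=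
  divisor_sum n (fun d => INR d ^ k * cos (2 * PI * INR n * t / INR d)).

Lemma twisted_sigma_fold k n t :
  twisted_sigma k n t = fold_sum (map (fun d => INR d ^ k * cos (2 * PI * INR n * t / INR d)) (div_list n)).
Proof. reflexivity. Qed.

Lemma twisted_sigma_bound k n t : Rabs (twisted_sigma k n t) <= INR n ^ S k.
Proof.
  rewrite twisted_sigma_fold.
  apply Rle_trans with (INR n ^ k * INR (length (div_list n))).
  - apply fold_sum_bound. intros d Hd. apply in_div_list in Hd. destruct Hd as [Hd _].
    rewrite Rabs_mult, Rabs_pos_eq by (apply pow_le, pos_INR).
    assert (H1 : INR d ^ k <= INR n ^ k) by (apply pow_incr; split; [apply pos_INR|apply le_INR; lia]).
    assert (H2 : Rabs (cos (2 * PI * INR n * t / INR d)) <= 1) by (apply Rabs_le; generalize (COS_bound (2 * PI * INR n * t / INR d)); lra).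
    assert (H3 : 0 <= INR d ^ k) by (apply pow_le, pos_INR).
    generalize (Rabs_pos (cos (2 * PI * INR n * t / INR d))). nra.
  - simpl. rewrite Rmult_comm. apply Rmult_le_compat_r; [apply pow_le, pos_INR|]. apply le_INR, div_list_length.
Qed.

Lemma twisted_sigma_continuous k n t : continuous (twisted_sigma k n) t.
Proof.
  apply (fold_sum_continuous nat (fun d t => INR d ^ k * cos (2 * PI * INR n * t / INR d))).
  intros d. apply (ex_derive_continuous (V := R_NormedModule)). unfold Rdiv. auto_derive; auto.
Qed.

Lemma twisted_sigma_sym k n t : twisted_sigma k n (1 - t) = twisted_sigma k n t.
Proof.
  rewrite !twisted_sigma_fold. f_equal. apply map_ext_in. intros d Hd. apply in_div_list in Hd.
  destruct Hd as [Hd Hm]. f_equal. assert (Hd0 : INR d <> 0) by (apply not_0_INR; lia).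
  assert (E : INR n = INR d * INR (n / d)).
  { rewrite <- mult_INR. f_equal. apply Nat.Div0.div_exact. auto. }
  replace (2 * PI * INR n * (1 - t) / INR d) with (- (2 * PI * INR n * t / INR d) + 2 * INR (n / d) * PI).
  - rewrite cos_period. apply cos_neg.
  - rewrite E. field; auto.
Qed.

(** For a divisor [d] of [n] the cosine has the integer frequency [n / d], so mode [m] singles out
    the divisor [d = n / m], if there is one. *)
Lemma twisted_sigma_cos (k n m : nat) :
  is_RInt (fun t => twisted_sigma k (S n) t * cos_mode m t) 0 1
    (if Nat.eqb m 0 then 0 else if Nat.eqb (Nat.modulo (S n) m) 0 then INR (S n / m) ^ k / 2 else 0).
Proof.
  pose (g := fun d => INR d ^ k * (if Nat.eqb (S n / d) m then 1 / 2 else 0)).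
  assert (H : is_RInt (fun t => twisted_sigma k (S n) t * cos_mode m t) 0 1 (fold_sum (map g (div_list (S n))))).
  { apply (fold_sum_RInt nat (fun d t => INR d ^ k * cos (2 * PI * INR (S n) * t / INR d))).
    intros d Hd. apply in_div_list in Hd. destruct Hd as [Hd Hm].
    assert (Hd0 : INR d <> 0) by (apply not_0_INR; lia).
    assert (E : (S n = d * (S n / d))%nat) by (apply Nat.Div0.div_exact; auto).
    assert (EI : INR (S n) = INR d * INR (S n / d)) by (rewrite <- mult_INR; f_equal; auto).
    remember (S n / d)%nat as q. destruct q as [|q]; [lia|].
    apply is_RInt_ext_R with (fun t => INR d ^ k * (cos_mode (S q) t * cos_mode m t)).
    - intros t _. unfold cos_mode at 1. rewrite EI.
      replace (2 * PI * (INR d * INR (S q)) * t / INR d) with (2 * PI * INR (S q) * t) by (field; auto). ring.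
    - unfold g. rewrite <- Heqq.
      apply is_RInt_R_eq with (1 := is_RInt_scal (V := R_NormedModule) _ _ _ (INR d ^ k) _ (is_RInt_cos_cos q m)).
      reflexivity. }
  apply is_RInt_R_eq with (1 := H). clear H.
  destruct (Nat.eqb_spec m 0) as [Hm|Hm].
  - subst m. replace (map g (div_list (S n))) with (map (fun _ : nat => 0) (div_list (S n))).
    + generalize (div_list (S n)). intros l. induction l as [|d l IH]; simpl; auto. unfold fold_sum in *. rewrite IH; ring.
    + apply map_ext_in. intros d Hd. apply in_div_list in Hd. destruct Hd as [Hd Hmod].
      assert (E : (S n = d * (S n / d))%nat) by (apply Nat.Div0.div_exact; auto).
      unfold g. destruct (Nat.eqb_spec (S n / d) 0) as [E2|_]; [rewrite E2 in E; lia|ring].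
  - assert (Hnd : NoDup (div_list (S n))) by (apply NoDup_filter, seq_NoDup).
    destruct (Nat.eqb_spec (Nat.modulo (S n) m) 0) as [Hd|Hd].
    + assert (E : (S n = m * (S n / m))%nat) by (apply Nat.Div0.div_exact; auto).
      replace (map g (div_list (S n))) with (map (fun d => if Nat.eqb d (S n / m) then INR (S n / m) ^ k / 2 else 0) (div_list (S n))).
      * rewrite fold_sum_indicator by auto. destruct (in_dec Nat.eq_dec (S n / m)%nat (div_list (S n))) as [_|Hin]; auto.
        exfalso. apply Hin. apply in_div_list. split; [nia|].
        rewrite E at 1. rewrite Nat.Div0.mod_mul. auto.
      * apply map_ext_in. intros d Hin. apply in_div_list in Hin. destruct Hin as [Hd1 Hd2].
        assert (Ed : (S n = d * (S n / d))%nat) by (apply Nat.Div0.div_exact; auto).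
        unfold g. destruct (Nat.eqb_spec d (S n / m)) as [E1|E1], (Nat.eqb_spec (S n / d) m) as [E2|E2].
        -- rewrite E1. field.
        -- exfalso. apply E2. rewrite <- E1 in E. nia.
        -- exfalso. apply E1. rewrite E2 in Ed. nia.
        -- ring.
    + replace (map g (div_list (S n))) with (map (fun _ : nat => 0) (div_list (S n))).
      * generalize (div_list (S n)). intros l. induction l as [|d l IH]; simpl; auto. unfold fold_sum in *. rewrite IH; ring.
      * apply map_ext_in. intros d Hin. apply in_div_list in Hin. destruct Hin as [Hd1 Hd2].
        assert (Ed : (S n = d * (S n / d))%nat) by (apply Nat.Div0.div_exact; auto).
        unfold g. destruct (Nat.eqb_spec (S n / d) m) as [E2|E2]; [|ring].
        exfalso. apply Hd. rewrite E2 in Ed. rewrite Ed. apply Nat.Div0.mod_mul.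
Qed.

(** The given series only has terms at multiples of [m], so its partial sums up to [m * D] are the
    partial sums of the wanted series: convergence passes to this subsequence. *)
Lemma is_series_multiples (G : nat -> R) (m : nat) (L : R) :
  (0 < m)%nat ->
  is_series (fun n => if Nat.eqb (Nat.modulo (S n) m) 0 then G (S n / m)%nat else 0) L ->
  is_series (fun d => G (S d)) L.
Proof.
  intros Hm HL. set (h := fun n => if Nat.eqb (Nat.modulo (S n) m) 0 then G (S n / m)%nat else 0) in HL.
  pose (P := fun n => sum_n (fun d => G (S d)) n).
  (* Partial sums normalized to be empty at [0], so that blocks end exactly at multiples of [m]. *)
  pose (A := fix A N := match N with O => 0 | S p => A p + h p end).
  pose (B := fix B N := match N with O => 0 | S p => B p + G (S p) end).
  assert (HA : forall n, sum_n h n = A (S n)).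
  { induction n as [|n IH]; [rewrite sum_O; simpl; ring|]. rewrite sum_Sn, IH. reflexivity. }
  assert (HB : forall n, sum_n (fun d => G (S d)) n = B (S n)).
  { induction n as [|n IH]; [rewrite sum_O; simpl; ring|]. rewrite sum_Sn, IH. reflexivity. }
  assert (Hin : forall D j, (j < m)%nat -> A (m * D + j)%nat = A (m * D)%nat).
  { intros D j. induction j as [|j IH]; intros Hj; [rewrite Nat.add_0_r; auto|].
    rewrite Nat.add_succ_r. change (A (m * D + j)%nat + h (m * D + j)%nat = A (m * D)%nat).
    rewrite IH by lia. unfold h. replace (S (m * D + j)) with (S j + D * m)%nat by lia.
    rewrite Nat.Div0.mod_add, Nat.mod_small by lia. simpl. ring. }
  assert (HAB : forall D, A (m * D)%nat = B D).
  { induction D as [|D IH]; [rewrite Nat.mul_0_r; auto|].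
    replace (m * S D)%nat with (S (m * D + (m - 1))) by lia.
    change (A (m * D + (m - 1))%nat + h (m * D + (m - 1))%nat = B D + G (S D)).
    rewrite Hin, IH by lia. f_equal. unfold h.
    replace (S (m * D + (m - 1))) with (S D * m)%nat by lia.
    rewrite Nat.Div0.mod_mul, Nat.div_mul by lia. auto. }
  change (is_lim_seq (sum_n (fun d => G (S d))) L).
  apply is_lim_seq_ext with (fun D => sum_n h (m * S D - 1)).
  { intros D. rewrite HA, HB. replace (S (m * S D - 1)) with (m * S D)%nat by nia. apply HAB. }
  apply (is_lim_seq_subseq (sum_n h) L (fun D => (m * S D - 1)%nat)).
  - apply eventually_subseq. intros n. nia.
  - exact HL.
Qed.

Definition lambert (k : nat) (y t : R) : R := Series (fun n => twisted_sigma k (S n) t * exp (- (INR (S n) * y))).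

Lemma lambert_term_bound (k : nat) : exists M, 0 < M /\ forall n y t, 0 < y ->
  Rabs (twisted_sigma k (S n) t * exp (- (INR (S n) * y))) <= M * Rpower (INR n + 1) (- (2)) * Rpower y (- (INR k + 3)).
Proof.
  (* The divisor sum is at most [n^(k+1)]; the exponent [k + 3] leaves the summable [n^(-2)]. *)
  destruct (pow_exp_le (S k) (INR k + 3)) as [M [HM H]]; [generalize (pos_INR k); lra|].
  exists M. split; auto. intros n y t Hy.
  assert (Hn : 0 < INR (S n)) by (apply lt_0_INR; lia).
  specialize (H y (INR (S n)) Hy Hn). rewrite (S_INR k) in H.
  replace (INR k + 1 - (INR k + 3)) with (- (2)) in H by ring.
  rewrite Rabs_mult, (Rabs_pos_eq (exp _)) by (left; apply exp_pos).
  rewrite <- S_INR.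
  apply Rle_trans with (INR (S n) ^ S k * exp (- (INR (S n) * y))); [|lra].
  apply Rmult_le_compat_r; [left; apply exp_pos|apply twisted_sigma_bound].
Qed.

Lemma lambert_bound_summable (k : nat) (y : R) : 0 < y -> exists b, ex_series b /\ forall n t,
  Rabs (twisted_sigma k (S n) t * exp (- (INR (S n) * y))) <= b n.
Proof.
  intros Hy. destruct (lambert_term_bound k) as [M [HM H]].
  exists (fun n => (M * Rpower y (- (INR k + 3))) * Rpower (INR n + 1) (- (2))). split.
  - apply (ex_series_scal (K := R_AbsRing) (V := R_NormedModule)). apply ex_series_Rpower; lra.
  - intros n t. apply Rle_trans with (1 := H n y t Hy). right; ring.
Qed.

Lemma lambert_series k y t : 0 < y ->
  is_series (fun n => twisted_sigma k (S n) t * exp (- (INR (S n) * y))) (lambert k y t).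
Proof.
  intros Hy. destruct (lambert_bound_summable k y Hy) as [b [Hb H]]. apply Series_correct.
  apply (ex_series_le (V := R_CompleteNormedModule)) with b; [intros n; apply H|auto].
Qed.

Lemma lambert_continuous k y t : 0 < y -> continuous (lambert k y) t.
Proof.
  intros Hy. destruct (lambert_bound_summable k y Hy) as [b [Hb H]].
  apply (continuous_series (fun n t => twisted_sigma k (S n) t * exp (- (INR (S n) * y))) b _ t 1 Rlt_0_1 Hb).
  - intros n. apply (continuous_mult (twisted_sigma k (S n)) (fun _ => exp (- (INR (S n) * y)))); [apply twisted_sigma_continuous|apply continuous_const].
  - intros n s _. apply H.
  - intros s _. apply lambert_series; auto.
Qed.

(** Only [n = d m] contributes to mode [m], with weight [d^k / 2], and the remaining sum over [d] is
    the one in [lipschitz_sum]. *)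
Lemma lambert_cos (k m : nat) (y : R) : 0 < y ->
  is_RInt (fun t => lambert k y t * cos_mode m t) 0 1
    (if Nat.eqb m 0 then 0 else tail_sum k (INR m * y) 0 / 2).
Proof.
  intros Hy. destruct (lambert_bound_summable k y Hy) as [b [Hb H]].
  pose (I := fun n => (if Nat.eqb m 0 then 0 else if Nat.eqb (Nat.modulo (S n) m) 0 then INR (S n / m) ^ k / 2 else 0) * exp (- (INR (S n) * y))).
  destruct (is_RInt_series_R (fun n t => twisted_sigma k (S n) t * exp (- (INR (S n) * y)) * cos_mode m t) b
    (fun t => lambert k y t * cos_mode m t) I 0 1) as [L [HL1 HL2]]; [lra|auto| | | |].
  - intros n t _. rewrite Rabs_mult. specialize (H n t).
    generalize (Rabs_cos_mode_le m t) (Rabs_pos (cos_mode m t)) (Rabs_pos (twisted_sigma k (S n) t * exp (- (INR (S n) * y)))). nra.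
  - intros t _. apply is_series_ext with (fun n => cos_mode m t * (twisted_sigma k (S n) t * exp (- (INR (S n) * y)))); [intros; apply Rmult_comm|].
    rewrite Rmult_comm. apply (is_series_scal (K := R_AbsRing) (V := R_NormedModule) (cos_mode m t) _ (lambert k y t)).
    apply lambert_series; auto.
  - intros n. apply is_RInt_ext_R with (fun t => exp (- (INR (S n) * y)) * (twisted_sigma k (S n) t * cos_mode m t)); [intros; ring|].
    apply is_RInt_R_eq with (1 := is_RInt_scal (V := R_NormedModule) _ _ _ (exp (- (INR (S n) * y))) _ (twisted_sigma_cos k n m)).
    apply Rmult_comm.
  - apply is_RInt_R_eq with (1 := HL2). destruct (Nat.eqb_spec m 0) as [Hm|Hm].
    + rewrite <- (is_series_unique _ _ HL1). unfold I. subst m. simpl Nat.eqb. cbv iota.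
      rewrite (Series_ext _ (fun n => 0 * 0)) by (intros; ring). rewrite Series_scal_l. ring.
    + assert (HG := is_series_multiples (fun d => pexp k (INR m * y) (INR d) / 2) m L ltac:(lia)).
      assert (HS : is_series (fun d => pexp k (INR m * y) (INR (S d)) / 2) L).
      { apply HG. apply is_series_ext with (2 := HL1). intros n. unfold I.
        destruct (Nat.eqb_spec m 0) as [|_]; [lia|]. destruct (Nat.eqb_spec (Nat.modulo (S n) m) 0) as [Hd|Hd].
        - assert (E : (S n = m * (S n / m))%nat) by (apply Nat.Div0.div_exact; auto).
          unfold pexp. replace (INR (S n) * y) with (INR (S n / m) * (INR m * y)).
          + match goal with |- ?x = ?z => change (@eq R x z) end. field.
          + rewrite E at 2. rewrite mult_INR. ring.
        - match goal with |- ?x = ?z => change (@eq R x z) end. ring. }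
      assert (Hmy : 0 < INR m * y) by (apply Rmult_lt_0_compat; auto; apply lt_0_INR; lia).
      assert (HT := is_series_scal (K := R_AbsRing) (V := R_NormedModule) (/ 2) _ _ (tail_sum_series k (INR m * y) 0 Hmy ltac:(lra))).
      rewrite <- (is_series_unique _ _ HS). apply is_series_unique.
      match goal with |- is_series _ ?l => replace l with (/ 2 * tail_sum k (INR m * y) 0) by (unfold Rdiv; ring) end.
      apply is_series_ext with (2 := HT). intros n. rewrite Rplus_0_r. unfold scal; simpl; unfold mult; simpl.
      match goal with |- ?x = ?z => change (@eq R x z) end. unfold Rdiv; ring.
Qed.

(** * The modular identity *)

Lemma kap_0 (K : nat) (z : R) : 0 < z -> kap K z 0 = / z ^ K.
Proof.
  intros Hz. unfold kap. change ((z, 0) : C) with (RtoC z). rewrite <- RtoC_pow.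
  rewrite <- RtoC_inv; [reflexivity|]. apply pow_nonzero; lra.
Qed.

Lemma Re_Cinv_conj (z : C) : Re (/ Cconj z)%C = Re (/ z)%C.
Proof.
  destruct z as [a b]. unfold Cinv, Cconj, Re; simpl. f_equal. f_equal. ring.
Qed.

Lemma kap_opp (K : nat) (z om : R) : kap K z (- om) = kap K z om.
Proof.
  unfold kap. change ((z, - om) : C) with (Cconj (z, om)). rewrite <- Cpow_conj. apply Re_Cinv_conj.
Qed.

(* [r w + 2 pi i m = (2 pi i / y) (m y - 2 pi i r)] for [w = 4 pi^2 / y]. *)
Lemma kap_modular (l : nat) (y r m : R) : 0 < y ->
  0 < m -> (-1) ^ S l * (2 * PI / y) ^ (2 * S l) * kap (2 * S l) (r * (4 * PI ^ 2 / y)) (2 * PI * m)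
  = kap (2 * S l) (m * y) (2 * PI * r).
Proof.
  intros Hy Hm. assert (HPI := PI_RGT_0). set (b := 2 * PI / y).
  assert (Hb : 0 < b) by (apply Rdiv_lt_0_compat; lra).
  set (c := (-1) ^ S l * b ^ (2 * S l)).
  assert (Hc : c <> 0).
  { unfold c. apply Rmult_integral_contrapositive. split; apply pow_nonzero; lra. }
  (* Factoring out [i b] produces the frequency [- 2 pi r]; conjugation inside the real part
     restores the sign. The exponent [2 * S l] is even, so [(i b)^(2 * S l)] is the real number [c]
     and leaves the real part. *)
  rewrite <- (kap_opp _ (m * y)).
  assert (Hpow : Cpow (0, b) (2 * S l) = RtoC c).
  { rewrite Cpow_mult_r. replace (Cpow (0, b) 2) with (RtoC (-1 * b ^ 2)).
    - rewrite <- RtoC_pow. f_equal. unfold c. rewrite Rpow_mult_distr, pow_mult. reflexivity.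
    - simpl. unfold Cmult, RtoC; simpl. f_equal; ring. }
  assert (E : ((r * (4 * PI ^ 2 / y), 2 * PI * m) : C) = ((0, b) * (m * y, - (2 * PI * r))%R)%C).
  { unfold Cmult; simpl. f_equal; unfold b; field; lra. }
  unfold kap. rewrite E, Cpow_mult_l, Hpow.
  set (X := Cpow (m * y, - (2 * PI * r)) (2 * S l)).
  assert (HX : X <> 0).
  { apply Cpow_nz. intros K. apply (f_equal Re) in K. unfold Re in K; simpl in K. nra. }
  replace (/ (RtoC c * X))%C with (RtoC (/ c) * / X)%C.
  - replace (Re (RtoC (/ c) * / X)%C) with (/ c * Re (/ X)%C) by (unfold Re; simpl; ring).
    field. auto.
  - rewrite RtoC_inv by auto. field. split; auto. intros K; apply RtoC_inj in K; auto.
Qed.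

(** Both sides are continuous up to the endpoints and invariant under [t |-> 1 - t], so it is enough
    to compare cosine coefficients. Under the Mellin integral with [y] the inverse of the variable,
    the constant yields the [zeta (- k)] term, the Bernoulli values yield [zeta (- k, theta)] and
    [zeta (- k, 1 - theta)], and the double sums yield the double series. *)
Lemma lambert_identity (l : nat) (y t : R) : 0 < y -> 0 < t < 1 ->
  lambert (S (2 * l)) y t =
    INR (fact (S (2 * l))) * bern (2 * S l) 1 / 2
    + (-1) ^ S l * (2 * PI / y) ^ (2 * S l) *
      (- INR (fact (S (2 * l))) * (bern (2 * S l) t + bern (2 * S l) (1 - t)) / 4
       + (double_sum (2 * l) (4 * PI ^ 2 / y) t + double_sum (2 * l) (4 * PI ^ 2 / y) (1 - t)) / 2).
Proof.
  intros Hy Ht. assert (HPI := PI_RGT_0).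
  set (F := INR (fact (S (2 * l)))). set (cc := (-1) ^ S l * (2 * PI / y) ^ (2 * S l)).
  set (w := 4 * PI ^ 2 / y). set (B := bern (2 * S l)). set (D := double_sum (2 * l) w).
  assert (Hw : 0 < w) by (apply Rdiv_lt_0_compat; [assert (0 < PI ^ 2) by (apply pow_lt; auto); lra|auto]).
  assert (HK : S (S (2 * l)) = (2 * S l)%nat) by lia.
  (* Only the symmetrization of [h] enters [f], so its cosine coefficients double and the sine
     coefficients of [f] vanish by symmetry. *)
  pose (h := fun t => cc * (- F / 4) * B t + cc / 2 * D t).
  pose (f := fun t => lambert (S (2 * l)) y t - F * B 1 / 2 - (h t + h (1 - t))).
  assert (Hrefl : forall s, continuous (fun t => 1 - t) s).
  { intros s. apply (ex_derive_continuous (V := R_NormedModule)). auto_derive; auto. }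
  assert (Hhc : forall s, 0 <= s -> continuous h s).
  { intros s Hs. apply (continuous_plus (V := R_NormedModule) (fun t => cc * (- F / 4) * B t) (fun t => cc / 2 * D t)).
    - apply (continuous_mult (fun _ => cc * (- F / 4)) B); [apply continuous_const|apply bern_continuous].
    - apply (continuous_mult (fun _ => cc / 2) D); [apply continuous_const|apply double_sum_continuous; auto]. }
  assert (Hfc : forall s, 0 <= s <= 1 -> continuous f s).
  { intros s Hs.
    apply (continuous_minus (V := R_NormedModule) (fun t => lambert (S (2 * l)) y t - F * B 1 / 2) (fun t => h t + h (1 - t))).
    - apply (continuous_minus (V := R_NormedModule) (lambert (S (2 * l)) y) (fun _ => F * B 1 / 2)); [apply lambert_continuous; auto|apply continuous_const].
    - apply (continuous_plus (V := R_NormedModule) h (fun t => h (1 - t))); [apply Hhc; lra|].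
      apply (continuous_comp (fun t => 1 - t) h); [apply Hrefl|apply Hhc; lra]. }
  assert (Hcos : forall m, is_RInt (fun t => f t * cos_mode m t) 0 1 0).
  { intros m. assert (H1 := lambert_cos (S (2 * l)) m y Hy).
    assert (H2 := is_RInt_scal (V := R_NormedModule) _ _ _ (F * B 1 / 2) _ (is_RInt_cos_mode m)).
    destruct (double_sum_cos (2 * l) m w Hw) as [L [HL1 HL2]].
    assert (HB : exists I, is_RInt (fun t => B t * cos_mode m t) 0 1 I /\
       I = if Nat.eqb m 0 then 0 else (-1) ^ l / (2 * PI * INR m) ^ (2 * S l)).
    { destruct m as [|m]; eexists; split.
      - unfold B. rewrite <- HK. apply bern_cos_0.
      - reflexivity.
      - apply bern_cos.
      - reflexivity. }
    destruct HB as [I [HB HI]].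
    assert (Hh : is_RInt (fun t => h t * cos_mode m t) 0 1 (cc * (- F / 4) * I + cc / 2 * L)).
    { apply is_RInt_ext_R with (2 := is_RInt_plus (V := R_NormedModule) _ _ _ _ _ _
        (is_RInt_scal (V := R_NormedModule) _ _ _ (cc * (- F / 4)) _ HB) (is_RInt_scal (V := R_NormedModule) _ _ _ (cc / 2) _ HL1)).
      intros s _. unfold h, D, plus, scal; simpl; unfold mult; simpl. ring. }
    apply cos_coef_sym in Hh.
    assert (H := is_RInt_minus (V := R_NormedModule) _ _ _ _ _ _ (is_RInt_minus (V := R_NormedModule) _ _ _ _ _ _ H1 H2) Hh).
    apply is_RInt_R_eq with (I := (if Nat.eqb m 0 then 0 else tail_sum (S (2 * l)) (INR m * y) 0 / 2)
       - F * B 1 / 2 * (if Nat.eqb m 0 then 1 else 0) - 2 * (cc * (- F / 4) * I + cc / 2 * L)).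
    { apply is_RInt_ext_R with (2 := H). intros s _. unfold f, minus, plus, opp, scal; simpl; unfold mult; simpl. ring. }
    rewrite <- (is_series_unique _ _ HL2), Series_scal_l. fold F. rewrite HK, HI. clear HL1 HL2 HB Hh H H1 H2 HI.
    assert (Hsgn : (-1) ^ S l = - (-1) ^ l) by (simpl; ring).
    assert (Hsq : (-1) ^ l * (-1) ^ l = 1) by (rewrite <- Rpow_mult_distr; replace (-1 * -1) with 1 by ring; apply pow1).
    destruct m as [|m]; simpl Nat.eqb; cbv iota.
    (* Zero mode: with [w = 4 pi^2 / y] the zero mode of the double sum is a multiple of
       [zeta (2 l + 2)], which is the constant by [bern_at_1]. *)
    - unfold B. rewrite bern_at_1.
      assert (E : cc * Series (fun r => kap (2 * S l) (INR (S r) * w) (2 * PI * INR 0)) =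
         - (-1) ^ l * Series (fun r => / (2 * PI * INR (S r)) ^ (2 * S l))).
      { rewrite <- !Series_scal_l. apply Series_ext. intros r.
        assert (Hr : 0 < INR (S r)) by (apply lt_0_INR; lia).
        replace (2 * PI * INR 0) with 0 by (simpl; ring).
        rewrite kap_0 by (apply Rmult_lt_0_compat; auto). unfold cc. rewrite Hsgn.
        rewrite Rmult_assoc. f_equal. rewrite <- !pow_inv, <- Rpow_mult_distr. f_equal.
        unfold w. field. repeat split; lra. }
      rewrite Rmult_0_r, Rmult_1_r.
      replace (2 * (0 + cc / 2 * (F * Series (fun r => kap (2 * S l) (INR (S r) * w) (2 * PI * INR 0))))) with
        (F * (cc * Series (fun r => kap (2 * S l) (INR (S r) * w) (2 * PI * INR 0)))) by field.
      rewrite E. field.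
    (* Positive mode: the isolated term [kap_0] of the Lipschitz formula is met by the Bernoulli
       coefficient, its series by the double sum through [kap_modular]. *)
    - assert (Hm : 0 < INR (S m)) by (apply lt_0_INR; lia).
      rewrite lipschitz_sum by (apply Rmult_lt_0_compat; auto). fold F. rewrite HK, kap_0 by (apply Rmult_lt_0_compat; auto).
      assert (E : cc * Series (fun r => kap (2 * S l) (INR (S r) * w) (2 * PI * INR (S m))) =
         Series (fun r => kap (2 * S l) (INR (S m) * y) (2 * PI * INR (S r)))).
      { rewrite <- Series_scal_l. apply Series_ext. intros r. apply kap_modular; auto. }
      replace (2 * (cc * (- F / 4) * ((-1) ^ l / (2 * PI * INR (S m)) ^ (2 * S l)) +
         cc / 2 * (F * Series (fun r => kap (2 * S l) (INR (S r) * w) (2 * PI * INR (S m)))))) with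
        (- F / 2 * (cc * ((-1) ^ l / (2 * PI * INR (S m)) ^ (2 * S l))) +
          F * (cc * Series (fun r => kap (2 * S l) (INR (S r) * w) (2 * PI * INR (S m))))).
      2:{ unfold Rdiv. field. apply pow_nonzero. nra. }
      rewrite E.
      assert (E2 : cc * ((-1) ^ l / (2 * PI * INR (S m)) ^ (2 * S l)) = - / (INR (S m) * y) ^ (2 * S l)).
      { unfold cc. rewrite Hsgn.
        replace (- (-1) ^ l * (2 * PI / y) ^ (2 * S l) * ((-1) ^ l / (2 * PI * INR (S m)) ^ (2 * S l)))
         with (- ((-1) ^ l * (-1) ^ l) * ((2 * PI / y) ^ (2 * S l) * / (2 * PI * INR (S m)) ^ (2 * S l))) by (unfold Rdiv; ring).
        rewrite Hsq, <- !pow_inv, <- Rpow_mult_distr.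
        replace (2 * PI / y * / (2 * PI * INR (S m))) with (/ (INR (S m) * y)) by (field; repeat split; lra). ring. }
      rewrite E2. field. apply pow_nonzero. nra. }
  assert (Hsym : forall s, 0 < s < 1 -> f (1 - s) = f s).
  { intros s Hs. unfold f. replace (1 - (1 - s)) with s by ring.
    assert (E : lambert (S (2 * l)) y (1 - s) = lambert (S (2 * l)) y s).
    { unfold lambert. apply Series_ext. intros n. rewrite twisted_sigma_sym. auto. }
    rewrite E. ring. }
  assert (Hz : f t = 0).
  { apply fourier_unique; auto. intros m. split; [apply Hcos|apply is_RInt_sym_sin; auto]. }
  unfold f, h in Hz. fold D. fold (B t) (B (1 - t)) in *. lra.
Qed.

(** * Mellin transforms of the two sides *)

Lemma is_series_RtoC (u : nat -> R) (l : R) :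
  is_series u l -> is_Cseries (fun n => RtoC (u n)) (RtoC l).
Proof.
  intros H. apply is_series_C_eps. intros eps He.
  destruct (proj1 (is_series_eps (V := R_NormedModule) u l) H eps He) as [N HN]. exists N. intros n Hn.
  assert (E : forall n, sum_n (G := C_AbelianMonoid) (fun n => RtoC (u n)) n = RtoC (sum_n u n)).
  { induction n0 as [|m IH]; [rewrite !sum_O; auto|]. rewrite !sum_Sn, IH.
    change ((RtoC (sum_n u m) + RtoC (u (S m)))%C = RtoC (sum_n u m + u (S m))). rewrite RtoC_plus. auto. }
  rewrite E, <- RtoC_minus, Cmod_R. exact (HN n Hn).
Qed.

Lemma continuous_exp_lin_mult (c : R) (g : R -> R) (t : R) :
  continuous g t -> continuous (fun t => exp (- (c * t)) * g t) t.
Proof. intros H. apply (continuous_mult (fun t => exp (- (c * t))) g); [apply continuous_exp_lin|auto]. Qed.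

Lemma ex_series_scal_R (u : nat -> R) (c : R) : ex_series u -> ex_series (fun n => c * u n).
Proof. apply (ex_series_scal (K := R_AbsRing) (V := R_NormedModule)). Qed.

(** Two successive applications of [CInt_pos_series], over [m] and then over [r], with one majorant.
    The value of each term comes from [Gamma_mellin]. *)
Lemma double_sum_mellin (k : nat) (nu : C) (c th : R) :
  0 < Re nu -> 0 < c -> 0 < th ->
  let s := (nu + RtoC (INR (S k)) + 1)%C in
  let q := fun r m => (RtoC ((INR m + th) ^ S k) / Rpow_C (4 * PI ^ 2 / c * (INR (S r) * (INR m + th)) + 1) s)%C in
  exists (inner : nat -> C) (Rsum : C),
    (forall r, is_Cseries (q r) (inner r)) /\
    is_Cseries inner Rsum /\
    is_CInt_pos (fun t => Rpow_C t (s - 1) * RtoC (exp (- (c * t)) * double_sum k (4 * PI ^ 2 * t) th))%C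
      (Gamma s / Rpow_C c s * Rsum)%C.
Proof.
  intros Hnu Hc Hth s q. assert (HPI := PI_RGT_0).
  assert (HP2 : 0 < 4 * PI ^ 2) by (assert (0 < PI ^ 2) by (apply pow_lt; auto); lra).
  set (P2 := 4 * PI ^ 2) in *. set (sg := Re nu) in *.
  set (Kr := INR (S k)). assert (HKr : 0 < Kr) by (apply lt_0_INR; lia).
  assert (Hres : Re s = sg + Kr + 1) by reflexivity.
  (* The exponent [p = Kr + 1 + d] spends half of [Re nu]: a term is then bounded by [(r + 1)^(-p)]
     in [r], by [(m + th)^(-(1 + d))] in [m] and by [t^(d - 1)] near [t = 0], and each of the three
     converges. *)
  set (d := sg / 2). assert (Hd : 0 < d) by (unfold d; lra).
  set (p := Kr + 1 + d). assert (Hp : 1 < p) by (unfold p; lra).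
  destruct (pow_exp_le (S k) p) as [M [HM HMb]]; [lra|]. fold Kr in HMb.
  destruct (majorant_bound d c Hd Hc) as [M' [HM' HMb']].
  assert (HpPi := Rpower_pos P2 (- p)).
  set (A := M * Rpower P2 (- p) * M'). assert (HA : 0 < A) by (unfold A; apply Rmult_lt_0_compat; auto; apply Rmult_lt_0_compat; auto).
  set (W := fun t => (Rpow_C t (s - 1) * RtoC (exp (- (c * t))))%C).
  set (br := fun r => A * Rpower (INR r + 1) (- p)).
  set (um := fun m => Rpower (INR m + th) (- (1 + d))).
  assert (Hbr : forall r, 0 < br r) by (intros r; apply Rmult_lt_0_compat; auto; apply Rpower_pos).
  assert (Hum : forall m, 0 < um m) by (intros m; apply Rpower_pos).
  assert (Hsr : ex_series br) by (apply ex_series_scal_R, ex_series_Rpower; lra).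
  assert (Hsm : ex_series um) by (apply ex_series_Rpower; lra).
  assert (Hu : forall m, 0 < INR m + th) by (intros m; generalize (pos_INR m); lra).
  assert (HW : forall t, 0 < t -> Cmod (W t) = Rpower t (sg + Kr) * exp (- (c * t))).
  { intros t Ht. unfold W. rewrite Cmod_mult, Cmod_Rpow_C, Cmod_R, Rabs_pos_eq by (left; apply exp_pos).
    f_equal. f_equal. replace (Re (s - 1)%C) with (Re s - 1) by (unfold Re; simpl; ring). rewrite Hres. ring. }
  assert (Hterm : forall r m t, 0 < t ->
     Cmod (W t * RtoC (pexp (S k) (INR (S r) * (P2 * t)) (INR m + th)))%C <= br r * um m * majorant d t).
  { intros r m t Ht. rewrite Cmod_mult, HW, Cmod_R, Rabs_pos_eq by (auto; apply pexp_nonneg; left; apply Hu).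
    assert (Hr : 0 < INR (S r)) by (apply lt_0_INR; lia).
    assert (E1 := HMb (INR (S r) * (P2 * t)) (INR m + th) ltac:(apply Rmult_lt_0_compat; nra) (Hu m)).
    replace (Kr - p) with (- (1 + d)) in E1 by (unfold p; ring). fold (um m) in E1.
    rewrite <- !Rpower_mult_distr in E1 by (auto; nra).
    assert (E2 := HMb' t Ht). assert (E3 := exp_pos (- (c * t))).
    assert (E4 : Rpower t (sg + Kr) * Rpower t (- p) = Rpower t (d - 1)).
    { rewrite <- Rpower_plus. f_equal. unfold p, d. field. }
    apply Rle_trans with (Rpower t (sg + Kr) * exp (- (c * t)) *
       (M * (Rpower (INR (S r)) (- p) * (Rpower P2 (- p) * Rpower t (- p))) * um m)).
    - apply Rmult_le_compat_l; [|exact E1]. apply Rmult_le_pos; left; [apply Rpower_pos|auto].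
    - replace (Rpower t (sg + Kr) * exp (- (c * t)) * (M * (Rpower (INR (S r)) (- p) * (Rpower P2 (- p) * Rpower t (- p))) * um m))
       with ((M * Rpower P2 (- p)) * Rpower (INR (S r)) (- p) * um m * ((Rpower t (sg + Kr) * Rpower t (- p)) * exp (- (c * t)))) by ring.
      rewrite E4. unfold br, A. rewrite S_INR.
      replace (M * Rpower P2 (- p) * M' * Rpower (INR r + 1) (- p) * um m * majorant d t) with
        (M * Rpower P2 (- p) * Rpower (INR r + 1) (- p) * um m * (M' * majorant d t)) by ring.
      apply Rmult_le_compat_l; auto. assert (F1 := Rpower_pos (INR r + 1) (- p)). assert (F2 := Hum m).
      apply Rmult_le_pos; [apply Rmult_le_pos; [apply Rmult_le_pos|]|]; lra. }
  assert (Hprim := primitive_majorant d Hd).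
  set (T := fun r m => P2 / c * (INR (S r) * (INR m + th)) + 1).
  assert (HT : forall r m, 1 < T r m /\ P2 / c * (INR (S r) * (INR m + th)) <= T r m /\
      0 < P2 / c * (INR (S r) * (INR m + th))).
  { intros r m. assert (H : 0 < P2 / c * (INR (S r) * (INR m + th))).
    { apply Rmult_lt_0_compat; [apply Rdiv_lt_0_compat; auto|]. apply Rmult_lt_0_compat; auto. apply lt_0_INR; lia. }
    unfold T. lra. }
  (* [exp (- c t)] times the exponential inside [pexp] is [exp (- c T t)], so the Gamma integral at
     [c * T] contributes the factor [T^(-s)] of the double series. *)
  assert (HG : forall r m, is_CInt_pos (fun t => W t * RtoC (pexp (S k) (INR (S r) * (P2 * t)) (INR m + th)))%C
      (Gamma s / Rpow_C c s * q r m)%C).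
  { intros r m. destruct (HT r m) as [H1 [H2 H3]].
    assert (E := Gamma_mellin s (c * T r m) ltac:(rewrite Hres; lra) ltac:(nra)).
    apply (is_CInt_pos_scal _ _ (RtoC ((INR m + th) ^ S k))) in E.
    rewrite Rpow_C_mult in E by lra.
    replace (Gamma s / Rpow_C c s * q r m)%C with
      (RtoC ((INR m + th) ^ S k) * (Gamma s / (Rpow_C c s * Rpow_C (T r m) s)))%C.
    - apply is_CInt_pos_ext with (2 := E). intros t Ht. unfold W, pexp. rewrite RtoC_mult.
      replace (exp (- (c * T r m * t))) with (exp (- (c * t)) * exp (- ((INR m + th) * (INR (S r) * (P2 * t))))).
      + rewrite RtoC_mult. ring.
      + rewrite <- exp_plus. f_equal. unfold T. field. lra.
    - unfold q. fold (T r m). field. split; apply Rpow_C_neq_0. }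
  (* The bound is direct, since [Gamma s <> 0] is not available to divide by. *)
  set (pp := sg + Kr + 1).
  assert (Hq : forall r m, Cmod (q r m) <= Rpower (P2 / c) (- pp) * Rpower (INR r + 1) (- pp) * Rpower (INR m + th) (- (1 + sg))).
  { intros r m. destruct (HT r m) as [H1 [H2 H3]]. unfold q. fold (T r m).
    assert (Hr : 0 < INR (S r)) by (apply lt_0_INR; lia).
    rewrite Cmod_div by apply Rpow_C_neq_0. rewrite Cmod_Rpow_C, Cmod_R, Rabs_pos_eq by (apply pow_le; left; apply Hu).
    rewrite Hres. fold pp. unfold Rdiv. rewrite <- Rpower_Ropp.
    apply Rle_trans with ((INR m + th) ^ S k * Rpower (P2 / c * (INR (S r) * (INR m + th))) (- pp)).
    - apply Rmult_le_compat_l; [apply pow_le; left; apply Hu|]. apply Rpower_neg_le; auto. unfold pp; lra.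
    - assert (Hpc : 0 < P2 / c) by (apply Rdiv_lt_0_compat; auto).
      rewrite <- !Rpower_mult_distr by (auto; apply Rmult_lt_0_compat; auto).
      rewrite <- (Rpower_pow (S k)) by auto. fold Kr. rewrite S_INR.
      replace (- (1 + sg)) with (Kr + - pp) by (unfold pp; ring). rewrite Rpower_plus. right; unfold Rdiv; ring. }
  assert (Hqm : forall r, exists l, is_Cseries (q r) l).
  { intros r. apply ex_series_C_le with (1 := Hq r). apply ex_series_scal_R, ex_series_Rpower; lra. }
  exists (fun r => Csum (q r)).
  assert (Hin : forall r, is_Cseries (q r) (Csum (q r))) by (intros r; apply Csum_correct; auto).
  destruct (ex_series_Rpower th (1 + sg) Hth ltac:(lra)) as [S1 HS1].
  assert (HR : exists l, is_Cseries (fun r => Csum (q r)) l).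
  { apply ex_series_C_le with (fun r => (Rpower (P2 / c) (- pp) * S1) * Rpower (INR r + 1) (- pp)).
    - intros r.
      replace (Rpower (P2 / c) (- pp) * S1 * Rpower (INR r + 1) (- pp)) with (Rpower (P2 / c) (- pp) * Rpower (INR r + 1) (- pp) * S1) by ring.
      apply (Cmod_series_le (q r) (fun m => Rpower (P2 / c) (- pp) * Rpower (INR r + 1) (- pp) * Rpower (INR m + th) (- (1 + sg)))); auto.
      apply (is_series_scal (K := R_AbsRing) (V := R_NormedModule) (Rpower (P2 / c) (- pp) * Rpower (INR r + 1) (- pp)) _ S1 HS1).
    - apply ex_series_scal_R, ex_series_Rpower; unfold pp; lra. }
  destruct HR as [Rsum HRs]. exists Rsum. split; [exact Hin|split; [exact HRs|]].
  destruct Hsm as [S2 HS2].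
  (* The sum over [m] at fixed [r]. The outer sum then reuses the same majorant with constants
     [S2 * br r]. *)
  assert (Hlat : forall r, (forall x y, 0 < x -> x <= y -> exists J, is_CInt (fun t => W t * RtoC (lattice_sum (S k) (INR (S r) * (P2 * t)) th))%C x y J) /\
      is_CInt_pos (fun t => W t * RtoC (lattice_sum (S k) (INR (S r) * (P2 * t)) th))%C (Gamma s / Rpow_C c s * Csum (q r))%C).
  { intros r.
    destruct (CInt_pos_series (fun m t => W t * RtoC (pexp (S k) (INR (S r) * (P2 * t)) (INR m + th)))%C
      (fun m => br r * um m) (fun t => W t * RtoC (lattice_sum (S k) (INR (S r) * (P2 * t)) th))%C
      (fun m => Gamma s / Rpow_C c s * q r m)%C _ _ _ _ Hprim) as [X1 [L [X2 X3]]].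
    - apply ex_series_scal_R. exists S2; auto.
    - intros m x y Hx Hxy.
      destruct (ex_CInt_Rpow_C (s - 1) (fun t => exp (- (c * t)) * pexp (S k) (INR (S r) * (P2 * t)) (INR m + th)) x y) as [J HJ]; auto.
      + intros t Ht. apply continuous_exp_lin_mult. apply (ex_derive_continuous (V := R_NormedModule)).
        unfold pexp. auto_derive; auto.
      + exists J. apply is_CInt_ext with (2 := HJ). intros t _. unfold W. rewrite RtoC_mult. ring.
    - intros m t Ht. apply Hterm; auto.
    - intros m. apply Rmult_le_pos; left; auto.
    - intros t Ht. apply is_series_C_scal. apply is_series_RtoC. apply lattice_sum_series; auto.
      apply Rmult_lt_0_compat; [apply lt_0_INR; lia|nra].
    - apply HG.
    - split; auto. rewrite (is_series_C_unique _ _ _ (is_series_C_scal _ _ (Gamma s / Rpow_C c s) (Hin r)) X2). exact X3. }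
  destruct (CInt_pos_series (fun r t => W t * RtoC (lattice_sum (S k) (INR (S r) * (P2 * t)) th))%C
      (fun r => S2 * br r) (fun t => W t * RtoC (double_sum k (P2 * t) th))%C
      (fun r => Gamma s / Rpow_C c s * Csum (q r))%C _ _ _ _ Hprim) as [_ [L [X2 X3]]].
  - apply ex_series_scal_R; auto.
  - intros r. apply Hlat.
  - intros r t Ht. replace (S2 * br r * majorant d t) with (br r * majorant d t * S2) by ring.
    apply (Cmod_series_le (fun m => W t * RtoC (pexp (S k) (INR (S r) * (P2 * t)) (INR m + th)))%C (fun m => br r * majorant d t * um m)).
    + intros m. apply Rle_trans with (1 := Hterm r m t Ht). right; ring.
    + apply (is_series_scal (K := R_AbsRing) (V := R_NormedModule) (br r * majorant d t) um S2 HS2).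
    + apply is_series_C_scal. apply is_series_RtoC. apply lattice_sum_series; auto.
      apply Rmult_lt_0_compat; [apply lt_0_INR; lia|nra].
  - intros r. apply Rmult_le_pos; [|left; auto].
    apply is_series_nonneg with (2 := HS2). intros m. left; auto.
  - intros t Ht. apply is_series_C_scal. apply is_series_RtoC. apply double_sum_series; auto. nra.
  - intros r. apply Hlat.
  - rewrite (is_series_C_unique _ _ _ (is_series_C_scal _ _ (Gamma s / Rpow_C c s) HRs) X2).
    apply is_CInt_pos_ext with (2 := X3). intros t Ht. unfold W. rewrite RtoC_mult. fold P2. ring.
Qed.

Lemma lambert_mellin (k : nat) (nu : C) (c th : R) :
  0 < Re nu -> 0 < c ->
  exists L, is_Cseries
      (fun n => RtoC (twisted_sigma k (S n) th) *
         (2 * Rpow_C (sqrt (INR (S n) / c)) nu * BesselK nu (2 * sqrt (c * INR (S n)))))%C L /\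
    is_CInt_pos (fun t => Rpow_C t (nu - 1) * RtoC (exp (- (c * t)) * lambert k (/ t) th))%C L.
Proof.
  intros Hnu Hc. set (sg := Re nu) in *.
  destruct (lambert_term_bound k) as [M [HM HMb]]. assert (Hk := pos_INR k).
  (* At [y = 1 / t] the bound for a Lambert term carries [t^(k+3)], which raises the exponent of the
     majorant from [Re nu] to [d]. *)
  set (d := sg + INR k + 3). assert (Hd : 0 < d) by (unfold d; lra).
  destruct (majorant_bound d c Hd Hc) as [M' [HM' HMb']].
  destruct (CInt_pos_series (fun n t => RtoC (twisted_sigma k (S n) th) *
       (Rpow_C t (nu - 1) * RtoC (exp (- (c * t)) * exp (- (INR (S n) / t)))))%C
     (fun n => (M * M') * Rpower (INR n + 1) (- (2)))
     (fun t => Rpow_C t (nu - 1) * RtoC (exp (- (c * t)) * lambert k (/ t) th))%C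
     (fun n => RtoC (twisted_sigma k (S n) th) *
         (2 * Rpow_C (sqrt (INR (S n) / c)) nu * BesselK nu (2 * sqrt (c * INR (S n)))))%C
     _ _ _ _ (primitive_majorant d Hd)) as [_ [L [X2 X3]]]; [| | | | | |exists L; auto].
  - apply ex_series_scal_R, ex_series_Rpower; lra.
  - intros n x y Hx Hxy.
    destruct (ex_CInt_Rpow_C (nu - 1) (fun t => exp (- (c * t)) * exp (- (INR (S n) / t))) x y) as [J HJ]; auto.
    + intros t Ht. apply continuous_exp_lin_mult. apply (ex_derive_continuous (V := R_NormedModule)).
      auto_derive. lra.
    + exists (RtoC (twisted_sigma k (S n) th) * J)%C. apply is_CInt_scal. exact HJ.
  - intros n t Ht. rewrite !Cmod_mult, !Cmod_R, Cmod_Rpow_C.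
    replace (Re (nu - 1)%C) with (sg - 1) by (unfold sg, Re; simpl; ring).
    assert (E := HMb n (/ t) th ltac:(apply Rinv_0_lt_compat; auto)).
    rewrite Rabs_mult, (Rabs_pos_eq (exp _)) in E by (left; apply exp_pos).
    rewrite (Rabs_pos_eq (_ * _)) by (apply Rmult_le_pos; left; apply exp_pos).
    replace (Rpower (/ t) (- (INR k + 3))) with (Rpower t (INR k + 3)) in E.
    2:{ unfold Rpower. rewrite ln_Rinv by auto. f_equal. ring. }
    change (INR (S n) * / t) with (INR (S n) / t) in E.
    assert (E2 := HMb' t Ht).
    assert (E4 : Rpower t (sg - 1) * Rpower t (INR k + 3) = Rpower t (d - 1)).
    { rewrite <- Rpower_plus. f_equal. unfold d. ring. }
    set (P := Rpower t (sg - 1)) in *. assert (HP : 0 < P) by apply Rpower_pos.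
    assert (He := exp_pos (- (c * t))).
    replace (Rabs (twisted_sigma k (S n) th) * (P * (exp (- (c * t)) * exp (- (INR (S n) / t))))) with
      ((P * exp (- (c * t))) * (Rabs (twisted_sigma k (S n) th) * exp (- (INR (S n) / t)))) by ring.
    apply Rle_trans with ((P * exp (- (c * t))) * (M * Rpower (INR n + 1) (- (2)) * Rpower t (INR k + 3))).
    + apply Rmult_le_compat_l; auto. nra.
    + replace ((P * exp (- (c * t))) * (M * Rpower (INR n + 1) (- (2)) * Rpower t (INR k + 3))) with
       (M * Rpower (INR n + 1) (- (2)) * (P * Rpower t (INR k + 3) * exp (- (c * t)))) by ring.
      rewrite E4. assert (F := Rpower_pos (INR n + 1) (- (2))).
      replace (M * M' * Rpower (INR n + 1) (- (2)) * majorant d t) with (M * Rpower (INR n + 1) (- (2)) * (M' * majorant d t)) by ring.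
      apply Rmult_le_compat_l; nra.
  - intros n. apply Rmult_le_pos; [nra|left; apply Rpower_pos].
  - intros t Ht. rewrite RtoC_mult, Cmult_assoc.
    apply is_series_C_ext with (fun n => Rpow_C t (nu - 1) * RtoC (exp (- (c * t))) * RtoC (twisted_sigma k (S n) th * exp (- (INR (S n) * / t))))%C.
    + intros n. rewrite !RtoC_mult. unfold Rdiv. ring.
    + apply is_series_C_scal, is_series_RtoC. apply lambert_series. apply Rinv_0_lt_compat; auto.
  - intros n. apply is_CInt_pos_scal. apply BesselK_mellin; auto. apply lt_0_INR; lia.
Qed.

Lemma BesselK_argument (a x n : R) : 0 < a -> 0 < x -> 0 < n ->
  2 * sqrt (a ^ 2 * x / 4 * n) = a * sqrt (n * x).
Proof.
  intros Ha Hx Hn. replace (a ^ 2 * x / 4 * n) with ((a / 2) ^ 2 * (n * x)) by field.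
  rewrite sqrt_mult_alt by apply pow2_ge_0. rewrite sqrt_pow2 by lra. field.
Qed.

Lemma Rpow_C_sqrt_quot (n c : R) (nu : C) : 0 < n -> 0 < c ->
  Rpow_C (sqrt (n / c)) nu = (Rpow_C n (nu / 2) / Rpow_C c (nu / 2))%C.
Proof.
  intros Hn Hc. unfold Rpow_C, Cdiv. rewrite <- Cexp_opp, <- Cexp_plus. f_equal.
  replace (ln (sqrt (n / c))) with ((ln n - ln c) / 2).
  - rewrite RtoC_div by lra. rewrite RtoC_minus.
    assert (H2 : RtoC 2 <> 0) by (intros K; apply RtoC_inj in K; lra). field; auto.
  - assert (Hnc : 0 < n / c) by (apply Rdiv_lt_0_compat; auto).
    assert (E : ln (n / c) = ln n - ln c) by (unfold Rdiv; rewrite ln_mult, ln_Rinv; auto using Rinv_0_lt_compat).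
    rewrite <- E. rewrite <- (sqrt_sqrt (n / c)) at 1 by lra.
    rewrite ln_mult by (apply sqrt_lt_R0; auto). field.
Qed.

(** * Comparison of the two evaluations of one Mellin integral *)

Theorem theorem2p10 (a x theta : R) (k : nat) (nu : C)
  (ha : 0 < a) (hx : 0 < x) (htheta0 : 0 < theta) (htheta1 : theta < 1)
  (hk : Nat.Odd k) (hnu : 0 < Re nu) :
  exists (Lsum : C) (inner : nat -> C) (Rsum : C),
    (* sum_{n>=1} n^(nu/2) K_nu(a sqrt(n x)) sum_{d|n} d^k cos(2 pi n theta / d) *)
    is_series (K := C_AbsRing) (V := C_NormedModule)
      (fun n : nat =>
         (Rpow_C (INR (S n)) (nu / 2) * BesselK nu (a * sqrt (INR (S n) * x))%R
          * RtoC (divisor_sum (S n)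
                    (fun d => (INR d ^ k * cos (2 * PI * INR (S n) * theta / INR d))%R)))%C)
      Lsum /\
    (* inner r = sum_{m>=0} { ... } with r+1 in place of r *)
    (forall r : nat,
      is_series (K := C_AbsRing) (V := C_NormedModule)
        (fun m : nat =>
           (RtoC ((INR m + theta) ^ k)%R
              / Rpow_C (16 * PI ^ 2 / a ^ 2 * (INR (S r) * (INR m + theta)) / x + 1)%R
                       (nu + RtoC (INR k) + 1)
            + RtoC ((INR m + 1 - theta) ^ k)%R
              / Rpow_C (16 * PI ^ 2 / a ^ 2 * (INR (S r) * (INR m + 1 - theta)) / x + 1)%R
                       (nu + RtoC (INR k) + 1))%C)
        (inner r)) /\
    is_series (K := C_AbsRing) (V := C_NormedModule) inner Rsum /\
    (Rpow_C (a ^ 2 * x / 4)%R (nu / 2 + RtoC (INR k) + 1) * Lsum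
     = RtoC ((-1) ^ ((k + 1) / 2) * (2 * PI) ^ (k + 1) / 8)%R
         * Gamma (nu + RtoC (INR k) + 1)
         * (hurwitz_zeta (RtoC (- INR k)%R) theta
            + hurwitz_zeta (RtoC (- INR k)%R) (1 - theta)%R)
       + RtoC ((-1) ^ ((k + 1) / 2) * (2 * PI) ^ (k + 1) / 4)%R
         * Gamma (nu + RtoC (INR k) + 1) * Rsum
       - RtoC (a ^ (2 * k + 2) / 2 ^ (2 * k + 4))%R
         * riemann_zeta (RtoC (- INR k)%R) * Gamma nu * RtoC (x ^ (k + 1))%R)%C.
Proof.
  destruct hk as [l Hl]. replace (2 * l + 1)%nat with (S (2 * l)) in Hl by lia. subst k.
  assert (HPI := PI_RGT_0).
  assert (Ha2 : 0 < a ^ 2) by (apply pow_lt; auto).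
  set (c := a ^ 2 * x / 4). assert (Hc : 0 < c) by (unfold c; nra).
  set (s := (nu + RtoC (INR (S (2 * l))) + 1)%C).
  destruct (lambert_mellin (S (2 * l)) nu c theta hnu Hc) as [L [HL1 HL2]].
  destruct (double_sum_mellin (2 * l) nu c theta hnu Hc htheta0) as [i1 [R1 [Hi1 [HR1 HD1]]]].
  destruct (double_sum_mellin (2 * l) nu c (1 - theta) hnu Hc ltac:(lra)) as [i2 [R2 [Hi2 [HR2 HD2]]]].
  fold s in Hi1, HD1, Hi2, HD2.
  assert (H2 : RtoC 2 <> 0) by (intros K; apply RtoC_inj in K; lra).
  (* Each term of [L] carries the factor [2 (n / c)^(nu / 2)] of the Bessel integral; multiplication
     by [c^(nu / 2) / 2] leaves [n^(nu / 2)]. *)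
  exists (Rpow_C c (nu / 2) / 2 * L)%C, (fun r => i1 r + i2 r)%C, (R1 + R2)%C.
  split; [|split; [|split]].
  - apply is_series_C_ext with (2 := is_series_C_scal _ _ (Rpow_C c (nu / 2) / 2) HL1).
    intros n. assert (Hn : 0 < INR (S n)) by (apply lt_0_INR; lia).
    rewrite Rpow_C_sqrt_quot by auto. replace (2 * sqrt (c * INR (S n))) with (a * sqrt (INR (S n) * x)) by (unfold c; symmetry; apply BesselK_argument; auto).
    unfold twisted_sigma. field. apply Rpow_C_neq_0.
  - intros r. apply is_series_C_ext with (2 := is_series_C_plus _ _ _ _ (Hi1 r) (Hi2 r)).
    intros m.
    replace (4 * PI ^ 2 / c * (INR (S r) * (INR m + theta)) + 1) with
      (16 * PI ^ 2 / a ^ 2 * (INR (S r) * (INR m + theta)) / x + 1) by (unfold c; field; lra).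
    replace (4 * PI ^ 2 / c * (INR (S r) * (INR m + (1 - theta))) + 1) with
      (16 * PI ^ 2 / a ^ 2 * (INR (S r) * (INR m + 1 - theta)) / x + 1) by (unfold c; field; lra).
    replace (INR m + (1 - theta)) with (INR m + 1 - theta) by ring. reflexivity.
  - apply is_series_C_plus; auto.
  - replace ((S (2 * l) + 1) / 2)%nat with (S l).
    2:{ replace (S (2 * l) + 1)%nat with (S l * 2)%nat by lia. rewrite Nat.div_mul; auto. }
    replace (S (2 * l) + 1)%nat with (2 * S l)%nat by lia.
    set (F := INR (fact (S (2 * l)))). set (B := bern (2 * S l)).
    set (A0 := F * B 1 / 2). set (E0 := (-1) ^ S l * (2 * PI) ^ (2 * S l)).
    set (B0 := - F * (B theta + B (1 - theta)) / 4).
    assert (HS : S (S (2 * l)) = (2 * S l)%nat) by lia.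
    assert (Hres : 0 < Re s).
    { assert (E : Re s = Re nu + INR (S (2 * l)) + 1) by reflexivity. rewrite E. generalize (pos_INR (S (2 * l))); lra. }
    assert (Hpow : forall t, 0 < t -> Rpow_C t (s - 1) = (Rpow_C t (nu - 1) * RtoC (t ^ (2 * S l)))%C).
    { intros t Ht. rewrite <- Rpow_C_INR, <- Rpow_C_plus by auto. f_equal. unfold s.
      rewrite <- HS, (S_INR (S (2 * l))), RtoC_plus. ring. }
    (* The integral of [lambert_mellin] evaluated through the modular identity at [y = 1 / t]: there
       [(2 pi / y)^(k+1)] contains the power [t^(k+1)] that raises the weight [t^(nu - 1)] to
       [t^(s - 1)]. *)
    assert (HI : is_CInt_pos (fun t => Rpow_C t (nu - 1) * RtoC (exp (- (c * t)) * lambert (S (2 * l)) (/ t) theta))%C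
      (RtoC A0 * (Gamma nu / Rpow_C c nu) + (RtoC (E0 * B0) * (Gamma s / Rpow_C c s) +
        RtoC (E0 / 2) * (Gamma s / Rpow_C c s * R1 + Gamma s / Rpow_C c s * R2)))%C).
    { apply is_CInt_pos_ext with (2 := is_CInt_pos_plus _ _ _ _ (is_CInt_pos_scal _ _ (RtoC A0) (Gamma_mellin nu c hnu Hc))
        (is_CInt_pos_plus _ _ _ _ (is_CInt_pos_scal _ _ (RtoC (E0 * B0)) (Gamma_mellin s c Hres Hc))
          (is_CInt_pos_scal _ _ (RtoC (E0 / 2)) (is_CInt_pos_plus _ _ _ _ HD1 HD2)))).
      intros t Ht. rewrite (lambert_identity l (/ t) theta (Rinv_0_lt_compat _ Ht) (conj htheta0 htheta1)).
      fold F B. rewrite Hpow by auto.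
      replace (2 * PI / / t) with (2 * PI * t) by (field; lra).
      replace (4 * PI ^ 2 / / t) with (4 * PI ^ 2 * t) by (field; lra).
      set (D1 := double_sum (2 * l) (4 * PI ^ 2 * t) theta). set (D2 := double_sum (2 * l) (4 * PI ^ 2 * t) (1 - theta)).
      rewrite Rpow_mult_distr.
      replace (F * B 1 / 2 + (-1) ^ S l * ((2 * PI) ^ (2 * S l) * t ^ (2 * S l)) * (- F * (B theta + B (1 - theta)) / 4 + (D1 + D2) / 2))
        with (A0 + t ^ (2 * S l) * (E0 * B0) + t ^ (2 * S l) * (E0 / 2) * (D1 + D2)) by (unfold A0, E0, B0; field).
      rewrite !RtoC_mult, !RtoC_plus, !RtoC_mult, RtoC_plus. ring. }
    assert (EL := is_CInt_pos_unique _ _ _ HL2 HI). rewrite EL.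
    assert (Hz : forall al, 0 < al -> hurwitz_zeta (RtoC (- INR (S (2 * l)))) al = RtoC (- F * B al)).
    { intros al Hal. rewrite hurwitz_zeta_neg_nat by auto. rewrite HS. reflexivity. }
    unfold riemann_zeta. rewrite !Hz by lra.
    replace (Rpow_C c (nu / 2 + RtoC (INR (S (2 * l))) + 1)) with (Rpow_C c (nu / 2) * RtoC (c ^ (2 * S l)))%C.
    2:{ rewrite <- Rpow_C_INR, <- Rpow_C_plus by auto. f_equal. rewrite <- HS, (S_INR (S (2 * l))), RtoC_plus. ring. }
    assert (Es : Rpow_C c s = (Rpow_C c (nu / 2) * Rpow_C c (nu / 2) * RtoC (c ^ (2 * S l)))%C).
    { rewrite <- Rpow_C_INR, <- !Rpow_C_plus by auto. f_equal. unfold s.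
      rewrite <- HS, (S_INR (S (2 * l))), RtoC_plus. field; auto. }
    assert (En : Rpow_C c nu = (Rpow_C c (nu / 2) * Rpow_C c (nu / 2))%C).
    { rewrite <- Rpow_C_plus. f_equal. field; auto. }
    rewrite Es, En.
    assert (Hcoef : (RtoC (a ^ (2 * S (2 * l) + 2) / 2 ^ (2 * S (2 * l) + 4)) * RtoC (x ^ (2 * S l)))%C = RtoC (c ^ (2 * S l) / 4)).
    { rewrite <- RtoC_mult. f_equal. unfold c.
      replace (2 * S (2 * l) + 2)%nat with (2 * (2 * S l))%nat by lia.
      replace (2 * S (2 * l) + 4)%nat with (2 * (2 * S l) + 2)%nat by lia.
      generalize (2 * S l)%nat. intros n. rewrite pow_add, (pow_mult a), (pow_mult 2).
      unfold Rdiv. rewrite !Rpow_mult_distr, pow_inv. replace (2 ^ 2) with 4 by ring.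
      field. apply pow_nonzero. lra. }
    assert (Hcn : RtoC (c ^ (2 * S l)) <> 0).
    { intros K. apply RtoC_inj in K. assert (0 < c ^ (2 * S l)) by (apply pow_lt; auto). lra. }
    assert (Hp := Rpow_C_neq_0 c (nu / 2)).
    assert (E1 : RtoC (E0 * B0) = (RtoC (E0 / 8) * (RtoC (- F * B theta) + RtoC (- F * B (1 - theta)%R)) * 2)%C).
    { rewrite <- RtoC_plus, <- !RtoC_mult. f_equal. unfold B0. field. }
    assert (E2 : RtoC (E0 / 2) = (RtoC (E0 / 4) * 2)%C) by (rewrite <- RtoC_mult; f_equal; field).
    rewrite E1, E2.
    match goal with |- _ = (?u + ?v - ?A * ?z * ?g * ?X)%C => replace (A * z * g * X)%C with (A * X * z * g)%C by ring end.
    rewrite Hcoef.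
    (* [A0] is minus one half of [zeta (- k)], the Hurwitz value at [1]; this is the origin of the
       negative last term. *)
    assert (E3 : (RtoC (c ^ (2 * S l)) * RtoC A0 = - RtoC (c ^ (2 * S l) / 4) * RtoC (- F * B 1) * 2)%C).
    { rewrite <- RtoC_opp, <- !RtoC_mult. f_equal. unfold A0. field. }
    fold E0.
    transitivity (Rpow_C c (nu / 2) * RtoC (c ^ (2 * S l)) * (Rpow_C c (nu / 2) / 2) *
      ((RtoC (E0 / 8) * (RtoC (- F * B theta) + RtoC (- F * B (1 - theta)%R)) * 2 *
        (Gamma s / (Rpow_C c (nu / 2) * Rpow_C c (nu / 2) * RtoC (c ^ (2 * S l)))) +
        RtoC (E0 / 4) * 2 * (Gamma s / (Rpow_C c (nu / 2) * Rpow_C c (nu / 2) * RtoC (c ^ (2 * S l))) * R1 +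
         Gamma s / (Rpow_C c (nu / 2) * Rpow_C c (nu / 2) * RtoC (c ^ (2 * S l))) * R2)))
      + (RtoC (c ^ (2 * S l)) * RtoC A0) * (Gamma nu / 2))%C.
    + field; auto.
    + rewrite E3. field; auto.
Qed.
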